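(* Let $X$ be a reflexive Banach space with $1$-symmetric basis. Let $\Delta$ be a countable dense subset of $(0,1)$ and let $Y$ be the closed subspace of $JF_X^{*}$ generated by the set of functionals $\{I^{*} : I \text{ is an interval with endpoints in } \Delta\}$. Then the quotient space $JF_X^{*}/Y$ is isomorphic to $X_{\mathbb{R}}^{*}$. In particular, for $X=\ell_2$ (where $JF_X=JF$ is the James function space), $JF^{*}/Y$ is isomorphic to $\ell_2(\mathbb{R})$.
   Context: Let $X$ be a (infinite-dimensional, real) reflexive Banach space with a $1$-symmetric basis $(e_n)_n$, i.e. $\|\sum_n \epsilon_n a_n e_{\pi(n)}\|_X=\|\sum_n a_n e_n\|_X$ for all finitely supported real $(a_n)$, signs $\epsilon_n$ and permutations $\pi$ of $\mathbb{N}$. $JF_X$ is the completion of $L^1((0,1))$ under the norm $\|f\|_{JF_X}=\sup\{\|\sum_{j=1}^m(\int_{I_j}f\,d\mu)e_j\|_X : I_1,\dots,I_m\subset(0,1)\text{ pairwise disjoint open intervals}\}$, where $\mu$ is Lebesgue measure. For an interval $I\subset(0,1)$, $I^{*}\in JF_X^{*}$ is the bounded linear functional determined by $I^{*}(f)=\int_I f\,d\mu$ for $f\in L^1((0,1))$. For an infinite set $\Gamma$, $X_\Gamma$ is the completion of $c_{00}(\Gamma)$ under the norm $\|\sum_{i=1}^n a_i e_{\gamma_i}\|=\|\sum_{i=1}^n a_i e_i\|_X$ for distinct $\gamma_1,\dots,\gamma_n\in\Gamma$; $X_{\mathbb{R}}^{*}$ is the dual of $X_{\mathbb{R}}$. 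*)

(* Defs.v *)
From HB Require Import structures.
From mathcomp Require Import all_boot all_order all_algebra.
From mathcomp Require Import finmap ring.
From mathcomp Require Import all_classical all_reals all_analysis.

Set Implicit Arguments.
Unset Strict Implicit.
Unset Printing Implicit Defensive.

Import Order.TTheory GRing.Theory Num.Theory.
Import numFieldNormedType.Exports.

Local Open Scope classical_set_scope.
Local Open Scope ring_scope.

Section Dual.
Context (R : realType) (V : normedModType R).

Definition is_bounded_functional : {pred V -> R^o} :=
  [pred f | `[< linear f /\ continuous f >]].

Record dual := Dual { dual_fun :> V -> R^o ;
                      _ : dual_fun \in is_bounded_functional }.

HB.instance Definition _ := [isSub for dual_fun].
HB.instance Definition _ := [Choice of dual by <:].

Lemma bounded_functional_submod : submod_closed is_bounded_functional.
Proof.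
split.
  apply/asboolP; split; first by move=> a x y; rewrite scaler0 addr0.
  exact: cst_continuous.
move=> a f g /asboolP[lf cf] /asboolP[lg cg]; apply/asboolP; split.
  move=> b x y; rewrite !fctE/= lf lg !scalerDr !scalerA mulrC addrACA.
  by [].
move=> x; apply: cvgD; last exact: cg.
by apply: cvgZl_tmp; exact: cf.
Qed.

HB.instance Definition _ := GRing.isSubmodClosed.Build _ _
  is_bounded_functional bounded_functional_submod.
HB.instance Definition _ := [SubChoice_isSubLmodule of dual by <:].

Lemma dual_linear (f : dual) : linear f.
Proof. by have /asboolP[] := valP f. Qed.

HB.instance Definition _ (f : dual) :=
  GRing.isLinear.Build R V R^o _ (f : V -> R^o) (dual_linear f).

Lemma dual_continuous (f : dual) : continuous f.
Proof. by have /asboolP[] := valP f. Qed.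

Definition dual_norm (f : dual) : R := sup [set `|f x| | x in [set x | `|x| <= 1]].

Lemma dual_has_sup (f : dual) : has_sup [set `|f x| | x in [set x | `|x| <= 1]].
Proof.
split; first by exists `|f 0|, 0 => //=; rewrite normr0.
have /bounded_funP /(_ 1)[M HM] :=
  continuous_linear_bounded 0 (@dual_continuous f 0).
by exists M => _ [x /= x1 <-]; exact: HM.
Qed.

Lemma dual_norm_ub (f : dual) (x : V) : `|x| <= 1 -> `|f x| <= dual_norm f.
Proof.
by move=> x1; apply: sup_upper_bound; [exact: dual_has_sup|exists x].
Qed.

Lemma dual_norm_le (f : dual) (M : R) :
  (forall x : V, `|x| <= 1 -> `|f x| <= M) -> dual_norm f <= M.
Proof.
move=> h; apply: ge_sup; first by have [] := dual_has_sup f.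
by move=> _ [x /= x1 <-]; exact: h.
Qed.

Lemma dual_normD (f g : dual) : dual_norm (f + g) <= dual_norm f + dual_norm g.
Proof.
apply: dual_norm_le => x x1.
by rewrite (le_trans (ler_normD _ _))// lerD// dual_norm_ub.
Qed.

Lemma dual_normZ_le (a : R) (f : dual) :
  dual_norm (a *: f) <= `|a| * dual_norm f.
Proof.
by apply: dual_norm_le => x x1; rewrite /= normrM ler_wpM2l// dual_norm_ub.
Qed.

Lemma dual_normZ (a : R) (f : dual) : dual_norm (a *: f) = `|a| * dual_norm f.
Proof.
apply/eqP; rewrite eq_le dual_normZ_le/=.
have [->|a0] := eqVneq a 0.
  rewrite normr0 mul0r (le_trans (normr_ge0 ((0 *: f) 0)))//.
  by rewrite dual_norm_ub// normr0.
have := dual_normZ_le a^-1 (a *: f).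
by rewrite scalerA mulVf// scale1r normfV -ler_pdivrMl ?invr_gt0 ?normr_gt0// invrK.
Qed.

Lemma dual_norm0_eq0 (f : dual) : dual_norm f = 0 -> f = 0.
Proof.
move=> f0; apply/val_inj/funext => x /=.
have [->|x0] := eqVneq x 0; first by rewrite linear0.
have := @dual_norm_ub f (`|x|^-1 *: x).
rewrite normrZ normfV normr_id mulVf ?normr_eq0// f0 linearZ normrZ => /(_ (lexx _)).
rewrite pmulr_rle0 ?normr_le0; first by move=> /eqP.
by rewrite normr_gt0 invr_neq0// normr_eq0.
Qed.

HB.instance Definition _ :=
  Lmodule_isNormed.Build R dual dual_normD dual_normZ dual_norm0_eq0.

End Dual.

(* The canonical embedding of V into its bidual is onto. *)
Definition reflexive_space (R : realType) (V : normedModType R) : Prop :=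
  forall F : dual (dual V), exists x : V, forall f : dual V, F f = f x.

Section Quotient.
Context (R : realType) (V : normedModType R).

Definition is_subspace (W : set V) : Prop :=
  W 0 /\ forall (a : R) x y, W x -> W y -> W (a *: x + y).

Record closedSubspace := ClosedSubspace {
  csub_set :> set V ;
  csub_subspace : is_subspace csub_set ;
  csub_closed : closed csub_set }.

Lemma span_subspace (S : set V) : is_subspace
  (\bigcap_(W in [set W : closedSubspace | S `<=` W]) (W : set V)).
Proof.
split; first by move=> W _; have [] := csub_subspace W.
move=> a x y hx hy W SW; have [_ hW] := csub_subspace W.
by apply: hW; [exact: hx|exact: hy].
Qed.

Lemma span_closed (S : set V) : closed
  (\bigcap_(W in [set W : closedSubspace | S `<=` W]) (W : set V)).
Proof. by apply: closed_bigI => W _; exact: csub_closed. Qed.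

(* The smallest closed subspace containing S. *)
Definition closed_span (S : set V) : closedSubspace :=
  ClosedSubspace (span_subspace S) (@span_closed S).

Definition csub_pred (Y : closedSubspace) : {pred V} := mem (Y : set V).

Lemma csub_pred_submod Y : submod_closed (csub_pred Y).
Proof.
have [Y0 YD] := csub_subspace Y; split; first exact/mem_set.
by move=> a x y /set_mem Yx /set_mem Yy; apply/mem_set/YD.
Qed.

HB.instance Definition _ Y := GRing.isSubmodClosed.Build _ _
  (csub_pred Y) (csub_pred_submod Y).

Variable Y : closedSubspace.

Definition quotient := {ideal_quot (csub_pred Y)}.

HB.instance Definition _ := GRing.Zmodule.on quotient.

Local Open Scope quotient_scope.

Definition quotient_pi (x : V) : quotient := \pi_({ideal_quot (csub_pred Y)}) x.

Lemma quotient_piP (x y : V) : quotient_pi x = quotient_pi y <-> csub_set Y (x - y).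
Proof.
split=> [h|h]; last by apply/eqP; rewrite -Quotient.idealrBE; exact: mem_set.
by apply/set_mem; rewrite [_ \in _](Quotient.idealrBE (csub_pred Y)); exact/eqP.
Qed.

Lemma quotient_pi_surj (q : quotient) : exists x, quotient_pi x = q.
Proof. by exists (repr q); exact: reprK. Qed.

Lemma quotient_piD : {morph quotient_pi : x y / x + y}.
Proof. exact: (raddfD (\pi_({ideal_quot (csub_pred Y)}))). Qed.

Definition quotient_scale (a : R) (q : quotient) : quotient :=
  quotient_pi (a *: (repr q : V)).

Lemma quotient_piZ a x : quotient_scale a (quotient_pi x) = quotient_pi (a *: x).
Proof.
apply/quotient_piP; rewrite -scalerBr.
have [Y0 YD] := csub_subspace Y; rewrite -[_ *: _]addr0; apply: YD => //.
by apply/quotient_piP; exact: reprK.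
Qed.

Lemma quotient_scaleA a b v :
  quotient_scale a (quotient_scale b v) = quotient_scale (a * b) v.
Proof.
by have [x <-] := quotient_pi_surj v; rewrite !quotient_piZ scalerA.
Qed.

Lemma quotient_scale1 : left_id 1 quotient_scale.
Proof. by move=> v; have [x <-] := quotient_pi_surj v; rewrite quotient_piZ scale1r. Qed.

Lemma quotient_scaleDr : right_distributive quotient_scale +%R.
Proof.
move=> a u v; have [x <-] := quotient_pi_surj u; have [y <-] := quotient_pi_surj v.
by rewrite -quotient_piD !quotient_piZ scalerDr quotient_piD.
Qed.

Lemma quotient_scaleDl v : {morph quotient_scale^~ v : a b / a + b}.
Proof.
move=> a b; have [x <-] := quotient_pi_surj v.
by rewrite !quotient_piZ scalerDl quotient_piD.
Qed.

HB.instance Definition _ := GRing.Zmodule_isLmodule.Build R quotient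
  quotient_scaleA quotient_scale1 quotient_scaleDr quotient_scaleDl.

Lemma quotient_pi_linear : linear quotient_pi.
Proof. by move=> a x y; rewrite quotient_piD -quotient_piZ. Qed.

HB.instance Definition _ :=
  GRing.isLinear.Build R V quotient _ quotient_pi quotient_pi_linear.

Definition quotient_norm (q : quotient) : R :=
  inf [set `|x| | x in [set x | quotient_pi x = q]].

Lemma quotient_norm_has_inf q :
  has_inf [set `|x| | x in [set x | quotient_pi x = q]].
Proof.
split; last by exists 0 => _ [x _ <-].
by have [x xq] := quotient_pi_surj q; exists `|x|, x.
Qed.

Lemma quotient_norm_lb x : quotient_norm (quotient_pi x) <= `|x|.
Proof. by apply: ge_inf; [have [] := quotient_norm_has_inf (quotient_pi x)|exists x]. Qed.

Lemma quotient_norm_adherent q (e : R) : 0 < e ->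
  exists2 x, quotient_pi x = q & `|x| < quotient_norm q + e.
Proof.
move=> e0; have [_ [x xq <-] h] := inf_adherent e0 (quotient_norm_has_inf q).
by exists x.
Qed.

Lemma quotient_normD u v : quotient_norm (u + v) <= quotient_norm u + quotient_norm v.
Proof.
apply/ler_addgt0Pr => e e0; have e20 : 0 < e / 2 by rewrite divr_gt0.
have [x <- hx] := quotient_norm_adherent u e20.
have [y <- hy] := quotient_norm_adherent v e20.
rewrite -quotient_piD (le_trans (quotient_norm_lb _))//.
rewrite (le_trans (ler_normD _ _))// [e]splitr addrACA.
by rewrite lerD// ltW.
Qed.

Lemma quotient_normZ_le a v : quotient_norm (a *: v) <= `|a| * quotient_norm v.
Proof.
apply/ler_addgt0Pr => e e0.
have ha : 0 < `|a| + 1 by rewrite ltr_wpDl.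
have [x xv hx] := quotient_norm_adherent v (divr_gt0 e0 ha).
have -> : a *: v = quotient_pi (a *: x) by rewrite linearZ/= xv.
rewrite (le_trans (quotient_norm_lb _))// normrZ.
rewrite (le_trans (ler_wpM2l (normr_ge0 a) (ltW hx)))// mulrDr lerD2l.
by rewrite mulrCA ger_pMr// ler_pdivrMr// mul1r lerDl.
Qed.

Lemma quotient_normZ a v : quotient_norm (a *: v) = `|a| * quotient_norm v.
Proof.
apply/eqP; rewrite eq_le quotient_normZ_le/=.
have [->|a0] := eqVneq a 0.
  rewrite normr0 mul0r; apply: lb_le_inf.
    by have [] := quotient_norm_has_inf (0 *: v).
  by move=> _ [x _ <-].
have := quotient_normZ_le a^-1 (a *: v).
by rewrite scalerA mulVf// scale1r normfV -ler_pdivrMl ?invr_gt0 ?normr_gt0// invrK.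
Qed.

Lemma quotient_norm0_eq0 v : quotient_norm v = 0 -> v = 0.
Proof.
have [x <-] := quotient_pi_surj v => x0.
rewrite -(linear0 quotient_pi); apply/quotient_piP; rewrite subr0.
apply: (csub_closed (c := Y)) => B /nbhs_normP[e /= e0 He].
have [y /quotient_piP yx] := quotient_norm_adherent (quotient_pi x) e0.
rewrite x0 add0r => ye; exists (x - y); split.
  have [Y0 YD] := csub_subspace Y.
  by rewrite -opprB -scaleN1r -[_ *: _]addr0; exact: YD.
by apply: He => /=; rewrite opprB addrC subrK.
Qed.

HB.instance Definition _ := Lmodule_isNormed.Build R quotient
  quotient_normD quotient_normZ quotient_norm0_eq0.

End Quotient.

(* Linear homeomorphism; no isometry is required. *)
Definition isomorphic (R : realType) (V W : normedModType R) : Prop :=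
  exists (T : {linear V -> W}) (S : {linear W -> V}),
    [/\ cancel T S, cancel S T, continuous T & continuous S].

Section SymmetricBasis.
Context (R : realType) (X : normedModType R) (e : nat -> X).

(* Infinite-dimensionality is implied: the basis is indexed by nat. *)
Definition schauder_basis : Prop :=
  forall x : X, exists! a : nat -> R,
    series (fun n => a n *: e n) @ \oo --> x.

Definition symmetric_basis : Prop :=
  schauder_basis /\
  forall (n : nat) (a : nat -> R) (eps : nat -> bool) (p : nat -> nat),
    bijective p ->
    `|\sum_(i < n) ((-1) ^+ eps i * a i) *: e (p i)| = `|\sum_(i < n) a i *: e i|.

End SymmetricBasis.

Section FinitelySupported.
Context (R : realType) (G : choiceType).

Definition finitely_supported : {pred G -> R^o} :=
  [pred f | `[< finite_set [set g | f g != 0] >]].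

Record c00 := C00 { c00_fun :> G -> R^o ; _ : c00_fun \in finitely_supported }.

HB.instance Definition _ := [isSub for c00_fun].
HB.instance Definition _ := [Choice of c00 by <:].

Lemma finitely_supported_submod : submod_closed finitely_supported.
Proof.
split.
  apply/asboolP; rewrite (_ : [set _ | _] = set0)//.
  by apply/seteqP; split=> // g /=; rewrite eqxx.
move=> a f h /asboolP ff /asboolP fh; apply/asboolP.
apply: (@sub_finite_set _ _ ([set g | f g != 0] `|` [set g | h g != 0])).
  move=> g /=; rewrite !fctE; have [->|?] := eqVneq (f g) 0; last by left.
  by rewrite scaler0 add0r; right.
by rewrite finite_setU.
Qed.

HB.instance Definition _ := GRing.isSubmodClosed.Build _ _
  finitely_supported finitely_supported_submod.
HB.instance Definition _ := [SubChoice_isSubLmodule of c00 by <:].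

Lemma c00_unit_subproof (g : G) :
  (fun h => (h == g)%:R : R^o) \in finitely_supported.
Proof.
apply/asboolP; apply: (@sub_finite_set _ _ [set g]) => // h /=.
by have [->|] := eqVneq h g; rewrite ?eqxx.
Qed.

Definition c00_unit (g : G) : c00 := C00 (c00_unit_subproof g).

End FinitelySupported.

(* A completion of c_00(G) under the norm that the basis e induces on it. *)
Definition is_XGamma (R : realType) (X : normedModType R) (e : nat -> X)
    (G : choiceType) (W : completeNormedModType R) (u : {linear c00 R G -> W}) :=
  dense (range u) /\
  forall (n : nat) (g : 'I_n -> G) (a : 'I_n -> R), injective g ->
    `|u (\sum_(i < n) a i *: c00_unit R (g i))| = `|\sum_(i < n) a i *: e i|.

Section SquareSummable.
Context (R : realType) (G : choiceType).

Definition sqsum (f : G -> R) : \bar R := (\esum_(g in [set: G]) ((f g) ^+ 2)%:E)%E.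

Definition square_summable : {pred G -> R^o} :=
  [pred f | (sqsum f < +oo)%E].

Lemma sqsum_ge0 f : (0 <= sqsum f)%E.
Proof. by apply: esum_ge0 => g _; rewrite lee_fin sqr_ge0. Qed.

Lemma sqsumZ_le (a : R) f : (sqsum (fun g => (a * f g)%R) <= (a ^+ 2)%:E * sqsum f)%E.
Proof.
apply: ge_ereal_sup => _ [A [finA _] <-].
under eq_fsbigr do rewrite exprMn EFinM.
rewrite -ge0_mule_fsumr; last by move=> g; rewrite lee_fin sqr_ge0.
rewrite lee_wpmul2l// ?lee_fin ?sqr_ge0//.
by apply: ereal_sup_ubound; exists A.
Qed.

Lemma sqr_add_weighted (p q a b : R) : 0 < p -> 0 < q ->
  (a + b) ^+ 2 <= (p + q) / p * a ^+ 2 + (p + q) / q * b ^+ 2.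
Proof.
move=> p0 q0; rewrite -subr_ge0.
have -> : (p + q) / p * a ^+ 2 + (p + q) / q * b ^+ 2 - (a + b) ^+ 2 =
    (q * a - p * b) ^+ 2 / (p * q) by field; rewrite !gt_eqF.
by rewrite divr_ge0 ?sqr_ge0// mulr_ge0// ltW.
Qed.

Lemma sqsumD_le (p q : R) f h : 0 < p -> 0 < q ->
  (sqsum (fun g => (f g + h g)%R) <=
   ((p + q) / p)%:E * sqsum f + ((p + q) / q)%:E * sqsum h)%E.
Proof.
move=> p0 q0; apply: ge_ereal_sup => _ [A [finA _] <-].
have pp : 0 <= (p + q) / p by rewrite divr_ge0// ?addr_ge0// ltW.
have pq : 0 <= (p + q) / q by rewrite divr_ge0// ?addr_ge0// ltW.
have sq0 (u : G -> R) g : (0 <= ((u g) ^+ 2)%:E)%E by rewrite lee_fin sqr_ge0.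
apply: (@le_trans _ _ (\sum_(g \in A)
    (((p + q) / p)%:E * (f g ^+ 2)%:E + ((p + q) / q)%:E * (h g ^+ 2)%:E))%E).
  apply: lee_fsum => // g _.
  by rewrite -!EFinM -EFinD lee_fin sqr_add_weighted.
rewrite fsbig_split//= -!ge0_mule_fsumr//.
by apply: leeD; rewrite lee_wpmul2l ?lee_fin//; apply: ereal_sup_ubound; exists A.
Qed.

Lemma square_summable_submod : submod_closed square_summable.
Proof.
have Z a (f : G -> R) : (sqsum f < +oo -> sqsum (fun g => (a * f g)%R) < +oo)%E.
  move=> ff; apply: le_lt_trans (sqsumZ_le a f) _.
  by rewrite lte_mul_pinfty// lee_fin sqr_ge0.
split.
  rewrite inE/=; rewrite /sqsum esum1 ?ltry// => g _.
  by rewrite expr0n.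
move=> a f h; rewrite !inE/= => /(Z a) ff fh.
apply: le_lt_trans (@sqsumD_le 1 1 _ _ ltr01 ltr01) _.
by rewrite lte_add_pinfty// lte_mul_pinfty// lee_fin divr_ge0.
Qed.

Record l2 := L2 { l2_fun :> G -> R^o ; _ : l2_fun \in square_summable }.

HB.instance Definition _ := [isSub for l2_fun].
HB.instance Definition _ := [Choice of l2 by <:].


HB.instance Definition _ := GRing.isSubmodClosed.Build _ _
  square_summable square_summable_submod.
HB.instance Definition _ := [SubChoice_isSubLmodule of l2 by <:].

Definition l2_norm (f : l2) : R := Num.sqrt (fine (sqsum f)).

Lemma sqsum_l2_norm (f : l2) : sqsum f = (l2_norm f ^+ 2)%:E.
Proof.
rewrite sqr_sqrtr ?fine_ge0 ?sqsum_ge0// fineK// ge0_fin_numE ?sqsum_ge0//.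
by have := valP f; rewrite inE.
Qed.

Lemma l2_norm_ge0 f : 0 <= l2_norm f. Proof. exact: sqrtr_ge0. Qed.

Lemma l2_normD f h : l2_norm (f + h) <= l2_norm f + l2_norm h.
Proof.
apply/ler_addgt0Pr => e e0.
set p := l2_norm f + e / 2; set q := l2_norm h + e / 2.
have p0 : 0 < p by rewrite ltr_wpDl ?l2_norm_ge0// divr_gt0.
have q0 : 0 < q by rewrite ltr_wpDl ?l2_norm_ge0// divr_gt0.
have pq0 : 0 <= p + q by apply: addr_ge0; exact: ltW.
rewrite (_ : _ + e = p + q); last by rewrite /p /q addrACA -splitr.
rewrite -(@ler_pXn2r _ 2)// ?nnegrE ?l2_norm_ge0//.
rewrite -lee_fin -sqsum_l2_norm (le_trans (sqsumD_le f h p0 q0))//.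
rewrite !sqsum_l2_norm -!EFinM -EFinD lee_fin.
have aux (r s : R) : 0 < r -> 0 <= s <= r -> (p + q) / r * s ^+ 2 <= (p + q) * r.
  move=> r0 /andP[s0 sr]; rewrite -mulrA ler_wpM2l//.
  by rewrite ler_pdivrMl// -expr2 ler_pXn2r// nnegrE// ltW.
rewrite [leRHS]expr2 mulrDr lerD// aux// l2_norm_ge0 lerDl divr_ge0// ltW//.
Qed.

Lemma l2_normZ_le a f : l2_norm (a *: f) <= `|a| * l2_norm f.
Proof.
rewrite -(@ler_pXn2r _ 2)// ?nnegrE ?mulr_ge0 ?l2_norm_ge0//.
by rewrite exprMn real_normK ?num_real// -lee_fin -sqsum_l2_norm EFinM -sqsum_l2_norm sqsumZ_le.
Qed.

Lemma l2_normZ a f : l2_norm (a *: f) = `|a| * l2_norm f.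
Proof.
apply/eqP; rewrite eq_le l2_normZ_le/=.
have [->|a0] := eqVneq a 0; first by rewrite normr0 mul0r l2_norm_ge0.
have := l2_normZ_le a^-1 (a *: f).
by rewrite scalerA mulVf// scale1r normfV -ler_pdivrMl ?invr_gt0 ?normr_gt0// invrK.
Qed.

Lemma l2_norm0_eq0 f : l2_norm f = 0 -> f = 0.
Proof.
move=> f0; apply/val_inj/funext => g /=; apply/eqP; rewrite -sqrf_eq0 eq_le sqr_ge0 andbT.
have : ((f g ^+ 2)%:E <= sqsum f)%E.
  rewrite -(@esum_set1 _ _ g (fun g => (f g ^+ 2)%:E)) ?lee_fin ?sqr_ge0//.
  rewrite [leLHS]esum_mkcond; apply: le_esum => h _.
  by case: ifP => _; rewrite ?lexx// lee_fin sqr_ge0.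
by rewrite sqsum_l2_norm f0 expr0n lee_fin.
Qed.

HB.instance Definition _ :=
  Lmodule_isNormed.Build R l2 l2_normD l2_normZ l2_norm0_eq0.

Lemma l2_unit_subproof (g : G) : (fun h => (h == g)%:R : R^o) \in square_summable.
Proof.
rewrite inE/=; apply: (@le_lt_trans _ _ 1%E); last exact: ltry.
rewrite /sqsum -(@esum_set1 R _ g (fun=> 1%E)) ?lee01//.
rewrite [leRHS]esum_mkcond; apply: le_esum => h _.
have [->|hg] := eqVneq h g; first by rewrite expr1n mem_set.
by rewrite expr0n; case: ifP; rewrite ?lee01.
Qed.

Definition l2_unit (g : G) : l2 := L2 (l2_unit_subproof g).

End SquareSummable.

Section JamesFunctionSpace.
Context (R : realType).

Local Notation mu := (@lebesgue_measure R).

(* Lebesgue measure on (0,1), as a measure on the whole line. *)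
Definition mu01 : set (measurableTypeR R) -> \bar R :=
  mrestr mu (measurable_itv `]0%R, 1%R[).

HB.instance Definition _ := Measure.on mu01.

(* Integrable functions, not identified almost everywhere: the norms below do
   not distinguish equivalent functions, so a norm-preserving map on L1 factors
   through the classes. *)
Definition L1 := LfunType mu01 (lexx 1%E).

HB.instance Definition _ := GRing.Lmodule.on L1.

Context (X : normedModType R) (e : nat -> X).

Definition JF_norm (f : R -> R) : R :=
  sup [set r | exists (m : nat) (a b : 'I_m -> R),
    [/\ forall i, [/\ 0 <= a i, a i < b i & b i <= 1],
        trivIset [set: 'I_m] (fun i => `]a i, b i[%classic) &
        r = `|\sum_(i < m) (\int[mu]_(x in `]a i, b i[) f x) *: e i|]].

Context (JF : completeNormedModType R) (j : {linear L1 -> JF}).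

(* j presents JF as the completion of L1 under JF_norm. *)
Definition is_JF : Prop :=
  dense (range j) /\ forall f : L1, `|j f| = JF_norm f.

(* phi is I^*, determined by its values on the dense range of j. *)
Definition interval_functional (I : interval R) (phi : dual JF) : Prop :=
  forall f : L1, phi (j f) = \int[mu]_(x in [set` I]) f x.

(* The booleans l and r let each endpoint be included or excluded. *)
Definition interval_span (D : set R) : closedSubspace (dual JF) :=
  closed_span [set phi : dual JF | exists (a b : R) (l r : bool),
    [/\ D a, D b, a < b &
        interval_functional (Interval (BSide l a) (BSide r b)) phi]].

End JamesFunctionSpace.

Definition countable_dense01 (R : realType) (D : set R) : Prop :=
  [/\ D `<=` `]0, 1[%classic, countable D & `]0, 1[%classic `<=` closure D].

(* Main.v *)
Require Import Defs.
From HB Require Import structures.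
From mathcomp Require Import all_boot all_order all_algebra.
From mathcomp Require Import ring lra zify.
From mathcomp Require Import all_classical all_reals all_analysis.

Set Implicit Arguments.
Unset Strict Implicit.
Unset Printing Implicit Defensive.

Import Order.TTheory GRing.Theory Num.Theory.
Import numFieldNormedType.Exports.

Local Open Scope classical_set_scope.
Local Open Scope ring_scope.

(* The jump at t of a functional phi on JF_X is an ultralimit of its values at functions whose
   primitives are tents of height 1 and vanishing width with vertex t.  Narrow tents at distinct
   points span X up to equivalence of norms, so the jumps at the points of [0,1] outside Delta form
   a bounded linear map from the dual of JF_X to that of X_Gamma, where Gamma = [0,1] \ Delta is
   equipotent to R; it kills Y, since I^* only jumps at the end points of I.

   It is onto: in the dual of X_Gamma a family of coordinates is small off a finite set A, the
   coordinates in A are the jumps of a combination, of controlled norm, of functionals I_t^*, t in A,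
   where I_t is a short interval from t to a point of Delta, and one iterates.

   Its kernel is Y.  First, a bounded sequence in JF_X whose primitives tend to 0 pointwise is weakly
   null: otherwise Simons' argument yields s in JF_X such that no functional b of norm 1 with
   b(s) = |s| tends to 0 along the sequence, while a cluster point of near-norming functionals of s
   is such a b of the form sum_i alpha_i I_i^*, which does tend to 0.  Hence a functional without
   jumps outside Delta is small on the functions with small primitive between the points of a
   suitable finite chain in Delta, and averaging over the gaps of the chain approximates it by
   elements of Y. *)

(** * Ultralimits of bounded sequences *)

Section UltraLimit.
Variable R : realType.
Implicit Types (u v : nat -> R) (M : R).

(** The sections on [JF] see [X] only through the list norm [lnorm] and four of its properties:
    symmetry, a nonzero first vector, [shrinking_lnorm] and [lnorm_unbounded]. Reflexivity enters
    through the last two; for l2 the four are checked directly, so that one argument,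
    [quotient_coordinates], yields both halves of the theorem. Shrinking leaves only finitely many
    coordinates to realise as jumps and truncates the cluster functionals; unboundedness limits the
    number of gaps on which a primitive can oscillate, whatever the chain. Ultralimits make the jump
    linear in the functional whether or not its values at the tents converge. Jumps are also taken
    at 0 and 1, by half tents: these points lie outside Delta, so Y cannot account for them. The
    criterion for weak nullity gives no rate. It is first used locally, to find around each point a
    window in which gaps are good; the windows are then glued by a supremum argument on [0,1]. A
    point of Delta, where the functional may jump, has to be an end of the gaps next to it and never
    interior, which is what forces the chain to have its nodes in Delta. *)

Definition free_ultra : set_system nat :=
  projT1 (cid (ultraFilterLemma (@eventually_filter))).

#[global] Instance free_ultraP : UltraFilter free_ultra.
Proof. by rewrite /free_ultra; case: cid => ? []. Qed.

Lemma free_ultra_near (P : set nat) : (\forall n \near \oo, P n) -> free_ultra P.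
Proof. by have [_] := projT2 (cid (ultraFilterLemma (@eventually_filter))); exact. Qed.

Definition bounded_seq u := exists M, forall n, `|u n| <= M.

Definition ulim u : R := lim (u @ free_ultra).

Lemma image_ultra u : UltraFilter (u @ free_ultra).
Proof.
split=> [|G PG uG]; first exact: fmap_proper_filter.
apply/seteqP; split=> [A GA|]; last exact: uG.
have [//|nA] := in_ultra_setVsetC (u @^-1` A) free_ultraP.
have : G (A `&` ~` A) by apply: filterI => //; exact: uG.
by rewrite setICr => /filter_ex[].
Qed.

Lemma ulimP u : bounded_seq u -> u @ free_ultra --> ulim u.
Proof.
move=> [M uM]; have := @segment_compact R (- M) M.
rewrite compact_ultra => /(_ _ (image_ultra u))[|l [_ ul]].
  have -> // : u @ free_ultra = fun A => free_ultra (u @^-1` A) by [].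
  rewrite (_ : _ @^-1` _ = setT); first exact: filterT.
  by apply/seteqP; split=> // n _; rewrite /= in_itv/= -ler_norml.
by apply/cvg_ex; exists l.
Qed.

Lemma ulimE u l : u @ free_ultra --> l -> ulim u = l.
Proof. by move=> ul; apply/cvg_lim. Qed.

Lemma ulim_cvg u l : u @ \oo --> l -> ulim u = l.
Proof. by move=> ul; apply: ulimE => A /ul; exact: free_ultra_near. Qed.

Lemma ulim_cst l : ulim (fun=> l) = l.
Proof. by apply: ulim_cvg; exact: cvg_cst. Qed.

Lemma bounded_seqD u v : bounded_seq u -> bounded_seq v -> bounded_seq (fun n => u n + v n).
Proof.
move=> [M uM] [N vN]; exists (M + N) => n.
by rewrite (le_trans (ler_normD _ _))// lerD.
Qed.

Lemma bounded_seqM u v : bounded_seq u -> bounded_seq v -> bounded_seq (fun n => u n * v n).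
Proof. by move=> [M uM] [N vN]; exists (M * N) => n; rewrite normrM ler_pM. Qed.

Lemma bounded_seq_cst l : bounded_seq (fun=> l).
Proof. by exists `|l|. Qed.

Lemma ulimD u v : bounded_seq u -> bounded_seq v ->
  ulim (fun n => u n + v n) = ulim u + ulim v.
Proof. by move=> bu bv; apply: ulimE; apply: cvgD; exact: ulimP. Qed.

Lemma ulimM u v : bounded_seq u -> bounded_seq v ->
  ulim (fun n => u n * v n) = ulim u * ulim v.
Proof. by move=> bu bv; apply: ulimE; apply: cvgM; exact: ulimP. Qed.

Lemma ulimZ a u : bounded_seq u -> ulim (fun n => a * u n) = a * ulim u.
Proof. by move=> bu; rewrite ulimM// ?ulim_cst//; exact: bounded_seq_cst. Qed.

Lemma ulim_le u v : bounded_seq u -> bounded_seq v ->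
  free_ultra [set n | u n <= v n] -> ulim u <= ulim v.
Proof.
move=> bu bv uv.
exact: (ler_cvg_to (ulimP bu) (ulimP bv) uv).
Qed.

Lemma ulim_norm_le u M : bounded_seq u -> free_ultra [set n | `|u n| <= M] ->
  `|ulim u| <= M.
Proof.
move=> bu uM; rewrite ler_norml -{1}(ulim_cst (- M)) -{2}(ulim_cst M).
by apply/andP; split; apply: ulim_le => //; try exact: bounded_seq_cst;
  apply: filterS uM => n /=; rewrite ler_norml => /andP[].
Qed.

Lemma ulim_sum (I : Type) (s : seq I) (F : I -> nat -> R) :
  (forall i, bounded_seq (F i)) ->
  ulim (fun n => \sum_(i <- s) F i n) = \sum_(i <- s) ulim (F i).
Proof.
move=> bF; suff: bounded_seq (fun n => \sum_(i <- s) F i n) /\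
  ulim (fun n => \sum_(i <- s) F i n) = \sum_(i <- s) ulim (F i) by case.
elim: s => [|i s [bs IH]].
  rewrite big_nil; under eq_fun do rewrite big_nil.
  by split; [exact: bounded_seq_cst|exact: ulim_cst].
rewrite big_cons -IH; under eq_fun do rewrite big_cons.
by split; [exact: bounded_seqD|exact: ulimD].
Qed.

Lemma free_ultra_all (P : set nat) : (forall n, P n) -> free_ultra P.
Proof. by move=> hP; apply: free_ultra_near; exists 0%N => // n _; exact: hP. Qed.

Lemma ulim_norm_le_all u M : (forall n, `|u n| <= M) -> `|ulim u| <= M.
Proof. by move=> uM; apply: ulim_norm_le; [exists M|exact: free_ultra_all]. Qed.

Lemma ulim_le_all u v : bounded_seq u -> bounded_seq v -> (forall n, u n <= v n) ->
  ulim u <= ulim v.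
Proof. by move=> bu bv uv; apply: ulim_le => //; exact: free_ultra_all. Qed.

Lemma bounded_seq_sum (I : Type) (s : seq I) (F : I -> nat -> R) :
  (forall i, bounded_seq (F i)) -> bounded_seq (fun n => \sum_(i <- s) F i n).
Proof.
move=> bF; elim: s => [|i s IH].
  by under eq_fun do rewrite big_nil; exact: bounded_seq_cst.
by under eq_fun do rewrite big_cons; exact: bounded_seqD.
Qed.

Lemma ulim_eventually (u : nat -> R) N l : (forall n, (N <= n)%N -> u n = l) -> ulim u = l.
Proof.
move=> h; apply: ulim_cvg; apply: (@cvg_trans _ ((fun=> l : R) @ \oo)); last exact: cvg_cst.
by apply: near_eq_cvg; exists N => // n /= Nn; rewrite h.
Qed.

Lemma ulim0_small (u : nat -> R) : bounded_seq u -> ulim u = 0 ->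
  forall N eps, 0 < eps -> exists2 n, (N <= n)%N & `|u n| <= eps.
Proof.
move=> /ulimP uP u0 N eps eps0; rewrite u0 in uP.
have /cvgr0Pnorm_le/(_ _ eps0) h := uP.
have /filter_ex[n [h1 h2]] : free_ultra [set n | (N <= n)%N /\ `|u n| <= eps].
  by apply: filterI => //; apply: free_ultra_near; exists N.
by exists n.
Qed.

End UltraLimit.

(** * Functionals on normed spaces *)

Section BoundedFunctional.
Variables (R : realType) (V : normedModType R).

Lemma dualZ (f : dual V) (a : R) (x : V) : f (a *: x) = a * f x.
Proof. exact: linearZ. Qed.

Lemma dualD (f : dual V) (x y : V) : f (x + y) = f x + f y.
Proof. exact: linearD. Qed.

Lemma dualB (f : dual V) (x y : V) : f (x - y) = f x - f y.
Proof. exact: linearB. Qed.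

Lemma dual_norm_bound (f : dual V) (x : V) : `|f x| <= `|f| * `|x|.
Proof.
have [->|x0] := eqVneq x 0; first by rewrite linear0 !normr0 mulr0.
have := @dual_norm_ub _ _ f (`|x|^-1 *: x).
rewrite normrZ normfV normr_id mulVf ?normr_eq0// => /(_ (lexx _)).
rewrite linearZ normrM normfV normr_id mulrC ler_pdivrMr ?normr_gt0//.
Qed.

Lemma mk_dual (f : V -> R) (M : R) : 0 <= M -> (forall a x y, f (a *: x + y) = a * f x + f y) ->
  (forall x, `|f x| <= M * `|x|) ->
  exists phi : dual V, (forall x, phi x = f x) /\ `|phi| <= M.
Proof.
move=> M0 lf fM.
have lf' : linear (f : V -> R^o) by move=> a x y; exact: lf.
pose L := GRing.isLinear.Build R V R^o _ (f : V -> R^o) lf'.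
pose F : {linear V -> R^o} := HB.pack (f : V -> R^o) L.
have cf : continuous (f : V -> R^o).
  apply: (@bounded_linear_continuous _ _ _ F).
  apply/linear_boundedP; near=> r => x.
  rewrite (le_trans (fM x))// ler_wpM2r//; near: r; exact: nbhs_pinfty_ge.
have pf : (f : V -> R^o) \in @is_bounded_functional R V by apply/asboolP.
exists (Dual pf); split => //.
apply: dual_norm_le => x x1; rewrite (le_trans (fM x))//=.
by rewrite ler_piMr.
Unshelve. all: end_near. Qed.

End BoundedFunctional.

(** * Hahn-Banach for finitely many vectors *)

Section Sublinear.
Variables (R : realType) (V : lmodType R).

Definition sublinear (q : V -> R) :=
  (forall x y, q (x + y) <= q x + q y) /\ (forall t x, 0 < t -> q (t *: x) = t * q x).

Lemma sublinear0 q : sublinear q -> q 0 = 0.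
Proof.
by move=> [_ qZ]; have := qZ 2 0 (ltr0Sn _ _); rewrite scaler0 => h; lra.
Qed.

Lemma sublinear_opp_ge q x : sublinear q -> - q x <= q (- x).
Proof.
move=> sq; have [qD _] := sq; have := qD x (- x).
by rewrite subrr (sublinear0 sq) => h; lra.
Qed.

(* Lowering p along the half-line through v makes it linear in that direction. *)
Lemma sublinear_lower (p : V -> R) (v : V) : sublinear p ->
  exists q, [/\ sublinear q, forall x, q x <= p x & q (- v) = - p v].
Proof.
move=> sp; have [pD pZ] := sp.
have pZ0 t x : 0 <= t -> p (t *: x) = t * p x.
  rewrite le_eqVlt => /predU1P[<-|/pZ//]; by rewrite scale0r (sublinear0 sp) mul0r.
pose S x := [set p (x + t *: v) - t * p v | t in [set t : R | 0 <= t]].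
have Slb x : lbound (S x) (- p (- x)).
  move=> _ [t /= t0 <-]; have := pD (x + t *: v) (- x).
  by rewrite addrAC subrr add0r pZ0// => h; lra.
have Sinf x : has_inf (S x).
  by split; [exists (p x), 0 => //=; rewrite scale0r mul0r addr0 subr0|exists (- p (- x))].
have ge_q x t : 0 <= t -> inf (S x) <= p (x + t *: v) - t * p v.
  by move=> t0; apply: ge_inf; [have [] := Sinf x|exists t].
have qp x : inf (S x) <= p x.
  by have := @ge_q x 0 (lexx _); rewrite scale0r mul0r addr0 subr0.
have qD x y : inf (S (x + y)) <= inf (S x) + inf (S y).
  apply/ler_addgt0Pr => e e0; have e20 : 0 < e / 2 by lra.
  have [_ [t /= t0 <-] ht] := inf_adherent e20 (Sinf x).
  have [_ [s /= s0 <-] hs] := inf_adherent e20 (Sinf y).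
  have := @ge_q (x + y) (t + s) (addr_ge0 t0 s0).
  have := pD (x + t *: v) (y + s *: v).
  by rewrite scalerDl addrACA mulrDl => h1 h2; lra.
have qZle t x : 0 < t -> inf (S (t *: x)) <= t * inf (S x).
  move=> t0; rewrite -ler_pdivrMl//; apply: lb_le_inf; first by have [] := Sinf x.
  move=> _ [s /= s0 <-]; rewrite ler_pdivrMl// mulrBr -pZ// scalerDr scalerA mulrA.
  by apply: ge_q; rewrite mulr_ge0// ltW.
have sq : sublinear (fun x => inf (S x)).
  split=> // t x t0; apply/eqP; rewrite eq_le qZle//=.
  have := @qZle t^-1 (t *: x).
  by rewrite invr_gt0 scalerA mulVf ?gt_eqF// scale1r ler_pdivlMl// => /(_ t0).
exists (fun x => inf (S x)); split=> //.
apply/eqP; rewrite eq_le; apply/andP; split.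
  have := @ge_q (- v) 1 ler01.
  by rewrite scale1r addNr (sublinear0 sp) mul1r sub0r.
have := sublinear_opp_ge v sq; have := qp v; move=> /= h1 h2; lra.
Qed.

(** Oddness at a vector, once obtained, survives further lowering:
    [q (- v) <= p (- v) = - p v <= - q v], and subadditivity gives the converse. *)
Lemma sublinear_odd_le (p q : V -> R) v : sublinear q ->
  (forall x, q x <= p x) -> p (- v) = - p v -> q (- v) = - q v.
Proof.
move=> sq qp pv; have := sublinear_opp_ge v sq.
have := qp v; have := qp (- v); rewrite pv => h1 h2 h3; lra.
Qed.

Lemma sublinear_odd_on (s : seq V) (p : V -> R) : sublinear p ->
  exists q, [/\ sublinear q, forall x, q x <= p x & {in s, forall v, q (- v) = - q v}].
Proof.
elim: s p => [|v s IH] p sp; first by exists p; split.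
have [q1 [sq1 q1p q1v]] := sublinear_lower v sp.
have q1o : q1 (- v) = - q1 v.
  have := sublinear_opp_ge v sq1; have := q1p v; rewrite q1v => h1 h2; lra.
have [q [sq qq1 qs]] := IH q1 sq1.
exists q; split=> // [x|w]; first exact: le_trans (qq1 x) (q1p x).
rewrite inE => /predU1P[->|]; last exact: qs.
exact: sublinear_odd_le sq qq1 q1o.
Qed.

Lemma sublinear_sum (q : V -> R) (n : nat) (c : nat -> R) (v : nat -> V) : sublinear q ->
  (forall i, (i < n)%N -> q (- v i) = - q (v i)) ->
  q (\sum_(i < n) c i *: v i) = \sum_(i < n) c i * q (v i).
Proof.
move=> sq qv; have [qD qZ] := sq; have q0 := sublinear0 sq.
have qZ' t i : (i < n)%N -> q (t *: v i) = t * q (v i).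
  move=> iN; have [t0|t0|->] := ltrgt0P t; last by rewrite scale0r q0 mul0r.
    by rewrite qZ.
  by rewrite -[t in LHS]opprK scaleNr -scalerN qZ ?oppr_gt0// qv// mulrNN.
have qA x i t : (i < n)%N -> q (x + t *: v i) = q x + t * q (v i).
  move=> iN; apply/eqP; rewrite eq_le -{1}qZ'// qD/=.
  have := qD (x + t *: v i) ((- t) *: v i).
  by rewrite qZ'// scaleNr addrK => h; lra.
elim: n {qv} qZ' qA => [|n IH] qZ' qA; first by rewrite !big_ord0.
rewrite !big_ord_recr/= qA// IH// => *; [exact/qZ'/ltnW|exact/qA/ltnW].
Qed.

End Sublinear.

(** The norm is lowered along [x] first, which fixes the value [|x|] at [x], and then along each
    [v i]; a sublinear function that is odd at the [v i] is linear on their combinations. The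
    functional is recorded by its values [a i], with [v] possibly linearly dependent. *)
Lemma norming_functional (R : realType) (X : normedModType R) (n : nat) (v : nat -> X)
    (x : X) :
  exists a : nat -> R,
    (forall c : nat -> R, \sum_(i < n) c i * a i <= `|\sum_(i < n) c i *: v i|) /\
    (forall c : nat -> R, x = \sum_(i < n) c i *: v i -> \sum_(i < n) c i * a i = `|x|).
Proof.
have sp : sublinear (fun y : X => `|y|).
  by split=> [y z|t y t0]; [exact: ler_normD|rewrite normrZ gtr0_norm].
have [q1 [sq1 q1p q1x]] := sublinear_lower x sp.
have [q [sq qq1 qv]] := sublinear_odd_on [seq v i | i <- iota 0 n] sq1.
have qv' i : (i < n)%N -> q (- v i) = - q (v i).
  by move=> iN; apply: qv; apply: map_f; rewrite mem_iota.
exists (q \o v); split=> [c|c xc].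
  by rewrite -(sublinear_sum c sq qv') (le_trans (qq1 _)).
rewrite -(sublinear_sum c sq qv') -xc; apply/eqP; rewrite eq_le.
rewrite (le_trans (qq1 _) (q1p _))/=.
have := qq1 (- x); have := sublinear_opp_ge x sq; rewrite q1x => h1 h2; lra.
Qed.

(** * Limits at a geometric rate *)

Section Geometric.
Variable R : realType.

Lemma geom_half_cvg0 (K : R) : (fun n => K / 2 ^+ n) @ \oo --> 0.
Proof.
rewrite (_ : (fun n => _) = geometric K (2^-1)); last first.
  by apply/funext => n; rewrite /geometric/= exprVn.
by apply: cvg_geometric; rewrite gtr0_norm ?invr_gt0// invf_lt1// ltr1n.
Qed.

Lemma le_geom_half (a b K : R) : (forall n, a <= b + K / 2 ^+ n) -> a <= b.
Proof.
move=> h; have : (fun n => b + K / 2 ^+ n) @ \oo --> b + 0.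
  by apply: cvgD; [exact: cvg_cst|exact: geom_half_cvg0].
rewrite addr0 => hb; have /cvg_lim <-// := hb.
apply: limr_ge; first by apply/cvg_ex; exists b.
by apply: nearW.
Qed.

Lemma geom_half_limit (E : completeNormedModType R) (s : nat -> E) (M : R) :
  (forall n, `|s n.+1 - s n| <= M / 2 ^+ n.+1) ->
  exists l, forall n, `|l - s n| <= M / 2 ^+ n.
Proof.
move=> hs.
have M0 : 0 <= M.
  by have := le_trans (normr_ge0 _) (hs 0%N); rewrite pmulr_lge0// invr_gt0 exprn_gt0.
have hnm n k : `|s (n + k)%N - s n| <= M / 2 ^+ n - M / 2 ^+ (n + k).
  elim: k => [|k IH]; first by rewrite addn0 !subrr normr0.
  rewrite addnS -(subrK (s (n + k)%N) (s (n + k).+1)) -addrA.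
  rewrite (le_trans (ler_normD _ _))//.
  have := hs (n + k)%N; move: IH; set A := `|_|; set B := `|_|.
  have -> : M / 2 ^+ (n + k) = M / 2 ^+ (n + k).+1 + M / 2 ^+ (n + k).+1.
    by rewrite exprS; field; rewrite expf_neq0.
  by move=> h1 h2; lra.
have hnm' n m : (n <= m)%N -> `|s m - s n| <= M / 2 ^+ n.
  move=> nm; rewrite -(subnKC nm) (le_trans (hnm _ _))// gerBl.
  by rewrite divr_ge0// exprn_ge0.
have : cvgn s.
  apply/cauchy_cvgP/cauchy_exP => e e0.
  have /cvgrPdist_lt/(_ e e0)[k _ hk] := geom_half_cvg0 M.
  exists (s k); exists k => // n /= kn; rewrite -ball_normE/= distrC.
  rewrite (le_lt_trans (hnm' _ _ kn))//.
  by have := hk k (leqnn _); rewrite sub0r normrN; exact/le_lt_trans/ler_norm.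
move=> /cvg_ex[l sl]; exists l => n.
have : (fun m => `|s m - s n|) @ \oo --> `|l - s n|.
  by apply: cvg_norm; apply: cvgB; [exact: sl|exact: cvg_cst].
move=> h; have /cvg_lim <-// := h; apply: limr_le; first by apply/cvg_ex; eexists; exact: h.
by exists n => // m; exact: hnm'.
Qed.

End Geometric.

(** * Extension of functionals from a dense image *)

Section Extension.
Variables (R : realType).

Lemma cvg_divS (K : R) : (fun n => K / n.+1%:R) @ \oo --> (0 : R).
Proof.
rewrite -[X in _ --> X](mulr0 K).
by apply: cvgM; [exact: cvg_cst|exact: (@cvg_harmonic R)].
Qed.

Lemma divS_small (K e : R) : 0 < e -> exists N, forall n, (N <= n)%N -> K / n.+1%:R <= e.
Proof.
move=> e0; have /cvgr0Pnorm_le/(_ e e0)[N _ hN] := cvg_divS K.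
by exists N => n Nn; rewrite (le_trans (ler_norm _))//; exact: hN.
Qed.

Lemma ulim_near0 (u v : nat -> R) (K : R) : bounded_seq v ->
  (forall n, `|u n - v n| <= K / n.+1%:R) -> ulim u = ulim v.
Proof.
move=> bv uv; have cd : (fun n => u n - v n) @ \oo --> (0 : R).
  apply/cvgr0Pnorm_le => e e0.
  have [N hN] := divS_small K e0; exists N => // n /= Nn.
  by rewrite (le_trans (uv n))// hN.
have bd : bounded_seq (fun n => u n - v n).
  exists K => n; rewrite (le_trans (uv n))// ler_pdivrMr// ler_peMr// ?ler1n//.
  by have := le_trans (normr_ge0 _) (uv n); rewrite pmulr_lge0// invr_gt0.
have -> : u = (fun n => (u n - v n) + v n) by apply/funext => n; rewrite subrK.
by rewrite ulimD// (ulim_cvg cd) add0r.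
Qed.

(** The value at [x] is the ultralimit of [l] along chosen approximants of [x] within [1 / (n + 1)].
    The approximants are not linear in [x], but the defect in [l] is at most
    [M * (2 + |c|) / (n + 1)], which the ultralimit ignores. *)
Lemma dense_extend (E0 : lmodType R) (E : normedModType R) (j : {linear E0 -> E})
    (l : E0 -> R) (M : R) : dense (range j) -> 0 <= M ->
  (forall a x y, l (a *: x + y) = a * l x + l y) ->
  (forall f, `|l f| <= M * `|j f|) ->
  exists phi : dual E, (forall f, phi (j f) = l f) /\ `|phi| <= M.
Proof.
move=> dj M0 ll lM.
have /choice[a ha] : forall nx : nat * E, exists f, `|j f - nx.2| <= nx.1.+1%:R^-1.
  move=> [n x]; have i0 : 0 < n.+1%:R^-1 :> R by rewrite invr_gt0.
  have [||y [/= h [f _ fy]]] := dj (ball x n.+1%:R^-1).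
  - by exists x; exact: ballxx.
  - exact: ball_open.
  by exists f; move: h; rewrite fy -ball_normE/= distrC => /ltW.
have lB x y : l (x - y) = l x - l y.
  by rewrite -[- y]scaleN1r addrC ll mulN1r addrC.
have ja n x : `|j (a (n, x))| <= `|x| + n.+1%:R^-1.
  rewrite -[j _](subrK x) addrC (le_trans (ler_normD _ _))// lerD2l.
  exact: (ha (n, x)).
have invS1 n : n.+1%:R^-1 <= 1 :> R by rewrite invf_le1// ler1n.
have bl x : bounded_seq (fun n => l (a (n, x))).
  exists (M * (`|x| + 1)) => n; rewrite (le_trans (lM _))// ler_wpM2l//.
  by rewrite (le_trans (ja _ _))// lerD2l.
have phiE x f K : (forall n, `|j (a (n, x)) - j f| <= K / n.+1%:R) -> ulim (fun n => l (a (n, x))) = l f.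
  move=> h; rewrite -[RHS]ulim_cst; apply: (@ulim_near0 _ _ (M * K)); first exact: bounded_seq_cst.
  by move=> n; rewrite -lB (le_trans (lM _))// linearB -mulrA ler_wpM2l.
have [||phi [hphi phiM]] := @mk_dual R E (fun x => ulim (fun n => l (a (n, x)))) M M0.
- move=> c x y; rewrite -ulimZ// -ulimD//; last by apply: bounded_seqM => //; exact: bounded_seq_cst.
  apply: (@ulim_near0 _ _ (M * (2 + `|c|))).
    by apply: bounded_seqD => //; apply: bounded_seqM => //; exact: bounded_seq_cst.
  move=> n; rewrite -ll -lB (le_trans (lM _))// linearB linearD linearZ/= -mulrA ler_wpM2l//.
  have : `|j (a (n, c *: x + y)) - (c *: x + y)| <= n.+1%:R^-1 := ha (n, _).
  have : `|j (a (n, x)) - x| <= n.+1%:R^-1 := ha (n, x).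
  have : `|j (a (n, y)) - y| <= n.+1%:R^-1 := ha (n, y).
  have sE z : exists u, j (a (n, z)) = u + z by exists (j (a (n, z)) - z); rewrite subrK.
  have [w ->] := sE (c *: x + y); have [u ->] := sE x; have [v ->] := sE y.
  rewrite !addrK => hv hu hw.
  rewrite scalerDr addrACA opprD addrACA subrr addr0.
  have := ler_normB w (c *: u + v); have := ler_normD (c *: u) v; rewrite normrZ !mulrDl.
  move: (ler_wpM2l (normr_ge0 c) hu) hv hw; move: n.+1%:R^-1 (`|c|) => k C.
  by move: (C * `|u|) => Cu; lra.
- move=> x; apply/ler_addgt0Pr => e e0.
  have [N hN] := divS_small M e0.
  apply: ulim_norm_le => //; apply: free_ultra_near; exists N => // n /= Nn.
  by rewrite (le_trans (lM _))// (le_trans (ler_wpM2l M0 (ja n x)))// mulrDr lerD2l hN.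
exists phi; split=> // f; rewrite hphi; apply: (@phiE _ _ 1) => n.
by rewrite mul1r; exact: (ha (n, j f)).
Qed.

End Extension.

(** * From approximate preimages to an isomorphism with the quotient *)

Section DualSeries.
Variables (R : realType).

(** The sum is built pointwise from real limits; the error at [x] is proportional to [|x|], so the
    convergence is uniform on the unit ball. *)
Lemma dual_series (V : normedModType R) (psi : nat -> dual V) (M : R) : 0 <= M ->
  (forall n, `|psi n| <= M / 2 ^+ n.+1) ->
  exists phi : dual V, forall n, `|phi - \sum_(k < n) psi k| <= M / 2 ^+ n.
Proof.
move=> M0 hpsi.
have sumE x n : (\sum_(k < n) psi k) x = \sum_(k < n) (psi k x).
  elim: n => [|n IH]; first by rewrite !big_ord0.
  by rewrite !big_ord_recr/= -IH.
have /choice[l hl] : forall x, exists l : R^o, forall n,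
    `|l - (\sum_(k < n) psi k) x| <= (M * `|x|) / 2 ^+ n.
  move=> x; apply: (@geom_half_limit R R^o (fun n => (\sum_(k < n) psi k) x)) => n.
  rewrite !sumE big_ord_recr/= addrAC subrr add0r.
  rewrite (le_trans (dual_norm_bound _ _))// mulrAC ler_wpM2r//.
have [||phi [hphi phiM]] := @mk_dual R V l M M0.
- move=> a x y; apply/eqP; rewrite -subr_eq0 -normr_le0.
  apply: (@le_geom_half _ _ _ (M * `|a *: x + y| + `|a| * (M * `|x|) + M * `|y|)) => n.
  have h1 := hl (a *: x + y) n; have h2 := ler_wpM2l (normr_ge0 a) (hl x n); have h3 := hl y n.
  move: h1 h2 h3; rewrite linearP/= -normrM.
  set p : R := (\sum_(k < n) psi k) x; set q : R := (\sum_(k < n) psi k) y.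
  rewrite -[a *: p]/(a * p) add0r !mulrDl => h1 h2 h3.
  rewrite (_ : _ - _ = (l (a *: x + y) - (a * p + q)) - a * (l x - p) - (l y - q)); last by ring.
  rewrite (le_trans (ler_normB _ _))// lerD// (le_trans (ler_normB _ _))// lerD//.
  by rewrite -!mulrA in h2 *.
- by move=> x; have := hl x 0%N; rewrite sumE big_ord0 subr0 expr0 divr1.
exists phi => n; apply: dual_norm_le => x x1.
rewrite [_ x]/(phi x - (\sum_(k < n) psi k) x) hphi (le_trans (hl x n))// ler_wpM2r ?invr_ge0 ?exprn_ge0//.
by rewrite ler_piMr.
Qed.

(** Iteration on the residual, which halves at each step; the corrections have norm at most
    [C * |w| / 2 ^+ n], and their sum gives the factor 2. *)
Lemma approx_onto (V W : normedModType R) (T : {linear dual V -> W}) (K C : R) :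
  0 <= K -> 0 <= C -> (forall v, `|T v| <= K * `|v|) ->
  (forall w, exists v, `|v| <= C * `|w| /\ `|w - T v| <= `|w| / 2) ->
  forall w, exists v, T v = w /\ `|v| <= (2 * C) * `|w|.
Proof.
move=> K0 C0 TK /choice[F hF] w.
pose r := fix r n := if n is m.+1 then r m - T (F (r m)) else w.
have rn n : `|r n| <= `|w| / 2 ^+ n.
  elim: n => [|n IH]; first by rewrite expr0 divr1.
  rewrite /= (le_trans (hF _).2)// exprSr invfM mulrA ler_wpM2r//.
have [|n|phi hphi] := @dual_series V (F \o r) ((2 * C) * `|w|).
- by rewrite !mulr_ge0.
- rewrite /= (le_trans (hF _).1)//.
  rewrite (le_trans (ler_wpM2l C0 (rn n)))// le_eqVlt; apply/orP; left; apply/eqP.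
  by rewrite exprS; field; rewrite expf_neq0.
exists phi; split; last by have := hphi 0%N; rewrite big_ord0 subr0 expr0 divr1.
have rE n : T (\sum_(k < n) (F \o r) k) = w - r n.
  elim: n => [|n IH]; first by rewrite big_ord0 linear0 subrr.
  by rewrite big_ord_recr linearD IH/= opprB addrA addrAC.
apply/eqP; rewrite -subr_eq0 -normr_le0.
apply: (@le_geom_half _ _ _ (`|w| + K * (2 * C * `|w|))) => n.
have -> : T phi - w = T (phi - \sum_(k < n) (F \o r) k) - r n.
  by rewrite linearB rE opprB addrA addrAC addrK.
rewrite add0r (le_trans (ler_normB _ _))// addrC mulrDl lerD//.
by rewrite (le_trans (TK _))// -mulrA ler_wpM2l.
Qed.

(** Both maps go through chosen representatives, on which by [piT] nothing depends. A representative
    of nearly minimal norm bounds the direct map, a controlled preimage the inverse one, so no open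
    mapping argument is involved. *)
Lemma quotient_isomorphic (V W : normedModType R) (Y : closedSubspace V)
    (T : {linear V -> W}) (K C : R) :
  0 <= K -> 0 <= C -> (forall v, `|T v| <= K * `|v|) ->
  (forall v, T v = 0 <-> csub_set Y v) ->
  (forall w, exists v, T v = w /\ `|v| <= C * `|w|) ->
  isomorphic (quotient Y) W.
Proof.
move=> K0 C0 TK TY onto.
have piT x y : quotient_pi Y x = quotient_pi Y y <-> T x = T y.
  rewrite quotient_piP -TY linearB; split=> [/eqP|->]; last by rewrite subrr.
  by rewrite subr_eq0 => /eqP.
have /choice[s hs] := @quotient_pi_surj _ _ Y.
have /choice[t ht] := onto.
pose f (q : quotient Y) : W := T (s q).
pose g (w : W) : quotient Y := quotient_pi Y (t w).
have fpi x : f (quotient_pi Y x) = T x by apply/piT; rewrite hs.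
have lf : linear f.
  move=> a x y; rewrite -[x in LHS]hs -[y in LHS]hs -linearP fpi.
  by rewrite linearP.
have lg : linear g.
  move=> a x y; rewrite /g -linearP; apply/piT.
  by rewrite linearP !(ht _).1.
pose f' : {linear quotient Y -> W} := HB.pack f (GRing.isLinear.Build R _ _ _ f lf).
pose g' : {linear W -> quotient Y} := HB.pack g (GRing.isLinear.Build R _ _ _ g lg).
exists f', g'; split.
- by move=> q; rewrite /= /g -[RHS]hs; apply/piT; rewrite (ht _).1.
- by move=> w; rewrite /= /g fpi (ht _).1.
- apply: (@bounded_linear_continuous _ _ _ f'); apply/linear_boundedP.
  near=> r => q /=; rewrite (@le_trans _ _ (K * `|q|))//; last first.
    by rewrite ler_wpM2r//; near: r; exact: nbhs_pinfty_ge.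
  apply/ler_addgt0Pr => e e0.
  have e1 : 0 < e / (K + 1) by rewrite divr_gt0// ltr_wpDl.
  have [x xq hx] := quotient_norm_adherent q e1.
  rewrite -xq fpi (le_trans (TK _))// (le_trans (ler_wpM2l K0 (ltW hx)))//.
  rewrite mulrDr xq lerD2l mulrA ler_pdivrMr ?ltr_wpDl//.
  by rewrite mulrC ler_wpM2l ?lerDl// ltW.
- apply: (@bounded_linear_continuous _ _ _ g'); apply/linear_boundedP.
  near=> r => w /=; rewrite (@le_trans _ _ (C * `|w|))//; last first.
    by rewrite ler_wpM2r//; near: r; exact: nbhs_pinfty_ge.
  by rewrite (le_trans (quotient_norm_lb _ _))//; exact: (ht w).2.
Unshelve. all: end_near. Qed.

End DualSeries.

(** * Simons' argument *)

Section Simons.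
Variables (R : realType) (E : completeNormedModType R).

(* The closed convex hull of the tails is handled through its dual description. *)
Lemma simons_sequence (x : nat -> E) (M : R) (phi : dual E) (eps : R) : 0 < eps ->
  (forall k, `|x k| <= M) -> (forall k, eps <= phi (x k)) ->
  exists (s : E) (m : R), 0 < m /\ forall b : dual E, `|b| <= 1 -> b s = `|s| ->
    forall n, exists2 k, (n <= k)%N & m <= b (x k).
Proof.
move=> e0 xM phix.
have M0 : 0 <= M := le_trans (normr_ge0 _) (xM 0%N).
pose C n := [set y : E | `|y| <= M /\ forall (b : dual E) c,
  (forall k, (n <= k)%N -> b (x k) <= c) -> b y <= c].
have Cx n : C n (x n) by split=> // b c; exact.
have phiC n y : C n y -> eps <= phi y.
  move=> [_ /(_ (- phi) (- eps)) h]; rewrite -lerN2; apply: h => k _.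
  by rewrite [_ (x k)]/(- phi (x k)) lerN2.
pose m0 := eps / (`|phi| + 1).
have p1 : 0 < `|phi| + 1 by rewrite ltr_wpDl.
have m00 : 0 < m0 by rewrite divr_gt0.
have Cm n y : C n y -> m0 <= `|y|.
  move=> Cy; rewrite ler_pdivrMr//; have := phiC _ _ Cy.
  move=> /le_trans; apply; rewrite (le_trans (ler_norm _))//.
  by rewrite (le_trans (dual_norm_bound _ _))// mulrC ler_wpM2l// lerDl.
(* Below, [b (w n)] loses less than [2 * d] from its initial lower bound [m0 = 4 * d], so it stays
   above [2 * d], whereas [b (x k) <= d] for all large [k] would force [b (w n) <= d]. *)
pose d := m0 / 4.
have d0 : 0 < d by rewrite divr_gt0.
(* The weight [2 ^- n] tried here is twice the one with which [g n] enters [S]: it is the total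
   weight of all terms still to be added to [S n]. Thus [s] itself, being [S n] plus [2 ^- n] times
   the average [w n] of the later terms, is one of the competitors. *)
have /choice[G hG] : forall ns : nat * E, exists g, C ns.1 g /\
    forall y, C ns.1 y -> `|ns.2 + (2 ^+ ns.1)^-1 *: g| <=
      `|ns.2 + (2 ^+ ns.1)^-1 *: y| + d / 4 ^+ ns.1.
  move=> [n s] /=.
  pose A := [set `|s + (2 ^+ n)^-1 *: y| | y in C n].
  have hA : has_inf A.
    by split; [exists `|s + (2 ^+ n)^-1 *: x n|, (x n)|exists 0 => _ [y _ <-]].
  have dn : 0 < d / 4 ^+ n by rewrite divr_gt0// exprn_gt0.
  have [_ [g Cg <-] hg] := inf_adherent dn hA.
  exists g; split=> // y Cy; rewrite (le_trans (ltW hg))// lerD2r.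
  by apply: ge_inf; [case: hA|exists y].
pose S := fix S n := if n is k.+1 then S k + (2 ^+ k.+1)^-1 *: G (k, S k) else 0.
pose g n := G (n, S n).
have SS n : S n.+1 = S n + (2 ^+ n.+1)^-1 *: g n by [].
have Cg n : C n (g n) := (hG (n, S n)).1.
have [s hs] : exists s, forall n, `|s - S n| <= M / 2 ^+ n.
  apply: geom_half_limit => n; rewrite SS addrAC subrr add0r normrZ gtr0_norm; last first.
    by rewrite invr_gt0 exprn_gt0.
  by rewrite mulrC ler_wpM2r ?invr_ge0 ?exprn_ge0//; have [] := Cg n.
have bS (b : dual E) c n k : (forall i, (n <= i)%N -> b (x i) <= c) ->
    b (S (n + k)%N) - b (S n) <= c / 2 ^+ n - c / 2 ^+ (n + k)%N.
  move=> bc; elim: k => [|k IH]; first by rewrite addn0 !subrr.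
  rewrite addnS SS linearD linearZ/= -[_ *: _]/((2 ^+ (n + k).+1)^-1 * b (g (n + k)%N)).
  have : b (g (n + k)%N) <= c.
    have [_] := Cg (n + k)%N; apply=> i ni; apply: bc.
    by rewrite (leq_trans _ ni)// leq_addr.
  have h0 : 0 <= (2 ^+ (n + k).+1)^-1 :> R by rewrite invr_ge0 exprn_ge0.
  move=> /(ler_wpM2l h0).
  have eq2 : c / 2 ^+ (n + k) = 2 * ((2 ^+ (n + k).+1)^-1 * c).
    by rewrite exprS; field; rewrite expf_neq0.
  move: IH; rewrite eq2.
  rewrite (mulrC c (2 ^+ (n + k).+1)^-1); lra.
pose w n := 2 ^+ n *: (s - S n).
have ws n : s = S n + (2 ^+ n)^-1 *: w n.
  by rewrite /w scalerA mulVf ?expf_neq0// scale1r addrC subrK.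
have Cw n : C n (w n).
  split.
    rewrite /w normrZ gtr0_norm ?exprn_gt0// mulrC -ler_pdivlMr ?exprn_gt0//.
  move=> b c bc; rewrite linearZ/= -[_ *: _]/(2 ^+ n * b (s - S n)).
  rewrite -ler_pdivlMl ?exprn_gt0// mulrC.
  apply: (@le_geom_half _ _ _ ((`|b| * M + `|c|) / 2 ^+ n)) => k.
  have := bS b c n k bc.
  have := dual_norm_bound b (s - S (n + k)%N) => h1.
  have := le_trans h1 (ler_wpM2l (normr_ge0 b) (hs (n + k)%N)).
  move=> /(le_trans (ler_norm _)); rewrite !linearB/= exprD invfM !mulrA.
  have := ler_norm (- (c / 2 ^+ n / 2 ^+ k)); rewrite normrN !normrM !normfV.
  rewrite !(@ger0_norm _ (2 ^+ _)) ?exprn_ge0// !mulrDl.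
  by lra.
exists s, d; split=> // b b1 bs n.
apply: contrapT => hn.
have {}hn k : (n <= k)%N -> b (x k) <= d.
  by move=> nk; rewrite leNgt; apply/negP => /ltW h; apply: hn; exists k.
have bnear k : b (S k) + (2 ^+ k)^-1 * b (g k) <= `|s| + d / 4 ^+ k.
  have := (hG (k, S k)).2 _ (Cw k); rewrite -ws; apply: le_trans.
  rewrite (_ : _ + _ = b (S k + (2 ^+ k)^-1 *: g k)); last by rewrite linearD linearZ.
  rewrite (le_trans (ler_norm _))// (le_trans (dual_norm_bound _ _))//.
  by rewrite ler_piMl.
have s0 : m0 <= `|s|.
  by apply: (@Cm 0%N); have := Cw 0%N; rewrite /w /= subr0 expr0 scale1r.
(* The right side is [b (w k)]. Near-minimality of [g k] says that [b (g k)] exceeds it by at most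
   [d / 2 ^+ k], and the next value is twice the present one minus [b (g k)]. *)
have D k : m0 - 2 * d + 2 * d / 2 ^+ k <= 2 ^+ k * (b s - b (S k)).
  elim: k => [|k IH].
    rewrite /= linear0 subr0 expr0 mul1r divr1 bs; lra.
  have := bnear k; rewrite SS dualD dualZ bs.
  rewrite bs in IH; have k0 : 0 < 2 ^+ k :> R by rewrite exprn_gt0.
  rewrite (_ : 4 = 2 * 2 :> R); last by ring.
  rewrite exprMn -(ler_pM2l k0) exprS.
  have -> : 2 ^+ k * (b (S k) + (2 ^+ k)^-1 * b (g k)) = 2 ^+ k * b (S k) + b (g k).
    by field; rewrite gt_eqF.
  have -> : 2 ^+ k * (`|s| + d / (2 ^+ k * 2 ^+ k)) = 2 ^+ k * `|s| + d / 2 ^+ k.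
    by field; rewrite gt_eqF.
  have -> : 2 * d / (2 * 2 ^+ k) = d / 2 ^+ k by field; rewrite gt_eqF.
  have -> : 2 * 2 ^+ k * (`|s| - (b (S k) + (2 * 2 ^+ k)^-1 * b (g k))) =
     2 * (2 ^+ k * `|s|) - 2 * (2 ^+ k * b (S k)) - b (g k) by field; rewrite gt_eqF.
  move: IH; rewrite mulrBr -mulrA; lra.
have : b (w n) <= d by have [_] := Cw n; exact.
rewrite dualZ dualB; have := D n; have : 0 <= 2 * d / 2 ^+ n by rewrite divr_ge0 ?exprn_ge0// mulr_ge0 // ltW.
have : m0 = 4 * d by rewrite /d; field.
lra.
Qed.

End Simons.

(** * Symmetric norms of coefficient lists *)

Section ListNorm.
Variables (R : realType) (X : normedModType R) (e : nat -> X).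
Implicit Types (c d l : seq R).

Definition lnorm c : R := `|\sum_(i < size c) c`_i *: e i|.

(** Symmetry on lists instead of on bijections of [nat]: families of intervals are lists, and their
    rearrangements are instances of [perm_eq]. *)
Definition symmetric_lnorm :=
  (forall c d, perm_eq c d -> lnorm c = lnorm d) /\
  (forall a c, lnorm (- a :: c) = lnorm (a :: c)).

Lemma lnorm_ge0 c : 0 <= lnorm c. Proof. exact: normr_ge0. Qed.

Lemma lnorm_mkseq (f : nat -> R) n : lnorm (mkseq f n) = `|\sum_(i < n) f i *: e i|.
Proof.
rewrite /lnorm size_mkseq; congr `|_|; apply: eq_bigr => i _.
by rewrite nth_mkseq.
Qed.

Lemma lnorm_map_nth (T : Type) (x0 : T) (f : T -> R) (s : seq T) :
  lnorm (map f s) = `|\sum_(i < size s) f (nth x0 s i) *: e i|.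
Proof.
rewrite /lnorm size_map; congr `|_|; apply: eq_bigr => i _.
by rewrite (nth_map x0).
Qed.

Lemma lnormD (T : Type) (f g : T -> R) (s : seq T) :
  lnorm (map (fun x => f x + g x) s) <= lnorm (map f s) + lnorm (map g s).
Proof.
case: s => [|x0 s]; first by rewrite /lnorm big_ord0 normr0 addr0.
rewrite !(lnorm_map_nth x0) (le_trans _ (ler_normD _ _))// -big_split/=.
by under [X in _ <= `|X|]eq_bigr do rewrite -scalerDl.
Qed.

Lemma lnormZ (T : Type) a (f : T -> R) (s : seq T) :
  lnorm (map (fun x => a * f x) s) = `|a| * lnorm (map f s).
Proof.
case: s => [|x0 s]; first by rewrite /lnorm big_ord0 normr0 mulr0.
rewrite !(lnorm_map_nth x0) -normrZ scaler_sumr.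
by under [X in _ = `|X|]eq_bigr do rewrite scalerA.
Qed.

Hypothesis symN : symmetric_lnorm.

Lemma lnorm_perm c d : perm_eq c d -> lnorm c = lnorm d.
Proof. exact: symN.1. Qed.

Lemma lnorm_cons0 c : lnorm (0 :: c) = lnorm c.
Proof.
rewrite (@lnorm_perm _ (rcons c 0)); last by rewrite perm_sym perm_rcons.
rewrite /lnorm size_rcons big_ord_recr/= nth_rcons ltnn eqxx scale0r addr0.
by under eq_bigr => i _ do rewrite nth_rcons ltn_ord.
Qed.

Lemma lnorm_nil : lnorm [::] = 0. Proof. by rewrite /lnorm big_ord0 normr0. Qed.

Lemma lnorm_cons_norm a c : lnorm (`|a| :: c) = lnorm (a :: c).
Proof.
by have [a0|a0] := ler0P a; rewrite ?symN.2.
Qed.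

Lemma lnorm_convex (s : seq (R * R)) t : 0 <= t <= 1 ->
  lnorm [seq t * x.1 + (1 - t) * x.2 | x <- s] <=
  t * lnorm (unzip1 s) + (1 - t) * lnorm (unzip2 s).
Proof.
move=> /andP[t0 t1]; rewrite (le_trans (lnormD _ _ _))// !lnormZ !ger0_norm ?subr_ge0//.
Qed.

Lemma lnorm_cons_convex a b t c : 0 <= t <= 1 ->
  lnorm (t * a + (1 - t) * b :: c) <= t * lnorm (a :: c) + (1 - t) * lnorm (b :: c).
Proof.
move=> t01; have := @lnorm_convex ((a, b) :: [seq (x, x) | x <- c]) t t01.
rewrite /= /unzip1 /unzip2 -!map_comp/= !map_id_in//.
by move=> x _; rewrite /= -mulrDl addrC subrK mul1r.
Qed.

(** [|a|] is a convex combination of [|b|] and [- |b|], which give the same norm by sign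
    invariance. *)
Lemma lnorm_cons_le a b c : `|a| <= `|b| -> lnorm (a :: c) <= lnorm (b :: c).
Proof.
have [->|b0] := eqVneq b 0; first by rewrite normr0 normr_le0 => /eqP->.
rewrite -(lnorm_cons_norm a) -(lnorm_cons_norm b) => ab.
have b1 : 0 < `|b| by rewrite normr_gt0.
pose t := (1 + `|a| / `|b|) / 2.
have ab1 : 0 <= `|a| / `|b| <= 1 by rewrite divr_ge0//= ler_pdivrMr// mul1r.
have -> : `|a| = t * `|b| + (1 - t) * - `|b| by rewrite /t; field; rewrite gt_eqF.
rewrite (le_trans (lnorm_cons_convex _ _ _ _))//; first by rewrite /t; lra.
by rewrite symN.2 -mulrDl addrC subrK mul1r.
Qed.

(** Entries are replaced one at a time: [l] collects those already replaced, and symmetry brings the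
    current one to the head. *)
Lemma lnorm_cat_map_le (T : Type) (f g : T -> R) (s : seq T) l :
  (forall x, `|f x| <= `|g x|) -> lnorm (l ++ map f s) <= lnorm (l ++ map g s).
Proof.
move=> fg; elim: s l => [|x s IH] l //=.
rewrite (@lnorm_perm _ (f x :: (l ++ map f s))); last by rewrite perm_catC/= perm_cons perm_catC.
rewrite (le_trans (lnorm_cons_le _ (fg x)))//.
rewrite -cat_cons (le_trans (IH _))// le_eqVlt; apply/orP; left; apply/eqP/lnorm_perm.
by rewrite perm_sym perm_catC/= perm_cons perm_catC.
Qed.

Lemma lnorm_map_le (T : eqType) (f g : T -> R) (s : seq T) :
  {in s, forall x, `|f x| <= `|g x|} -> lnorm (map f s) <= lnorm (map g s).
Proof.
move=> fg; pose f' x := if x \in s then f x else 0.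
rewrite (@eq_in_map _ _ f f' s).1; last by move=> x xs; rewrite /f' xs.
apply: (@lnorm_cat_map_le _ f' g s [::]) => x; rewrite /f'; case: ifP => // xs.
  exact: fg.
by rewrite normr0.
Qed.

Lemma lnorm_swap a b l : lnorm (a :: b :: l) = lnorm (b :: a :: l).
Proof. by apply: lnorm_perm; apply/permPl; exact: (perm_catCA [:: a] [:: b]). Qed.

Lemma lnorm_middle a c l : lnorm (c ++ a :: l) = lnorm (a :: c ++ l).
Proof. by apply: lnorm_perm; apply/permPl; exact: (perm_catCA c [:: a] l). Qed.

Lemma lnorm_zeros (T : Type) (s : seq T) l : lnorm (map (fun=> 0) s ++ l) = lnorm l.
Proof. by elim: s => //= x s IH; rewrite lnorm_cons0. Qed.

Lemma lnorm_filter_le (T : Type) (P : pred T) (c : T -> R) (s : seq T) :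
  lnorm (map c [seq x <- s | P x]) <= lnorm (map c s).
Proof.
rewrite -[X in lnorm X <= _]cats0 -[X in _ <= lnorm X]cats0.
elim: s [::] => //= x s IH l; rewrite -lnorm_middle; case: ifP => _ /=.
  by rewrite -lnorm_middle.
rewrite (le_trans (IH l))// lnorm_middle// -lnorm_cons0.
by apply: lnorm_cons_le; rewrite normr0.
Qed.

(** With [s = |a| + |b|], the pair of absolute values is a convex combination of [(s, 0)] and
    [(0, s)], both of which count as the single entry [s]. *)
Lemma lnorm_merge a b l : lnorm (a :: b :: l) <= lnorm (`|a| + `|b| :: l).
Proof.
set s := `|a| + `|b|.
have [s0|s0] := eqVneq s 0.
  have : `|a| + `|b| == 0 by rewrite -/s s0.
  rewrite paddr_eq0// !normr_eq0 => /andP[/eqP-> /eqP->].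
  by rewrite s0 !lnorm_cons0.
have sp : 0 < s by rewrite lt_def s0 addr_ge0.
pose t := `|a| / s.
have t01 : 0 <= t <= 1.
  by apply/andP; split; [rewrite divr_ge0// ltW|rewrite ler_pdivrMr// mul1r lerDl].
have -> : lnorm (a :: b :: l) = lnorm (`|a| :: `|b| :: l).
  by rewrite lnorm_cons_norm (lnorm_swap a b) (lnorm_swap a `|b|) lnorm_cons_norm.
have bE : `|b| = (1 - t) * s by rewrite /t /s; field; rewrite -/s.
have aE : `|a| = t * s by rewrite /t divfK.
have := @lnorm_convex ((s, 0) :: (0, s) :: [seq (x, x) | x <- l]) t t01.
rewrite /= /unzip1 /unzip2 -!map_comp/= !map_id_in//; last first.
  by move=> x _; rewrite /= -mulrDl addrC subrK mul1r.
rewrite !mulr0 addr0 add0r -aE -bE => /le_trans; apply.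
rewrite lnorm_cons0 (lnorm_swap s 0).
by rewrite lnorm_cons0 -mulrDl addrC subrK mul1r.
Qed.

(** The sum has at most one nonzero term, which is merged into the entry of [u] with the same
    index. *)
Lemma lnorm_absorb (I : eqType) (w u : I -> R) (r : seq I) l : uniq r ->
  {in r &, forall i k, i != k -> w i = 0 \/ w k = 0} -> (forall i, 0 <= u i) ->
  lnorm (\sum_(i <- r) w i :: map u r ++ l) <= lnorm (map (fun i => u i + `|w i|) r ++ l).
Proof.
move=> ur w1 u0; elim: r l ur w1 => [|i r IH] l; first by rewrite big_nil lnorm_cons0.
move=> /= /andP[ir ur] w1; rewrite big_cons.
have w1' : {in r &, forall i k, i != k -> w i = 0 \/ w k = 0}.
  by move=> k m kr mr; apply: w1; rewrite inE ?kr ?mr orbT.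
have [wi|wi] := eqVneq (w i) 0.
  rewrite wi add0r normr0 addr0 lnorm_swap.
  rewrite -(lnorm_middle (u i) (\sum_(j <- r) w j :: map u r) l) -lnorm_middle.
  exact: IH.
have wk k : k \in r -> w k = 0.
  move=> kr; have ik : i != k by apply: contraNneq ir => ->.
  have := w1 i k; rewrite !inE eqxx kr orbT => /(_ isT isT ik)[wi0|//].
  by rewrite wi0 eqxx in wi.
rewrite big_seq big1// addr0 (le_trans (lnorm_merge _ _ _))//.
rewrite (ger0_norm (u0 i)) (addrC `|w i|) le_eqVlt; apply/orP; left; apply/eqP; congr (lnorm (_ :: _ ++ _)).
by apply/eq_in_map => k kr; rewrite wk// normr0 addr0.
Qed.

(** In a matrix with at most one nonzero entry per column, merging the entries of each row does not
    decrease the norm. This is how the increments over many intervals are charged to the tents or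
    gaps in which they occur. *)
Lemma lnorm_collect (I T : eqType) (v : I -> T -> R) (r : seq I) (s : seq T) : uniq r ->
  {in s, forall x, {in r &, forall i k, i != k -> v i x = 0 \/ v k x = 0}} ->
  lnorm [seq \sum_(i <- r) v i x | x <- s] <= lnorm [seq \sum_(x <- s) `|v i x| | i <- r].
Proof.
move=> ur; rewrite -[X in lnorm X <= _]cats0 -[X in _ <= lnorm X]cats0.
elim: s [::] => [|x s IH] l v1.
  by rewrite /= (@eq_map _ _ _ (fun=> 0)) ?lnorm_zeros// => i; exact: big_nil.
rewrite /= -lnorm_middle (le_trans (IH _ _))//.
  by move=> y ys; apply: v1; rewrite inE ys orbT.
rewrite lnorm_middle (le_trans (lnorm_absorb _ ur _ _))//.
- by apply: v1; rewrite inE eqxx.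
- by move=> i; apply: sumr_ge0.
rewrite le_eqVlt; apply/orP; left; apply/eqP; congr (lnorm (_ ++ _)).
by apply/eq_map => i; rewrite big_cons addrC.
Qed.

Lemma lnorm1Z a : lnorm [:: a] = lnorm [:: 1] * `|a|.
Proof.
have := @lnormZ R a id [:: 1]; rewrite /= mulr1 => ->.
by rewrite mulrC.
Qed.

Lemma lnorm_le_sum (T : eqType) (f : T -> R) (s : seq T) :
  lnorm (map f s) <= lnorm [:: 1] * \sum_(x <- s) `|f x|.
Proof.
have := @lnorm_collect unit T (fun=> f) [:: tt] s isT.
rewrite /= (@eq_map _ _ _ f) => [|x]; last by rewrite big_seq1.
by rewrite lnorm1Z ger0_norm ?sumr_ge0// => -> // x _ [] [].
Qed.

(* The mean of all rotations of c is the constant list of its mean. *)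
Lemma lnorm_mean c : `|\sum_(a <- c) a| * lnorm (nseq (size c) 1) <= (size c)%:R * lnorm c.
Proof.
set n := size c; set m := \sum_(a <- c) a.
have rotE i : (i < n)%N -> \sum_(k < n) (rot k c)`_i = m.
  move=> iN; have ->: m = \sum_(0 <= k < n) c`_k by rewrite /m (big_nth 0).
  have ni : (n - i <= n)%N by rewrite leq_subr.
  rewrite -(big_mkord xpredT (fun k => (rot k c)`_i)) (@big_cat_nat _ _ _ (n - i))//=.
  rewrite [RHS](@big_cat_nat _ _ _ i)/= ?(ltnW iN)// addrC; congr (_ + _).
    rewrite -{1}[(n - i)%N]add0n big_addn subKn ?(ltnW iN)//.
    apply: eq_big_nat => k /andP[_ ki].
    rewrite /rot nth_cat size_drop -/n ifF; last by apply/negbTE; lia.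
    by rewrite nth_take; [congr nth; lia|lia].
  have -> : \sum_(i <= k < n) c`_k = \sum_(0 <= k < n - i) c`_(k + i).
    by rewrite -{1}[i]add0n big_addn.
  apply: eq_big_nat => k /andP[_ ki].
  rewrite /rot nth_cat size_drop -/n ifT; last by lia.
  by rewrite nth_drop.
have h k : (k <= n)%N ->
  lnorm (mkseq (fun i => \sum_(q < k) (rot q c)`_i) n) <= k%:R * lnorm c.
  elim: k => [|k IH] kn.
    rewrite /mkseq (@eq_map _ _ _ (fun=> 0)) => [|i]; last exact: big_ord0.
    by have := lnorm_zeros (iota 0 n) [::]; rewrite cats0 mul0r lnorm_nil => ->.
  rewrite /mkseq (@eq_map _ _ _ (fun i => \sum_(q < k) (rot q c)`_i + (rot k c)`_i)).
    rewrite (le_trans (lnormD _ _ _))// -natr1 mulrDl mul1r.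
    apply: lerD; first exact/IH/ltnW.
    rewrite (_ : map _ _ = rot k c); first by rewrite (@lnorm_perm _ c)// perm_rot.
    by apply: (@eq_from_nth _ 0); rewrite ?size_map ?size_iota ?size_rot// => i iN;
      rewrite (nth_map 0%N) ?size_iota// nth_iota.
  by move=> i; rewrite big_ord_recr.
have := h n (leqnn _); apply: le_trans; have -> : nseq n 1 = map (fun=> 1 : R) (nseq n tt) by rewrite map_nseq.
rewrite -(@lnormZ _ m) map_nseq /mkseq le_eqVlt; apply/orP; left; apply/eqP; congr lnorm.
apply: (@eq_from_nth _ 0); rewrite size_nseq ?size_map ?size_iota// => i iN.
by rewrite nth_nseq iN (nth_map 0%N) ?size_iota// nth_iota// add0n rotE// mulr1.
Qed.

Lemma lnorm_mkseq_pad (d : nat -> R) n m : (n <= m)%N -> (forall i, (n <= i)%N -> d i = 0) ->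
  lnorm (mkseq d m) = lnorm (mkseq d n).
Proof.
move=> nm d0; rewrite -(subnKC nm) /mkseq iotaD map_cat add0n.
rewrite (@lnorm_perm _ (map d (iota n (m - n)) ++ map d (iota 0 n))); last by rewrite perm_catC.
rewrite (@eq_in_map _ _ _ (fun=> 0) (iota n (m - n))).1 ?lnorm_zeros// => i.
by rewrite mem_iota => /andP[/d0].
Qed.

(** Finite form of a shrinking basis: a bounded functional on finite sequences has tails of small
    norm. *)
Definition shrinking_lnorm := forall (alpha : nat -> R) (M : R),
  (forall n (d : nat -> R), `|\sum_(i < n) alpha i * d i| <= M * lnorm (mkseq d n)) ->
  forall eps, 0 < eps -> exists J, forall n (d : nat -> R), (forall i, (i < J)%N -> d i = 0) ->
    `|\sum_(i < n) alpha i * d i| <= eps * lnorm (mkseq d n).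

Hypothesis lnorm1_gt0 : 0 < lnorm [:: 1].
Hypothesis shrN : shrinking_lnorm.

(** If these norms exceeded [eps * n] infinitely often, [lnorm_mean] would make the sum of the
    entries a functional bounded by [eps^-1]. It equals 1 on every unit vector, so its tails are not
    small; the threshold [(2 * lnorm [:: 1])^-1] turns this into [1 <= 1/2]. *)
Lemma lnorm_ones_small eps : 0 < eps ->
  exists J, forall n, (J <= n)%N -> lnorm (nseq n 1) <= eps * n%:R.
Proof.
move=> eps0; apply: contrapT => h.
have {}h J : exists2 n, (J <= n)%N & eps * n%:R < lnorm (nseq n 1).
  apply: contrapT => hJ; apply: h; exists J => n Jn; rewrite leNgt; apply/negP => hn.
  by apply: hJ; exists n.
have [||J hJ] := @shrN (fun=> 1) eps^-1 _ (2 * lnorm [:: 1])^-1.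
- move=> n d; have [m nm hm] := h n.+1.
  pose d' i := if (i < n)%N then d i else 0.
  have -> : lnorm (mkseq d n) = lnorm (mkseq d' m).
    rewrite (@lnorm_mkseq_pad d' n m) ?(ltnW nm)//.
      congr lnorm; apply/eq_in_map => i; rewrite mem_iota add0n /d' => /andP[_ ->]//.
    by move=> i ni; rewrite /d' ltnNge ni.
  have := lnorm_mean (mkseq d' m); rewrite size_mkseq.
  have -> : \sum_(a <- mkseq d' m) a = \sum_(i < n) 1 * d i.
    rewrite big_map -[m]subn0 -/(index_iota 0 m) big_mkord (big_ord_widen_cond m xpredT (fun i => 1 * d i)) ?(ltnW nm)//.
    by rewrite [RHS]big_mkcond/=; apply: eq_bigr => i _; rewrite /d' mul1r.
  move=> h1; rewrite ler_pdivlMl//.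
  have m0 : 0 < m%:R :> R by rewrite ltr0n; exact: leq_ltn_trans nm.
  rewrite -(ler_pM2l m0) (le_trans _ h1)// mulrA (mulrC _ `|_|) (mulrC m%:R).
  by rewrite ler_wpM2l// ltW.
- by rewrite invr_gt0 mulr_gt0.
have := hJ J.+1 (fun i => (i == J)%:R).
have -> : \sum_(i < J.+1) 1 * (i == J :> nat)%:R = 1 :> R.
  rewrite big_ord_recr/= eqxx mulr1 big1 ?add0r// => i _.
  by rewrite ltn_eqF ?mulr0// ltn_ord.
have -> : lnorm (mkseq (fun i => (i == J)%:R) J.+1) = lnorm [:: 1].
  rewrite mkseqS eqxx -cats1 lnorm_middle cats0.
  rewrite /mkseq (@eq_in_map _ _ _ (fun=> 0) (iota 0 J)).1; last first.
    by move=> i; rewrite mem_iota add0n => /andP[_ iJ]; rewrite ltn_eqF.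
  by rewrite -(cats0 (map _ _)) -lnorm_middle lnorm_zeros.
rewrite normr1 invfM -mulrA mulVf ?gt_eqF// mulr1 => h1.
suff : 1 <= 2^-1 :> R by rewrite leNgt invf_lt1 ?ltr1n.
by apply: h1 => i iJ; rewrite ltn_eqF.
Qed.

(** Otherwise, pairwise disjoint finite blocks on which [g] is large can be chosen one after the
    other; listed in this order, their points turn [g] into a sequence that contradicts the
    shrinking property. *)
Lemma shrinking_family (G : eqType) (g : G -> R) (M : R) :
  (forall s (c : G -> R), uniq s -> `|\sum_(x <- s) g x * c x| <= M * lnorm (map c s)) ->
  forall eps, 0 < eps -> exists A : seq G, forall s (c : G -> R), uniq s ->
    {in s, forall x, x \notin A} -> `|\sum_(x <- s) g x * c x| <= eps * lnorm (map c s).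
Proof.
move=> gM eps eps0; apply: contrapT => h.
have /choice[F hF] (A : seq G) : exists sc : seq G * (G -> R), [/\ uniq sc.1,
    {in sc.1, forall x, x \notin A} &
    eps * lnorm (map sc.2 sc.1) < `|\sum_(x <- sc.1) g x * sc.2 x|].
  apply: contrapT => hA; apply: h; exists A => s c us sA.
  by rewrite leNgt; apply/negP => hs; apply: hA; exists (s, c).
have F1 A : (F A).1 != [::].
  apply/eqP => F0; have [_ _] := hF A.
  by rewrite F0 big_nil normr0 ltNge mulr_ge0 ?lnorm_ge0// ltW.
pose A := fix A n := if n is k.+1 then A k ++ (F (A k)).1 else [::].
have uA n : uniq (A n).
  elim: n => //= n IH; rewrite cat_uniq IH/=; have [-> hn _] := hF (A n).
  by rewrite andbT; apply/hasPn => x /hn.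
have sA n : (n <= size (A n))%N.
  elim: n => //= n IH; rewrite size_cat -addn1 leq_add//.
  by rewrite lt0n size_eq0 F1.
have [x0 _] : exists x0 : G, True.
  by have := F1 [::]; case: (F [::]).1 => // x0; exists x0.
have preA n k : exists t, A (n + k)%N = A n ++ t.
  elim: k => [|k [t IH]]; first by exists [::]; rewrite addn0 cats0.
  by exists (t ++ (F (A (n + k)%N)).1); rewrite addnS/= {1}IH catA.
(* The blocks are nonempty, so [A i.+1] has more than [i] entries, and later blocks are appended
   behind them. *)
pose ga i := nth x0 (A i.+1) i.
have gaE n i : (i < size (A n))%N -> ga i = nth x0 (A n) i.
  move=> iA; have [ni|ni] := leqP n i.+1.
    by have [t] := preA n (i.+1 - n)%N; rewrite subnKC// => E; rewrite /ga E nth_cat iA.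
  have [t] := preA i.+1 (n - i.+1)%N; rewrite subnKC ?(ltnW ni)// => E.
  by rewrite E nth_cat sA.
have sumE n (s : nat -> R) : \sum_(i < size (A n)) g (ga i) * s i =
    \sum_(x <- A n) g x * s (index x (A n)).
  rewrite (big_nth x0) big_mkord; apply: eq_bigr => i _.
  by rewrite (gaE n)// index_uniq.
have mapE n (s : nat -> R) : mkseq s (size (A n)) = [seq s (index x (A n)) | x <- A n].
  apply: (@eq_from_nth _ 0); rewrite ?size_mkseq ?size_map// => i iA.
  by rewrite nth_mkseq// (nth_map x0)// index_uniq.
have [|J hJ] := @shrN (g \o ga) M _ eps eps0.
  move=> n d; pose d' i := if (i < n)%N then d i else 0.
  have d'0 i : (n <= i)%N -> d' i = 0 by rewrite /d' leqNgt => /negbTE->.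
  have -> : lnorm (mkseq d n) = lnorm (mkseq d' (size (A n))).
    rewrite (@lnorm_mkseq_pad d' n)//.
    by congr lnorm; apply/eq_in_map => i; rewrite mem_iota add0n /d' => /andP[_ ->].
  have -> : \sum_(i < n) (g \o ga) i * d i = \sum_(i < size (A n)) g (ga i) * d' i.
    rewrite (big_ord_widen_cond _ xpredT (fun i => g (ga i) * d i) (sA n)).
    by rewrite big_mkcond/=; apply: eq_bigr => i _; rewrite /d'; case: ifP; rewrite ?mulr0.
  by rewrite sumE mapE; exact: gM.
have [us sd lt] := hF (A J); move: us sd lt; set s := (F (A J)).1; set c := (F (A J)).2 => us sd lt.
pose d i := if (i < size (A J))%N then 0 else c (ga i).
have := hJ (size (A J.+1)) d; rewrite sumE mapE.
have [d0 dc] : {in A J, forall x, d (index x (A J.+1)) = 0} /\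
    {in s, forall x, d (index x (A J.+1)) = c x}.
  split=> x xA; rewrite /d /= index_cat.
    by rewrite xA index_mem xA.
  rewrite (negbTE (sd x xA)) ltnNge leq_addr/= (gaE J.+1)/= ?size_cat ?ltn_add2l ?index_mem//.
  by rewrite nth_cat ltnNge leq_addr/= addKn nth_index.
rewrite /= -/s big_cat/= map_cat.
rewrite big_seq big1 ?add0r; last by move=> x xA; rewrite [d _]d0 ?mulr0.
rewrite (@eq_in_map _ _ _ (fun=> 0) (A J)).1; last by move=> x xA; rewrite [d _]d0.
rewrite lnorm_zeros (@eq_in_map _ _ _ c s).1; last by move=> x xs; rewrite [d _]dc.
rewrite big_seq (eq_bigr (fun x => g x * c x)) -?big_seq; last by move=> x xs; rewrite [d _]dc.
rewrite leNgt lt => h1; suff : false by [].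
by apply: h1 => i iJ; rewrite /d (leq_trans iJ)// sA.
Qed.

End ListNorm.

(** * Primitives of integrable functions *)

Section Primitive.
Variable R : realType.
Local Notation mu := (@lebesgue_measure R).
Implicit Types (f g : R -> R) (p q x y : R).

Definition clamp p q x : R := if x <= p then p else if q <= x then q else x.

Lemma clamp_itv p q x : p <= q -> p <= clamp p q x <= q.
Proof. by rewrite /clamp => pq; case: (leP x p) => ?; case: (leP q x) => ?; lra. Qed.

Lemma clamp_id p q x : p <= x <= q -> clamp p q x = x.
Proof. by rewrite /clamp => ?; case: (leP x p) => ?; case: (leP q x) => ?; lra. Qed.

Lemma clamp_le p q x : x <= p -> clamp p q x = p.
Proof. by rewrite /clamp => ->. Qed.

Lemma clamp_ge p q x : p <= q -> q <= x -> clamp p q x = q.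
Proof. by rewrite /clamp => pq qx; case: (leP x p) => ?; case: (leP q x) => ?; lra. Qed.

Lemma clamp_mono p q x y : p <= q -> x <= y -> clamp p q x <= clamp p q y.
Proof.
rewrite /clamp => pq xy.
by case: (leP x p) => ?; case: (leP q x) => ?; case: (leP y p) => ?; case: (leP q y) => ?; lra.
Qed.

Lemma clamp_lipschitz p q x y : p <= q -> `|clamp p q x - clamp p q y| <= `|x - y|.
Proof.
rewrite /clamp => pq; wlog xy : x y / x <= y.
  by move=> h; have [/h//|/ltW/h] := leP x y; rewrite distrC (distrC x).
rewrite distrC (distrC x) !ger0_norm ?subr_ge0//; last exact: clamp_mono.
by case: (leP x p) => ?; case: (leP q x) => ?; case: (leP y p) => ?; case: (leP q y) => ?; lra.
Qed.

Lemma clamp_continuous p q : p <= q -> continuous (clamp p q).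
Proof.
move=> pq x; apply/cvgrPdist_lt => e e0.
have /cvgrPdist_lt/(_ e e0) : id y @[y --> x] --> x by exact: cvg_id.
by apply: filterS => y; exact/le_lt_trans/clamp_lipschitz.
Qed.

(** Clamping makes the primitive continuous on the whole line and constant on either side of
    [0,1]. *)
Definition prim f x := \int[mu]_(y in `[0%R, clamp 0 1 x]) f y.

Definition int01 f := mu.-integrable `[0%R, 1%R] (EFin \o f).

Lemma int01S f (A : set R) : int01 f -> measurable A -> A `<=` `[0, 1]%classic ->
  mu.-integrable A (EFin \o f).
Proof. by move=> intf mA A01; apply: integrableS intf. Qed.

Lemma prim01 f x : 0 <= x <= 1 -> prim f x = \int[mu]_(y in `[0%R, x]) f y.
Proof. by move=> x01; rewrite /prim clamp_id. Qed.

Lemma prim_clamp f x : prim f (clamp 0 1 x) = prim f x.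
Proof. by rewrite /prim [clamp 0 1 (clamp _ _ _)]clamp_id// clamp_itv. Qed.

Lemma prim_linear a f g x : int01 f -> int01 g ->
  prim (fun y => a * f y + g y) x = a * prim f x + prim g x.
Proof.
move=> intf intg; rewrite /prim.
have sub : `[0%R, clamp 0 1 x] `<=` `[0%R, 1%R].
  by apply: subset_itvl; rewrite bnd_simp; have /andP[] := @clamp_itv 0 1 x ler01.
have intaf : int01 (fun y => a * f y).
  have mI : measurable (`[0%R, 1%R]%classic : set R) by [].
  rewrite /int01 (_ : EFin \o _ = (fun x => a%:E * (EFin \o f) x)%E).
    exact: integrableZl.
  by apply/funext => y.
by rewrite RintegralD ?RintegralZl//; exact: int01S sub.
Qed.

Lemma prim_itv f (a b : R) (l r : bool) : int01 f -> 0 <= a -> a <= b -> b <= 1 ->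
  \int[mu]_(x in [set` Interval (BSide l a) (BSide r b)]) f x = prim f b - prim f a.
Proof.
move=> intf a0 ab b1.
have iS (l' r' : bool) : mu.-integrable [set` Interval (BSide l' a) (BSide r' b)] (EFin \o f).
  apply: (int01S intf) => //; apply: subset_itv.
    by case: l'; rewrite bnd_simp.
  by case: r'; rewrite bnd_simp.
rewrite !prim01 ?a0 ?b1 ?(le_trans a0 ab) ?(le_trans ab b1)//.
rewrite Rintegral_itvB ?bnd_simp//; last first.
  by apply: (int01S intf) => //; apply: subset_itvl; rewrite bnd_simp.
transitivity (\int[mu]_(x in [set` Interval (BSide l a) (BRight b)]) f x).
  by case: r => //; rewrite Rintegral_itv_bndo_bndc.
by case: l => //; rewrite Rintegral_itv_obnd_cbnd.
Qed.

Lemma prim_continuous f : int01 f -> continuous (prim f).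
Proof.
move=> intf x; have /subspace_continuousP := parameterized_integral_continuous ler01 intf.
move=> /(_ (clamp 0 1 x)); rewrite /= in_itv/= clamp_itv// => /(_ isT) h.
move=> A /h; rewrite /fmap/= => /(@clamp_continuous 0 1 ler01 x) hA.
have {}hA : nbhs x (clamp 0 1 @^-1` (fun t => t \in `[0, 1] -> A (\int[mu]_(y in `[0%R, t]) f y))) := hA.
apply: (@filterS _ (nbhs x) _ _ _ _ hA) => y /=; apply.
by rewrite in_itv/= clamp_itv.
Qed.

(** [G] is the primitive of [|f|]; it bounds sums of increments over disjoint intervals. *)
Lemma prim_dominated f : int01 f -> exists G : R -> R,
  [/\ continuous G, {homo G : x y / x <= y} &
      forall x y, x <= y -> `|prim f y - prim f x| <= G y - G x].
Proof.
move=> intf; pose g x := `|f x|.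
have intg : int01 g by exact: (integrable_norm intf).
have dom x y : x <= y -> `|prim f y - prim f x| <= prim g y - prim g x.
  move=> xy; rewrite -(prim_clamp f x) -(prim_clamp f y) -(prim_clamp g x) -(prim_clamp g y).
  have /andP[x0 _] := @clamp_itv 0 1 x ler01; have /andP[_ y1] := @clamp_itv 0 1 y ler01.
  have cxy := @clamp_mono 0 1 _ _ ler01 xy.
  rewrite -(@prim_itv f _ _ true false)// -(@prim_itv g _ _ true false)//.
  apply: le_normr_Rintegral => //; apply: (int01S intf) => //.
  by apply: subset_itv; rewrite bnd_simp.
exists (prim g); split=> //; first exact: prim_continuous.
by move=> x y /dom h; rewrite -subr_ge0; exact: le_trans (normr_ge0 _) h.
Qed.

End Primitive.

Section IntegrableFunctions.
Variable R : realType.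
Local Notation mu := (@lebesgue_measure R).
Implicit Types (f g : L1 R).

(** [mu01] and [mu] agree on the measurable subsets of (0,1), and the two end points are null. *)
Lemma L1_int01 f : int01 f.
Proof.
have /Lfun1_integrable intf := LfunP f; have /integrableP[mf ioo] := intf.
have mI : measurable (`]0%R, 1%R[%classic : set R) by [].

have : mu.-integrable `]0%R, 1%R[ (EFin \o f).
  apply/integrableP; split; first exact: (measurable_funS measurableT (@subsetT _ _) mf).
  rewrite (@eq_measure_integral _ _ _ _ (@mu01 R)).
    apply: le_lt_trans ioo; apply: ge0_subset_integral => //.
    exact: (measurable_int _ (integrable_abse intf)).
  by move=> A mA AI; rewrite /= /mu01 /mrestr setIidl.
move=> /integrableP[mf1 i1]; apply/integrableP; split.
  exact: (measurable_funS measurableT (@subsetT _ _) mf).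
have mabs := measurable_int _ (integrable_abse intf).
rewrite -integral_itv_bndo_bndc -?integral_itv_obnd_cbnd//;
  exact: (measurable_funS measurableT (@subsetT _ _) mabs).
Qed.

Lemma primP a f g x : prim (a *: f + g) x = a * prim f x + prim g x.
Proof. by rewrite -prim_linear//; exact: L1_int01. Qed.

Lemma L1_restr_subproof f (p q : R) : (f : R -> R) \_ `]p, q[ \in Lfun (@mu01 R) 1.
Proof.
have /Lfun1_integrable intf := LfunP f.
apply/Lfun1_integrable; rewrite -restrict_EFin.
have mD : measurable (`]p, q[%classic : set (measurableTypeR R)) by exact: measurable_itv.
apply/(integrable_mkcond _ mD).
exact: (integrableS _ _ _ intf).
Qed.

Definition restr f p q : L1 R := Lfun_Sub (lexx 1%E) (L1_restr_subproof f p q).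

Lemma prim_restr f p q x : 0 <= p -> p <= q -> q <= 1 ->
  prim (restr f p q) x = prim f (clamp p q x) - prim f p.
Proof.
move=> p0 pq q1; wlog x01 : x / 0 <= x <= 1.
  move=> h; rewrite -prim_clamp h ?clamp_itv//; congr (prim f _ - _).
  have [x0|x0] := leP x 0.
    by rewrite (clamp_le 1 x0) !clamp_le// (le_trans x0).
  have [x1|x1] := leP 1 x.
    by rewrite (clamp_ge ler01 x1) !clamp_ge// (le_trans q1).
  by rewrite [clamp 0 1 x]clamp_id// !ltW.
rewrite prim01// /= -Rintegral_mkcondr.
have /andP[pc cq] := clamp_itv x pq.
rewrite -(@prim_itv _ f p _ false true (L1_int01 f)) ?(le_trans cq)//.
have [xp|px] := leP x p.
  rewrite clamp_le// (_ : _ `&` _ = set0).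
    by rewrite Rintegral_set0 set_itv_ge ?Rintegral_set0// bnd_simp ltxx.
  apply/seteqP; split=> // y [/=]; rewrite !in_itv/= => /andP[_ yx] /andP[py _].
  by have := le_lt_trans (le_trans yx xp) py; rewrite ltxx.
have [qx|xq] := leP q x.
  rewrite clamp_ge// (_ : _ `&` _ = `]p, q[%classic).
    by rewrite !prim_itv//; exact: L1_int01.
  apply/seteqP; split=> y /=; first by case.
  rewrite !in_itv/= => /andP[py yq]; split; last by rewrite py yq.
  by rewrite (le_trans p0 (ltW py)) (le_trans (ltW yq) qx).
rewrite clamp_id ?(ltW px) ?(ltW xq)// (_ : _ `&` _ = `]p, x]%classic).
  have xr r := @prim_itv _ f p x false r (L1_int01 f) p0 (ltW px) (le_trans (ltW xq) q1).
  by rewrite (xr true) (xr false).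
apply/seteqP; split=> y /=; rewrite !in_itv/=.
  by move=> [/andP[_ ->] /andP[->]].
move=> /andP[py yx]; rewrite yx py (le_lt_trans yx xq) (le_trans p0 (ltW py)).
by [].
Qed.

Lemma L1_one_subproof : (cst 1 : R -> R) \in Lfun (@mu01 R) 1.
Proof.
apply/Lfun1_integrable/integrableP; split.
  have -> : EFin \o cst (1 : R) = cst 1%E by [].
  exact: measurable_cst.
rewrite (eq_integral (cst 1%E)); last by move=> x _; rewrite /= normr1.
rewrite integral_cst//= mul1e /mu01 /mrestr setTI lebesgue_measure_itv/= lte01.
by rewrite sube0 ltry.
Qed.

Definition L1_one : L1 R := Lfun_Sub (lexx 1%E) (L1_one_subproof).

Lemma prim_one x : prim L1_one x = clamp 0 1 x.
Proof.
have /andP[x0 _] := @clamp_itv R 0 1 x ler01.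
rewrite /prim /= Rintegral_cst//= mul1r lebesgue_measure_itv/= lte_fin.
have [x0'|x0'] := ltP 0 (clamp 0 1 x); first by rewrite -EFinD/= subr0.
by apply/eqP; rewrite eq_le x0 x0'.
Qed.

End IntegrableFunctions.

Section PrimLinear.
Variable R : realType.
Implicit Types f g : L1 R.

Lemma prim_L1_0 x : prim (0 : L1 R) x = 0.
Proof. by have := primP 1 (0 : L1 R) 0 x; rewrite scaler0 addr0 mul1r => h; lra. Qed.

Lemma primZ a f x : prim (a *: f) x = a * prim f x.
Proof. by have := primP a f 0 x; rewrite addr0 prim_L1_0 addr0. Qed.

Lemma primD f g x : prim (f + g) x = prim f x + prim g x.
Proof. by have := primP 1 f g x; rewrite scale1r mul1r. Qed.

Lemma primB f g x : prim (f - g) x = prim f x - prim g x.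
Proof. by rewrite -scaleN1r primD primZ mulN1r. Qed.

Lemma prim_sum (T : Type) (s : seq T) (P : pred T) (f : T -> L1 R) x :
  prim (\sum_(t <- s | P t) f t) x = \sum_(t <- s | P t) prim (f t) x.
Proof.
elim: s => [|t s IH]; first by rewrite !big_nil prim_L1_0.
by rewrite !big_cons; case: (P t); rewrite ?primD IH.
Qed.

End PrimLinear.

(** * The norm of JF *)

Section Intervals.
Variable R : realType.
Implicit Types (I J : R * R) (s : seq (R * R)) (F G : R -> R).

Definition incr F I : R := F I.2 - F I.1.

Definition itv_disj I J := (I.2 <= J.1) || (J.2 <= I.1).

Definition in01 I := [&& 0 <= I.1, I.1 <= I.2 & I.2 <= 1].

(** Degenerate intervals, unlike in [JF_norm], are allowed, so that a family stays admissible when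
    its members are shrunk; their increments vanish, and [lnorm_filter_degenerate] discards them. *)
Definition admissible s := all in01 s && pairwise itv_disj s.

Lemma itv_disjC I J : itv_disj I J = itv_disj J I.
Proof. by rewrite /itv_disj orbC. Qed.

Lemma admissible_cons I s : admissible (I :: s) =
  [&& in01 I, all (itv_disj I) s & admissible s].
Proof. by rewrite /admissible /= -!andbA [all in01 s && _]andbCA. Qed.

Lemma admissible_perm s t : perm_eq s t -> admissible s -> admissible t.
Proof.
move=> st /andP[s01 ps]; apply/andP; split; first by rewrite -(perm_all _ st).
pose x0 : R * R := (0, 0).
rewrite perm_sym in st; have [r ri ->] := perm_iotaP x0 st.
have ur : uniq r by rewrite (perm_uniq ri) iota_uniq.
apply/(pairwiseP x0) => i k; rewrite !inE size_map => ir kr ik.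
rewrite !(nth_map 0%N)//.
have rs a : (a < size r)%N -> (nth 0%N r a < size s)%N.
  by move=> ar; have := mem_nth 0%N ar; rewrite (perm_mem ri) mem_iota add0n.
have : nth 0%N r i != nth 0%N r k by rewrite nth_uniq// ltn_eqF.
have P := elimT (pairwiseP x0) ps.
rewrite neq_ltn => /orP[h|h]; last rewrite itv_disjC;
  by apply: P h; rewrite inE rs.
Qed.

Lemma admissible_filter (P : pred (R * R)) s :
  admissible s -> admissible [seq I <- s | P I].
Proof.
move=> /andP[s01 ps]; apply/andP; split; last exact: pairwise_filter.
by apply/allP => I; rewrite mem_filter => /andP[_ /(allP s01)].
Qed.

Lemma admissible_sub (g : R * R -> R * R) s :
  {in s, forall I, [&& I.1 <= (g I).1, (g I).1 <= (g I).2 & (g I).2 <= I.2]} ->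
  admissible s -> admissible (map g s).
Proof.
elim: s => //= I s IH gs; rewrite !admissible_cons => /and3P[/and3P[I0 I12 I1] dI ads].
have /and3P[g1 g12 g2] := gs _ (mem_head _ _).
rewrite IH//; last by move=> J Js; apply: gs; rewrite inE Js orbT.
rewrite /in01 (le_trans I0 g1) g12 (le_trans g2 I1)/= andbT.
apply/allP => _ /mapP[J Js ->]; have /and3P[h1 h12 h2] := gs J (mem_behead (s := I :: s) Js).
have := allP dI J Js; rewrite /itv_disj => /orP[h|h]; apply/orP; [left|right].
  exact: le_trans g2 (le_trans h h1).
exact: le_trans h2 (le_trans h g1).
Qed.

(* Cutting the graph of G along an interval keeps it monotone. *)
Lemma admissible_sum_le G s : {homo G : x y / x <= y} -> admissible s ->
  \sum_(I <- s) incr G I <= G 1 - G 0.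
Proof.
elim: s G => [|I s IH] G hG; first by rewrite big_nil subr_ge0 hG.
rewrite admissible_cons big_cons => /and3P[/and3P[I0 I12 I1] dI ads].
pose G' x := G x - (G (clamp I.1 I.2 x) - G I.1).
have hG' : {homo G' : x y / x <= y}.
  move=> x y xy; rewrite /G' /clamp.
  have [h1|h1] := leP x I.1; have [h2|h2] := leP y I.1; have [h3|h3] := leP I.2 x;
    have [h4|h4] := leP I.2 y; rewrite ?subrr ?subr0; try (have := hG _ _ xy); try lra.
  - have -> : I.2 = I.1 by lra.
    lra.
  - have := hG _ _ h4; have := hG _ _ h1; lra.
  - have := hG _ _ h1; lra.
  - have := hG _ _ h4; lra.
have := IH G' hG' ads; rewrite {2 3}/G' (clamp_ge I12 I1) (clamp_le _ I0).
have -> : \sum_(J <- s) incr G' J = \sum_(J <- s) incr G J.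
  rewrite !big_seq; apply: eq_bigr => J Js; rewrite /incr /G'.
  have -> : clamp I.1 I.2 J.2 = clamp I.1 I.2 J.1; last by ring.
  have /and3P[_ J12 _] := allP (andP ads).1 J Js.
  have := allP dI J Js; rewrite /itv_disj => /orP[h|h].
    by rewrite !clamp_ge// (le_trans h).
  by rewrite !clamp_le// (le_trans J12).
rewrite /incr; lra.
Qed.

(** An interval that misses (p,q) shrinks to its own left end and not to [p] or [q], which might lie
    inside another member of the family. *)
Definition cut p q I : R * R :=
  if (I.2 <= p) || (q <= I.1) then (I.1, I.1) else (clamp p q I.1, clamp p q I.2).

Lemma incr_cut F p q I : p <= q -> I.1 <= I.2 ->
  incr F (cut p q I) = F (clamp p q I.2) - F (clamp p q I.1).
Proof.
rewrite /cut => pq I12; case: ifPn => // /orP[h|h]; rewrite /incr/= subrr.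
  by rewrite !clamp_le ?subrr// (le_trans I12).
by rewrite !clamp_ge ?subrr// (le_trans h).
Qed.

Lemma cut_sub p q I : p <= q -> I.1 <= I.2 ->
  [&& I.1 <= (cut p q I).1, (cut p q I).1 <= (cut p q I).2 & (cut p q I).2 <= I.2].
Proof.
rewrite /cut => pq I12; case: ifPn => [_|]; first by rewrite /= !lexx.
rewrite negb_or -!ltNge => /andP[h1 h2] /=; rewrite clamp_mono// /clamp.
by case: (leP I.1 p) => ?; case: (leP q I.1) => ?; case: (leP I.2 p) => ?;
  case: (leP q I.2) => ?; lra.
Qed.

Lemma seq_min (d : R) (D : seq R) :
  exists2 m, m \in d :: D & {in d :: D, forall x, m <= x}.
Proof.
elim: D d => [|d' D IH] d; first by exists d; rewrite ?mem_head// => x; rewrite inE => /eqP->.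
have [m mD hm] := IH d'; have [dm|md] := leP d m.
  exists d; first exact: mem_head.
  move=> x; rewrite inE => /predU1P[->//|/hm]; exact: le_trans.
exists m; first by rewrite inE mD orbT.
by move=> x; rewrite inE => /predU1P[->|/hm//]; exact: ltW.
Qed.

(** [r] runs from the least to the greatest point of [D] in [I], and is degenerate at [I.2] if there
    is none. A function that is constant on [D] has no increment over [r]. *)
Lemma itv_split (D : seq R) I : I.1 <= I.2 -> exists r : R * R,
  [/\ I.1 <= r.1, r.1 <= r.2, r.2 <= I.2, (r.1 = r.2) \/ (r.1 \in D /\ r.2 \in D) &
      {in D, forall d, ~~ (I.1 < d < r.1) /\ ~~ (r.2 < d < I.2)}].
Proof.
move=> I12; pose E := [seq d <- D | I.1 <= d <= I.2].
have ED d : d \in D -> I.1 < d < I.2 -> d \in E.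
  by move=> dD /andP[h1 h2]; rewrite mem_filter dD !ltW.
have mE d : d \in E -> [/\ d \in D, I.1 <= d & d <= I.2].
  by rewrite mem_filter => /andP[/andP[]].
case: E ED mE => [|d E] ED mE.
  exists (I.2, I.2); split=> //=; first by left.
  move=> d dD; split; last by apply/andP => -[h1 h2]; have := lt_trans h1 h2; rewrite ltxx.
  by apply/negP => /(ED d dD).
have [m /[dup] mE' /mE[mD m1 m2] hm] := seq_min d E.
have [_ /(mapP (f := -%R) (s := d :: E))[M ME ->] hM] := seq_min (- d) (map -%R E).
have {}hM x : x \in d :: E -> x <= M.
  by move=> /(map_f -%R) xE; have := hM _ xE; rewrite lerN2.
have /mE[MD M1 M2] : M \in d :: E by [].
exists (m, M); split=> //=; [exact: hM|by right|].
move=> x xD; split; apply/negP => /andP[h1 h2].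
  have /ED-/(_ xD)/hm : I.1 < x < I.2 by rewrite h1 (lt_le_trans h2).
  by rewrite leNgt h2.
have /ED-/(_ xD)/hM : I.1 < x < I.2 by rewrite h2 (le_lt_trans M1).
by rewrite leNgt h1.
Qed.

End Intervals.

Section JFNorm.
Variables (R : realType) (X : normedModType R) (e : nat -> X).
Hypothesis symN : symmetric_lnorm e.
Variables (JF : completeNormedModType R) (j : {linear L1 R -> JF}).
Hypothesis jJF : is_JF e j.
Local Notation lnorm := (lnorm e).
Local Notation mu := (@lebesgue_measure R).
Implicit Types (f g : L1 R) (s : seq (R * R)).

Lemma jf_normE f : `|j f| = JF_norm e f. Proof. exact: jJF.2. Qed.

Definition jf_set f := [set r | exists (m : nat) (a b : 'I_m -> R),
    [/\ forall i, [/\ 0 <= a i, a i < b i & b i <= 1],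
        trivIset [set: 'I_m] (fun i => `]a i, b i[%classic) &
        r = `|\sum_(i < m) (\int[mu]_(x in `]a i, b i[) f x) *: e i|]].

Lemma jf_setP f r : jf_set f r <-> exists s, [/\ admissible s, all (fun I => I.1 < I.2) s &
  r = lnorm (map (incr (prim f)) s)].
Proof.
split=> [[m [a [b [ab tab ->]]]]|[s [ads s12 ->]]].
  exists [seq (a i, b i) | i <- enum 'I_m]; split.
  - apply/andP; split.
      by apply/allP => _ /mapP[i _ ->]; rewrite /in01/=; have [-> /ltW-> ->] := ab i.
    rewrite pairwise_map; apply: (@sub_pairwise _ [rel x y | x != y]); last first.
      by rewrite -uniq_pairwise enum_uniq.
    move=> i k /= ik; apply: contraNT ik; rewrite /itv_disj/= negb_or -!ltNge => /andP[h1 h2].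
    apply/eqP; apply: tab => //.
    have [ai bi _] := ab i; have [ak bk _] := ab k.
    exists ((Num.max (a i) (a k) + Num.min (b i) (b k)) / 2).
    by split; rewrite /= in_itv/=; case: (leP (a i) (a k)) => ?; case: (leP (b i) (b k)) => ?; lra.
  - by apply/allP => _ /mapP[i _ ->] /=; have [] := ab i.
  - rewrite -map_comp /lnorm size_map size_enum_ord; congr `|_|.
    apply: eq_bigr => i _; rewrite (nth_map i) ?size_enum_ord// nth_ord_enum/=.
    have [? /ltW ? ?] := ab i.
    by rewrite (prim_itv false true (L1_int01 f)).
exists (size s), (fun i => (nth (0, 0) s i).1), (fun i => (nth (0, 0) s i).2).
have /andP[s01 ps] := ads.
have P := elimT (pairwiseP (0, 0)) ps.
split.
- move=> i; have /(allP s01)/and3P[-> _ ->] := mem_nth (0, 0) (ltn_ord i).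
  by have /(allP s12)-> := mem_nth (0, 0) (ltn_ord i).
- have key i k : (i < k)%N -> (k < size s)%N ->
     itv_disj (nth (0, 0) s i) (nth (0, 0) s k).
    by move=> ik ks; apply: P; rewrite ?inE// (ltn_trans ik).
  move=> i k _ _ [x [/=]]; rewrite !in_itv/= => /andP[i1 i2] /andP[k1 k2].
  have nd : ~~ itv_disj (nth (0, 0) s i) (nth (0, 0) s k).
    by rewrite /itv_disj negb_or -!ltNge (lt_trans k1)// (lt_trans i1).
  apply: ord_inj; case: (ltngtP (nat_of_ord i) (nat_of_ord k)) => // ik; case/negP: nd.
    by apply: key; rewrite ?ltn_ord.
  by rewrite itv_disjC; apply: key; rewrite ?ltn_ord.
rewrite (lnorm_map_nth _ (0, 0)); congr `|_|; apply: eq_bigr => i _; congr (_ *: _).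
have /(allP s01)/and3P[? ? ?] := mem_nth (0, 0) (ltn_ord i).
by rewrite (prim_itv false true (L1_int01 f)).
Qed.

Lemma lnorm_filter_degenerate (F : R -> R) s : all (@in01 R) s ->
  lnorm (map (incr F) s) = lnorm (map (incr F) [seq I <- s | I.1 < I.2]).
Proof.
rewrite -[X in lnorm X = _]cats0 -[X in _ = lnorm X]cats0.
elim: s [::] => //= I s IH l /andP[/and3P[_ I12 _] s01].
case: ifPn => [h|h].
  by rewrite /= -!(lnorm_middle symN); exact: IH.
have -> : incr F I = 0 by rewrite /incr (le_anti (_ : I.1 <= I.2 <= I.1)) ?subrr// I12 leNgt.
by rewrite (lnorm_cons0 symN); exact: IH.
Qed.

(** All these norms are at most [lnorm [:: 1]] times the total increase of the primitive of [|f|],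
    so the [sup] in [JF_norm] is a genuine one. *)
Lemma jf_set_has_sup f : has_sup (jf_set f).
Proof.
split.
  by exists (lnorm (map (incr (prim f)) [::])); apply/jf_setP; exists [::].
have [G [_ hG fG]] := prim_dominated (L1_int01 f).
exists (lnorm [:: 1] * (G 1 - G 0)) => r /jf_setP[s [ads _ ->]].
rewrite (le_trans (lnorm_le_sum symN _ _))// ler_wpM2l ?lnorm_ge0//.
rewrite (le_trans _ (admissible_sum_le hG ads))// big_seq [leRHS]big_seq.
apply: ler_sum => I Is; apply: fG.
by have /andP[/allP/(_ _ Is)/and3P[]] := ads.
Qed.

Lemma jf_ge f s : admissible s -> lnorm (map (incr (prim f)) s) <= `|j f|.
Proof.
move=> ads; rewrite jf_normE lnorm_filter_degenerate; last by have /andP[] := ads.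
apply: sup_upper_bound; first exact: jf_set_has_sup.
apply/jf_setP; exists [seq I <- s | I.1 < I.2]; split=> //.
  exact: admissible_filter.
exact: filter_all.
Qed.

Lemma jf_near f eps : 0 < eps ->
  exists2 s, admissible s & `|j f| - eps < lnorm (map (incr (prim f)) s).
Proof.
move=> e0; have [r] := sup_adherent e0 (jf_set_has_sup f).
by rewrite jf_normE => /jf_setP[s [ads _ ->]] h; exists s.
Qed.

Lemma jf_le f C : (forall s, admissible s -> lnorm (map (incr (prim f)) s) <= C) ->
  `|j f| <= C.
Proof.
move=> h; apply/ler_addgt0Pr => eps e0; have [s ads hs] := jf_near f e0.
by rewrite -lerBlDr (le_trans (ltW hs))// h.
Qed.

Lemma jf_eq f g : (forall I, in01 I -> incr (prim f) I = incr (prim g) I) -> j f = j g.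
Proof.
move=> fg; apply/eqP; rewrite -subr_eq0 -linearB -normr_le0.
apply: jf_le => s ads; rewrite (@eq_in_map _ _ _ (fun=> 0) s).1.
  by rewrite -(cats0 (map _ _)) lnorm_zeros// lnorm_nil.
move=> I Is; have /fg : in01 I by have /andP[/allP/(_ _ Is)] := ads.
by rewrite /incr !primB; lra.
Qed.

Lemma jf_incr_le f I : in01 I -> lnorm [:: 1] * `|incr (prim f) I| <= `|j f|.
Proof.
move=> I01; have := @jf_ge f [:: I]; rewrite /= lnorm1Z//; apply.
by rewrite /admissible /= I01.
Qed.

Lemma incr_restr f p q I : 0 <= p -> p <= q -> q <= 1 ->
  incr (prim (restr f p q)) I = prim f (clamp p q I.2) - prim f (clamp p q I.1).
Proof. by move=> p0 pq q1; rewrite /incr !prim_restr// opprB addrA subrK. Qed.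

(** The increments of the restriction over a family are those of [f] over the cut family. *)
Lemma jf_restr_le f p q : 0 <= p -> p <= q -> q <= 1 -> `|j (restr f p q)| <= `|j f|.
Proof.
move=> p0 pq q1; apply: jf_le => s ads.
have s01 I : I \in s -> I.1 <= I.2.
  by move=> Is; have /andP[/allP/(_ _ Is)/and3P[]] := ads.
rewrite (le_trans _ (@jf_ge f (map (cut p q) s) _))//; last first.
  by apply: admissible_sub => // I /s01; exact: cut_sub.
rewrite -map_comp le_eqVlt; apply/orP; left; apply/eqP; congr lnorm.
by apply/eq_in_map => I /s01 I12; rewrite incr_restr//= incr_cut.
Qed.

End JFNorm.

(** * Weakly null sequences in JF *)

Section WeaklyNull.
Variables (R : realType) (X : normedModType R) (e : nat -> X).
Hypothesis symN : symmetric_lnorm e.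
Variables (JF : completeNormedModType R) (j : {linear L1 R -> JF}).
Hypothesis jJF : is_JF e j.
Local Notation lnorm := (lnorm e).
Implicit Types (f g : L1 R) (s : seq (R * R)).

(** The default interval [(0, 0)] lies to the left of everything in [0,1], so padding does no
    harm. *)
Lemma admissible_mkseq_nth s J : admissible s -> admissible (mkseq (nth (0, 0) s) J).
Proof.
move=> /andP[/allP s01 ps]; have P := elimT (pairwiseP (0, 0)) ps.
have n01 i : in01 (nth (0, 0) s i).
  have [/(mem_nth (0, 0))/s01//|h] := ltnP i (size s).
  by rewrite nth_default// /in01/= lexx ler01.
apply/andP; split; first by apply/allP => _ /mapP[i _ ->].
apply/(pairwiseP (0, 0)) => i k; rewrite !inE size_mkseq => iJ kJ ik; rewrite !nth_mkseq//.
have [ks|ks] := ltnP k (size s).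
  by apply: P => //; rewrite inE// (ltn_trans ik).
rewrite [nth _ _ k]nth_default// /itv_disj/=.
by have /and3P[-> _ _] := n01 i; rewrite orbT.
Qed.

Lemma lnorm_mkseq_mono (d : nat -> R) n m : (n <= m)%N ->
  lnorm (mkseq d n) <= lnorm (mkseq d m).
Proof.
move=> nm; pose d' i := if (i < n)%N then d i else 0.
have -> : mkseq d n = mkseq d' n.
  by apply/eq_in_map => i; rewrite mem_iota add0n /d' => /andP[_ ->].
rewrite -(lnorm_mkseq_pad symN nm) => [|i ni]; last by rewrite /d' ltnNge ni.
by apply: lnorm_map_le => // i _; rewrite /d'; case: ifP; rewrite ?normr0.
Qed.

Lemma norming_family f eps : 0 < eps -> exists (m : nat) (A : nat -> R) (I : nat -> R * R),
  [/\ forall J, admissible (mkseq I J),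
      forall J (d : nat -> R), `|\sum_(i < J) A i * d i| <= lnorm (mkseq d J),
      forall i, `|A i| * i.+1%:R <= lnorm (nseq i.+1 1),
      forall i, (m <= i)%N -> A i = 0 &
      `|j f| - eps <= \sum_(i < m) A i * incr (prim f) (I i)].
Proof.
move=> e0; have [s ads hs] := jf_near symN jJF f e0.
pose n := size s; pose F k := incr (prim f) (nth (0, 0) s k).
have [a [ale aeq]] := norming_functional n e (\sum_(i < n) F i *: e i).
pose idx := sort (fun i k => `|a k| <= `|a i|) (iota 0 n).
have pidx : perm_eq idx (iota 0 n) by rewrite perm_sort.
have sidx : size idx = n by rewrite size_sort size_iota.
have uidx : uniq idx by rewrite sort_uniq iota_uniq.
have sumidx (g : nat -> R) : \sum_(i < n) g (nth 0%N idx i) = \sum_(i < n) g i.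
  rewrite -(big_mkord xpredT (fun i => g (nth 0%N idx i))) -{1}sidx -(big_nth 0%N xpredT).
  by rewrite (perm_big _ pidx)/= -[RHS](big_mkord xpredT g) /index_iota subn0.
have aN (v : nat -> R) : `|\sum_(i < n) a i * v i| <= lnorm (mkseq v n).
  rewrite lnorm_mkseq ler_norml lerNl -sumrN; apply/andP; split.
    rewrite -normrN -sumrN.
    have := ale (fun i => - v i).
    under eq_bigr do rewrite mulNr mulrC.
    by under [X in _ <= `|X| -> _]eq_bigr do rewrite scaleNr.
  by have := ale v; under eq_bigr do rewrite mulrC.
pose A i := if (i < n)%N then a (nth 0%N idx i) else 0.
pose I := nth (0, 0) (map (nth (0, 0) s) idx).
have IE i : (i < n)%N -> I i = nth (0, 0) s (nth 0%N idx i).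
  by move=> iN; rewrite /I (nth_map 0%N)// sidx.
have AN J (d : nat -> R) : `|\sum_(i < J) A i * d i| <= lnorm (mkseq d J).
  pose d' i := if (i < J)%N then d i else 0.
  have -> : \sum_(i < J) A i * d i = \sum_(i < n) A i * d' i.
    have [nJ|Jn] := leqP n J.
      rewrite [RHS](big_ord_widen_cond _ xpredT (fun i => A i * d' i) nJ) [RHS]big_mkcond/=.
      apply: eq_bigr => i _; rewrite /d' ltn_ord /A; by case: ifP; rewrite ?mul0r.
    rewrite (big_ord_widen_cond _ xpredT (fun i => A i * d i) (ltnW Jn)) big_mkcond/=.
    by apply: eq_bigr => i _; rewrite /d'; case: ifP; rewrite ?mulr0.
  have -> : \sum_(i < n) A i * d' i = \sum_(i < n) a i * d' (index (i : nat) idx).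
    rewrite -[RHS](sumidx (fun k : nat => a k * d' (index k idx))); apply: eq_bigr => i _.
    by rewrite index_uniq ?sidx// /A ltn_ord.
  have := aN (fun k : nat => d' (index k idx)); move/le_trans; apply.
  have -> : lnorm (mkseq (fun k : nat => d' (index k idx)) n) = lnorm (mkseq d' n).
    rewrite -(lnorm_perm symN (perm_map _ pidx)); congr lnorm.
    apply: (@eq_from_nth _ 0); rewrite ?size_map ?size_iota ?sidx// => i iN.
    by rewrite (nth_map 0%N) ?sidx// nth_mkseq// index_uniq ?sidx.
  have [nJ|Jn] := leqP n J.
    rewrite (le_trans _ (lnorm_mkseq_mono d nJ))// le_eqVlt; apply/orP; left; apply/eqP.
    congr lnorm; apply/eq_in_map => i; rewrite mem_iota add0n /d' => /andP[_ iN].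
    by rewrite (leq_trans iN).
  rewrite (lnorm_mkseq_pad symN (ltnW Jn)) => [|i Ji]; last by rewrite /d' ltnNge Ji.
  rewrite le_eqVlt; apply/orP; left; apply/eqP.
  by congr lnorm; apply/eq_in_map => i; rewrite mem_iota add0n /d' => /andP[_ ->].
exists n, A, I; split=> //.
- move=> J; apply: admissible_mkseq_nth; apply: (admissible_perm _ ads).
  rewrite perm_sym (perm_trans (perm_map _ pidx))//.
  rewrite (_ : map _ _ = s) ?perm_refl//; exact: mkseq_nth.
- move=> i; have [iN|iN] := ltnP i n; last by rewrite /A ltnNge iN normr0 mul0r lnorm_ge0.
  apply: (@le_trans _ _ (\sum_(k < i.+1) A k * Num.sg (A k))).
    rewrite -[i.+1 in leLHS]card_ord -sumr_const mulr_sumr.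
    apply: ler_sum => k _; rewrite mulr1 (mulrC (A k)) -normrEsg.
    have ki : (k <= i)%N by rewrite -ltnS.
    have kn : (k < n)%N := leq_ltn_trans ki iN.
    rewrite /A kn iN.
    have so : sorted (fun i k => `|a k| <= `|a i|) idx.
      by apply: sort_sorted => x y; exact: le_total.
    have tr : transitive (fun i k => `|a k| <= `|a i|).
      by move=> x y z h1 h2; exact: le_trans h2 h1.
    by apply: (sorted_leq_nth tr _ 0%N so); rewrite ?inE ?sidx.
  rewrite (le_trans (ler_norm _))// (le_trans (AN _ (fun k => Num.sg (A k))))//.
  have -> : nseq i.+1 (1 : R) = mkseq (fun=> 1) i.+1.
    apply: (@eq_from_nth _ 0); rewrite ?size_nseq ?size_mkseq// => k kn.
    by rewrite nth_nseq kn nth_mkseq.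
  apply: lnorm_map_le => // k _; rewrite normr1 normr_sg.
  by case: (_ != 0).
- by move=> i ni; rewrite /A ltnNge ni.
- rewrite (le_trans (ltW hs))// le_eqVlt; apply/orP; left; apply/eqP.
  rewrite (lnorm_map_nth _ (0, 0)) -/n -(aeq F)//.
  rewrite -(sumidx (fun k => F k * a k)); apply: eq_bigr => i _.
  by rewrite /A ltn_ord IE// mulrC.
Qed.

Hypothesis lnorm1_gt0 : 0 < lnorm [:: 1].
Hypothesis shrN : shrinking_lnorm e.

Lemma cvg_sum0 (F : nat -> nat -> R) n : (forall i, F i @ \oo --> (0 : R)) ->
  (fun k => \sum_(i < n) F i k) @ \oo --> (0 : R).
Proof.
move=> F0; elim: n => [|n IH].
  by under eq_fun do rewrite big_ord0; exact: cvg_cst.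
rewrite (_ : (fun k => _) = (fun k => \sum_(i < n) F i k) \+ F n); last first.
  by apply/funext => k; rewrite big_ord_recr.
by rewrite -[X in _ --> X]addr0; apply: cvgD.
Qed.

Definition pointwise_null (h : nat -> L1 R) :=
  forall x, 0 <= x <= 1 -> (fun k => prim (h k) x) @ \oo --> (0 : R).

(* A near-norming family is a functional f |-> sum_i A_i (int_{I_i} f); since A is ordered
   decreasingly, its tail is uniformly small on each f in L1, so that a cluster point of such
   functionals is again of this form. *)
Lemma norming_limit (x : JF) : exists b : dual JF, [/\ `|b| <= 1, b x = `|x| &
  forall (h : nat -> L1 R) M eps, (forall k, `|j (h k)| <= M) -> pointwise_null h ->
    0 < eps -> exists K, forall k, (K <= k)%N -> `|b (j (h k))| <= eps].
Proof.
have [dj _] := jJF.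
have i0 n : 0 < n.+1%:R^-1 :> R by rewrite invr_gt0.
have /choice[f hf] : forall n, exists f, `|j f - x| <= n.+1%:R^-1.
  move=> n; have [||y [/= h [f _ fy]]] := dj (ball x n.+1%:R^-1).
  - by exists x; exact: ballxx.
  - exact: ball_open.
  by exists f; move: h; rewrite fy -ball_normE/= distrC => /ltW.
have /choice[mAI hAI] : forall n, exists mAI : nat * (nat -> R) * (nat -> R * R),
    [/\ forall J, admissible (mkseq mAI.2 J),
      forall J (d : nat -> R), `|\sum_(i < J) mAI.1.2 i * d i| <= lnorm (mkseq d J),
      forall i, `|mAI.1.2 i| * i.+1%:R <= lnorm (nseq i.+1 1),
      forall i, (mAI.1.1 <= i)%N -> mAI.1.2 i = 0 &
      `|j (f n)| - n.+1%:R^-1 <= \sum_(i < mAI.1.1) mAI.1.2 i * incr (prim (f n)) (mAI.2 i)].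
  by move=> n; have [m [A [I h]]] := norming_family (f n) (i0 n); exists (m, A, I).
pose m n := (mAI n).1.1; pose A n := (mAI n).1.2; pose I n := (mAI n).2.
have adI n J : admissible (mkseq (I n) J) by have [+ _ _ _ _] := hAI n.
have AN n J (d : nat -> R) : `|\sum_(i < J) A n i * d i| <= lnorm (mkseq d J).
  by have [_ + _ _ _] := hAI n.
have Ai n i : `|A n i| * i.+1%:R <= lnorm (nseq i.+1 1) by have [_ _ + _ _] := hAI n; exact.
have Am n i : (m n <= i)%N -> A n i = 0 by have [_ _ _ + _] := hAI n; exact.
have fI n : `|j (f n)| - n.+1%:R^-1 <= \sum_(i < m n) A n i * incr (prim (f n)) (I n i).
  by have [] := hAI n.
pose B n J g := \sum_(i < J) A n i * incr (prim g) (I n i).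
have BE n J g : (m n <= J)%N -> B n (m n) g = B n J g.
  move=> mJ; rewrite /B (big_ord_widen_cond _ xpredT (fun i => A n i * incr (prim g) (I n i)) mJ).
  rewrite big_mkcond/=; apply: eq_bigr => i _; case: ltnP => // /Am->.
  by rewrite mul0r.
have IN n J g : lnorm (mkseq (fun i => incr (prim g) (I n i)) J) <= `|j g|.
  by have := jf_ge symN jJF g (adI n J); rewrite -map_comp.
have BN n J g : `|B n J g| <= `|j g| := le_trans (AN n J _) (IN n J g).
have Bb J g : bounded_seq (fun n => B n J g) by exists `|j g| => n.
have Bmb g : bounded_seq (fun n => B n (m n) g) by exists `|j g| => n.
have Bl n J a g g' : B n J (a *: g + g') = a * B n J g + B n J g'.
  rewrite /B mulr_sumr -big_split/=; apply: eq_bigr => i _.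
  rewrite /incr !primP; ring.
have [||b [bj b1]] := @dense_extend _ _ _ j (fun g => ulim (fun n => B n (m n) g)) 1 dj ler01.
- move=> a g g'; rewrite -ulimZ// -ulimD//; last by apply: bounded_seqM => //; exact: bounded_seq_cst.
  by congr ulim; apply/funext => n; rewrite Bl.
- by move=> g; rewrite mul1r; apply: ulim_norm_le_all.
exists b; split=> //.
  apply/eqP; rewrite eq_le; apply/andP; split.
    rewrite (le_trans (ler_norm _))// (le_trans (dual_norm_bound _ _))//.
    by rewrite ler_piMl.
  (* Five errors of size [1 / (N + 1)]: from [x] to [f n], the defect of the family, two for
     replacing [f n] by [f N], and from [f N] back to [x]. *)
  apply/ler_addgt0Pr => e' e'0; have [N hN] := divS_small 5 e'0.
  have bfN : `|x| - 4 / N.+1%:R <= b (j (f N)).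
    rewrite bj -[leLHS]ulim_cst; apply: ulim_le => //; first exact: bounded_seq_cst.
    apply: free_ultra_near; exists N => // n /= Nn.
    have dnN : n.+1%:R^-1 <= N.+1%:R^-1 :> R by rewrite lef_pV2 ?posrE// ler_nat.
    pose g := -1 *: f n + f N.
    have jg : j g = - j (f n) + j (f N) by rewrite linearD linearZ/= scaleN1r.
    have := Bl n (m n) (-1) (f n) (f N); rewrite -/g.
    have := BN n (m n) g; rewrite jg.
    have : `|- j (f n) + j (f N)| <= n.+1%:R^-1 + N.+1%:R^-1.
      by rewrite addrC (le_trans (ler_distD x _ _))// addrC lerD// distrC.
    have := fI n; rewrite -/(B n (m n) (f n)).
    have : `|x| <= `|j (f n)| + n.+1%:R^-1.
      rewrite -[x in leLHS](subrK (j (f n))) addrC (le_trans (ler_normD _ _))// lerD2l distrC.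
      exact: hf.
    move: (B n (m n) (f n)) (B n (m n) (f N)) => u v h1 h2 h3 h4 h5.
    have : - B n (m n) g <= n.+1%:R^-1 + N.+1%:R^-1.
      by rewrite (le_trans (ler_norm _))// normrN (le_trans h4).
    rewrite h5; move: h1 h2 dnN; move: n.+1%:R^-1 N.+1%:R^-1 => a c; lra.
  have : `|b (j (f N) - x)| <= N.+1%:R^-1.
    rewrite (le_trans (dual_norm_bound _ _))// (le_trans _ (hf N))//.
    by rewrite ler_piMl.
  rewrite dualB; have := hN N (leqnn _).
  move: bfN; move: N.+1%:R^-1 => c h1 h2 /(le_trans (ler_norm _)); lra.
have I01 n i : in01 (I n i).
  have /andP[/allP s01 _] := adI n i.+1.
  by apply: s01; rewrite map_f// mem_iota add0n leqnn.
(* The coefficients and the end points of the intervals converge separately; primitives being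
   continuous, so do the increments. It remains to exchange this limit with the sum over [i]. *)
pose alpha i := ulim (fun n => A n i).
pose p i := (ulim (fun n => (I n i).1), ulim (fun n => (I n i).2)).
have bA i : bounded_seq (fun n => A n i).
  exists (lnorm (nseq i.+1 1)) => n; rewrite (le_trans _ (Ai n i))//.
  by rewrite ler_peMr// ler1n.
have bI1 i : bounded_seq (fun n => (I n i).1).
  by exists 1 => n; have /and3P[h1 h2 h3] := I01 n i; rewrite ger0_norm// (le_trans h2).
have bI2 i : bounded_seq (fun n => (I n i).2).
  by exists 1 => n; have /and3P[h1 h2 h3] := I01 n i; rewrite ger0_norm// (le_trans h1).
have binc g i : bounded_seq (fun n => incr (prim g) (I n i)).
  exists (`|j g| / lnorm [:: 1]) => n; rewrite ler_pdivlMr// mulrC.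
  exact: jf_incr_le.
have uinc g i : ulim (fun n => incr (prim g) (I n i)) = incr (prim g) (p i).
  have cg := prim_continuous (L1_int01 g).
  by apply: ulimE; apply: cvgB; apply: continuous_cvg; [exact: cg|exact: ulimP|exact: cg|exact: ulimP].
have alphaN J (d : nat -> R) : `|\sum_(i < J) alpha i * d i| <= 1 * lnorm (mkseq d J).
  have -> : \sum_(i < J) alpha i * d i = ulim (fun n => \sum_(i < J) A n i * d i).
    rewrite ulim_sum; last by move=> i; apply: bounded_seqM => //; exact: bounded_seq_cst.
    by apply: eq_bigr => i _; rewrite ulimM ?ulim_cst//; exact: bounded_seq_cst.
  by rewrite mul1r; apply: ulim_norm_le_all.
have limB J g : ulim (fun n => B n J g) = \sum_(i < J) alpha i * incr (prim g) (p i).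
  rewrite ulim_sum => [|i]; last exact: bounded_seqM.
  by apply: eq_bigr => i _; rewrite ulimM// uinc.
(* Only real sequences have ultralimits here, so the norm of the limit vector is computed by one
   functional that norms it. *)
have pN J g : lnorm (mkseq (fun i => incr (prim g) (p i)) J) <= `|j g|.
  pose d i := incr (prim g) (p i).
  have [a [ale /(_ d erefl) aeq]] := norming_functional J e (\sum_(i < J) d i *: e i).
  rewrite lnorm_mkseq -aeq.
  have -> : \sum_(i < J) d i * a i = ulim (fun n => \sum_(i < J) incr (prim g) (I n i) * a i).
    rewrite ulim_sum; last by move=> i; apply: bounded_seqM => //; exact: bounded_seq_cst.
    by apply: eq_bigr => i _; rewrite ulimM ?ulim_cst ?uinc//; exact: bounded_seq_cst.
  rewrite -[leRHS]ulim_cst; apply: ulim_le_all; [|exact: bounded_seq_cst|].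
    apply: bounded_seq_sum => i; apply: bounded_seqM => //; exact: bounded_seq_cst.
  move=> n; rewrite (le_trans (ale (fun i => incr (prim g) (I n i))))// -(lnorm_mkseq e (fun i => incr (prim g) (I n i))).
  exact: IN.
(* Far out, the coefficients are small for all [n] at once by [lnorm_ones_small], while the
   increments of [prim g] are absolutely summable with a bound independent of [n]. *)
have tail (eta : R) g : 0 < eta -> exists J1, forall J n, (J1 <= J)%N -> `|B n (m n) g - B n J g| <= eta.
  move=> eta0; have [G [_ hG gG]] := prim_dominated (L1_int01 g).
  have G0 : 0 <= G 1 - G 0 by rewrite subr_ge0 hG.
  have eta1 : 0 < eta / (G 1 - G 0 + 1) by rewrite divr_gt0// ltr_wpDl.
  have [J1 hJ1] := lnorm_ones_small symN lnorm1_gt0 shrN eta1.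
  exists J1 => J n JJ1; pose K := maxn J (m n).
  rewrite (@BE n K) ?leq_maxr// /B.
  pose t i := A n i * incr (prim g) (I n i).
  rewrite -(big_mkord xpredT t) -(big_mkord xpredT t).
  rewrite (@big_cat_nat _ _ _ J)//= ?leq_maxl// addrAC subrr add0r.
  rewrite (le_trans (ler_norm_sum _ _ _))//.
  apply: (@le_trans _ _ (eta / (G 1 - G 0 + 1) * \sum_(I <- mkseq (I n) K) incr G I)).
    rewrite big_map (_ : iota 0 K = index_iota 0 K); last by rewrite /index_iota subn0.
    rewrite (@big_cat_nat _ _ _ J 0)//= ?leq_maxl// mulrDr -[leLHS]add0r lerD//.
      apply: mulr_ge0; [exact: ltW|apply: sumr_ge0 => i _]; rewrite subr_ge0 hG//.
      by have /and3P[] := I01 n i.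
    rewrite mulr_sumr; apply: ler_sum_nat => i /andP[Ji _]; rewrite normrM.
    apply: ler_pM => //; last by apply: gG; have /and3P[] := I01 n i.
    rewrite -(ler_pM2r (_ : 0 < i.+1%:R :> R)) ?ltr0n// (le_trans (Ai n i))//.
    by apply: hJ1; rewrite (leq_trans JJ1)// (leq_trans Ji).
  rewrite (le_trans (ler_wpM2l (ltW eta1) (admissible_sum_le hG (adI n K))))//.
  by rewrite mulrAC ler_pdivrMr ?ltr_wpDl// ler_wpM2l ?lerDl// ltW.
(* [J0] comes from the shrinking property of [alpha] and serves all [g]; [J1] depends on [g] but
   only serves the exchange of limits. *)
have key (eps : R) : 0 < eps -> exists J0, forall g,
    `|b (j g)| <= `|\sum_(i < J0) alpha i * incr (prim g) (p i)| + eps * `|j g|.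
  move=> eps0; have [J0 hJ0] := shrN alphaN eps0; exists J0 => g; rewrite bj.
  apply/ler_addgt0Pr => eta eta0; have [J1 hJ1] := tail _ g eta0.
  pose J := maxn J0 J1; pose d i := incr (prim g) (p i).
  pose d' i := if (i < J0)%N then 0 else d i.
  have -> : ulim (fun n => B n (m n) g) = ulim (fun n => B n J g) + ulim (fun n => B n (m n) g - B n J g).
    rewrite -ulimD//.
      by congr ulim; apply/funext => n; rewrite addrC subrK.
    by exists eta => n; apply: hJ1; rewrite leq_maxr.
  rewrite (le_trans (ler_normD _ _))// lerD//; last first.
    by apply: ulim_norm_le_all => n; apply: hJ1; rewrite leq_maxr.
  rewrite limB.
  have -> : \sum_(i < J) alpha i * incr (prim g) (p i) =
      \sum_(i < J0) alpha i * d i + \sum_(i < J) alpha i * d' i.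
    rewrite [X in _ = X + _](big_ord_widen_cond J xpredT (fun i => alpha i * d i)) ?leq_maxl//.
    rewrite [X in _ = X + _]big_mkcond/=.
    rewrite -big_split/=; apply: eq_bigr => i _; rewrite /d'.
    by case: ifP => _; rewrite ?mulr0 ?addr0 ?add0r.
  rewrite (le_trans (ler_normD _ _))// lerD2l (le_trans (hJ0 J d' _))//.
    by move=> i iJ; rewrite /d' iJ.
  rewrite ler_wpM2l ?(ltW eps0)// (le_trans _ (pN J g))//.
  by apply: lnorm_map_le => // i _; rewrite /d'; case: ifP; rewrite ?normr0.
move=> h M eps hM h0 eps0.
have M0 : 0 <= M := le_trans (normr_ge0 _) (hM 0%N).
have eps1 : 0 < eps / (2 * (M + 1)) by rewrite divr_gt0// mulr_gt0// ltr_wpDl.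
have [J0 hJ0] := key _ eps1.
have p01 i : 0 <= (p i).1 <= 1 /\ 0 <= (p i).2 <= 1.
  have u01 (u : nat -> R) : (forall n, 0 <= u n <= 1) -> 0 <= ulim u <= 1.
    move=> hu; have bu : bounded_seq u.
      by exists 1 => n; have /andP[u0 u1] := hu n; rewrite ger0_norm.
    have := ulim_le_all (bounded_seq_cst 0) bu (fun n => (andP (hu n)).1).
    have := ulim_le_all bu (bounded_seq_cst 1) (fun n => (andP (hu n)).2).
    by rewrite !ulim_cst => -> ->.
  split; apply: u01 => n; have /and3P[h1 h2 h3] := I01 n i.
    by rewrite h1 (le_trans h2).
  by rewrite h3 (le_trans h1).
have cv : (fun k => \sum_(i < J0) alpha i * incr (prim (h k)) (p i)) @ \oo --> (0 : R).
  apply: (@cvg_sum0 (fun i k => alpha i * incr (prim (h k)) (p i))) => i; rewrite -[X in _ --> X](mulr0 (alpha i)).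
  apply: cvgM; first exact: cvg_cst.
  rewrite -[X in _ --> X](subrr 0); have [h1 h2] := p01 i.
  by apply: cvgB; exact: h0.
have eps2 : 0 < eps / 2 by rewrite divr_gt0.
have /cvgr0Pnorm_le/(_ _ eps2)[K _ hK] := cv.
exists K => k Kk; rewrite (le_trans (hJ0 _))// [leRHS]splitr lerD//; first exact: hK.
rewrite (le_trans (ler_wpM2l (ltW eps1) (hM k)))//.
have M1 : 0 < M + 1 by rewrite ltr_wpDl.
have -> : eps / (2 * (M + 1)) * M = eps / 2 * (M / (M + 1)) by field; rewrite gt_eqF.
apply: ler_piMr; first exact: ltW.
by rewrite ler_pdivrMr// mul1r lerDl.
Qed.

Lemma weakly_null (h : nat -> L1 R) M (phi : dual JF) eps : (forall k, `|j (h k)| <= M) ->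
  pointwise_null h -> 0 < eps -> ~ (forall k, eps <= phi (j (h k))).
Proof.
move=> hM h0 eps0 hphi.
have [s [m [m0 hs]]] := simons_sequence eps0 hM hphi.
have [b [b1 bs /(_ h M (m / 2) hM h0)[|K hK]]] := norming_limit s; first by rewrite divr_gt0.
have [k Kk mb] := hs b b1 bs K.
have := le_trans mb (le_trans (ler_norm _) (hK k Kk)).
lra.
Qed.

End WeaklyNull.

(** * Jumps of functionals on JF *)

Section Jump.
Variables (R : realType) (X : normedModType R) (e : nat -> X).
Hypothesis symN : symmetric_lnorm e.
Variables (JF : completeNormedModType R) (j : {linear L1 R -> JF}).
Hypothesis jJF : is_JF e j.
Local Notation lnorm := (lnorm e).
Implicit Types (f g : L1 R) (s : seq (R * R)).

(** Each interval is cut at its first and last points of [D]: the middle piece contributes nothing,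
    and the left and the right pieces form two admissible families without points of [D] inside,
    hence the factor 2. *)
Lemma jf_le_split (H : R -> R) f (D : seq R) C :
  (forall I, in01 I -> incr (prim f) I = incr H I) ->
  {in D &, forall d d', H d = H d'} ->
  (forall s, admissible s -> {in s, forall I, {in D, forall d, ~~ (I.1 < d < I.2)}} ->
    lnorm (map (incr H) s) <= C) -> `|j f| <= 2 * C.
Proof.
move=> fH HD hC; apply: (jf_le symN jJF) => s ads.
have s01 I : I \in s -> in01 I by have /andP[/allP + _] := ads; apply.
have /choice[r hr] (I : R * R) : exists r : R * R, in01 I ->
    [/\ I.1 <= r.1, r.1 <= r.2, r.2 <= I.2, H r.1 = H r.2 &
      {in D, forall d, ~~ (I.1 < d < r.1) /\ ~~ (r.2 < d < I.2)}].
  have [I01|_] := boolP (in01 I); last by exists (0, 0).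
  have /and3P[_ I12 _] := I01; have [r [h1 h2 h3 h4 h5]] := itv_split D I12.
  exists r => _; split=> //; case: h4 => [->//|[rD1 rD2]]; exact: HD.
rewrite (@eq_in_map _ _ _ (fun I => incr H (I.1, (r I).1) + incr H ((r I).2, I.2)) s).1; last first.
  move=> I /s01 I01; have [_ _ _ Hr _] := hr I I01.
  by rewrite fH// /incr/= Hr; ring.
rewrite (le_trans (lnormD _ _ _ _))// mulrDl !mul1r lerD//.
  rewrite [X in lnorm X](map_comp (incr H) (fun I => (I.1, (r I).1))); apply: hC.
    apply: admissible_sub => // I /s01/hr[h1 h2 h3 _ _] /=.
    by rewrite lexx h1 (le_trans h2 h3).
  by move=> _ /mapP[I /s01/hr[_ _ _ _ hD] ->] d /hD[].
rewrite [X in lnorm X](map_comp (incr H) (fun I => ((r I).2, I.2))); apply: hC.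
  apply: admissible_sub => // I /s01/hr[h1 h2 h3 _ _] /=.
  by rewrite lexx h3 (le_trans h1 h2).
by move=> _ /mapP[I /s01/hr[_ _ _ _ hD] ->] d /hD[].
Qed.

(** Derivative of the tent of height 1 and half-width [d] with vertex [t], cut off to (0,1); at
    [t = 0] and [t = 1] only one slope is left. *)
Definition spike (t d : R) : L1 R := locked
  (d^-1 *: (restr (L1_one R) (clamp 0 1 (t - d)) t - restr (L1_one R) t (clamp 0 1 (t + d)))).

Definition tent (t d x : R) : R := d^-1 * (clamp (t - d) t x - clamp t (t + d) x) + 1.

(** Only increments can agree: the primitive vanishes at 0, where the tent is positive if
    [t < d]. *)
Lemma incr_spike t d I : 0 <= t <= 1 -> 0 < d -> in01 I ->
  incr (prim (spike t d)) I = incr (tent t d) I.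
Proof.
move=> /andP[t0 t1] d0 /and3P[I0 I12 I1].
have /andP[p0 p1] := @clamp_itv R 0 1 (t - d) ler01.
have /andP[q0 q1] := @clamp_itv R 0 1 (t + d) ler01.
have pt : clamp 0 1 (t - d) <= t.
  by rewrite /clamp; case: (leP (t - d) 0) => ?; case: (leP 1 (t - d)) => ?; lra.
have tq : t <= clamp 0 1 (t + d).
  by rewrite /clamp; case: (leP (t + d) 0) => ?; case: (leP 1 (t + d)) => ?; lra.
have E x : 0 <= x <= 1 -> prim (spike t d) x =
    tent t d x + d^-1 * (t - clamp 0 1 (t - d)) - 1.
  move=> /andP[x0 x1].
  have c01 p q y : 0 <= p -> p <= q -> q <= 1 -> clamp 0 1 (clamp p q y) = clamp p q y.
    move=> h1 h2 h3; have /andP[h4 h5] := clamp_itv y h2.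
    by apply: clamp_id; rewrite (le_trans h1 h4) (le_trans h5 h3).
  rewrite /spike -lock primZ primB !prim_restr// !prim_one !c01// [clamp 0 1 t]clamp_id ?t0 ?t1//.
  have -> : clamp (clamp 0 1 (t - d)) t x = clamp (t - d) t x.
    move=> {p0 p1 q0 q1 pt tq c01 I0 I12 I1}; rewrite /clamp.
    have [h|h] := leP (t - d) 0; last by rewrite (leNgt 1) (_ : t - d < 1)//; lra.
    by case: (leP x 0) => ?; case: (leP x (t - d)) => ?; case: (leP t x) => ?; lra.
  have -> : clamp t (clamp 0 1 (t + d)) x = clamp t (t + d) x.
    move=> {p0 p1 q0 q1 pt tq c01 I0 I12 I1}; rewrite /clamp (leNgt _ 0) (_ : 0 < t + d)/=; last by lra.
    have [h|//] := leP 1 (t + d).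
    by case: (leP x t) => ?; case: (leP 1 x) => ?; case: (leP (t + d) x) => ?; lra.
  by rewrite /tent; ring.
rewrite /incr !E ?I0 ?I1 ?(le_trans I0 I12) ?(le_trans I12 I1)//.
by ring.
Qed.

Lemma tent1 t d : 0 < d -> tent t d t = 1.
Proof.
move=> d0; rewrite /tent clamp_ge ?gerBl ?(ltW d0)// clamp_le//.
by rewrite subrr mulr0 add0r.
Qed.

Lemma tent0 t d x : 0 < d -> d <= `|x - t| -> tent t d x = 0.
Proof.
move=> d0; rewrite /tent; have [tx|xt] := leP t x.
  rewrite ger0_norm ?subr_ge0// => h.
  rewrite !clamp_ge ?gerBl ?lerDl ?(ltW d0)//; last by lra.
  by rewrite opprD addrA subrr add0r mulrN mulVf ?gt_eqF// addNr.
rewrite ltr0_norm ?subr_lt0// => h.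
rewrite !clamp_le ?(ltW xt)//; last by lra.
by rewrite addrAC subrr add0r mulrN mulVf ?gt_eqF// addNr.
Qed.

Lemma incr_tent_out t d I : 0 < d -> I.1 <= I.2 -> (I.2 <= t - d) || (t + d <= I.1) ->
  incr (tent t d) I = 0.
Proof.
move=> d0 I12 /orP[h|h]; rewrite /incr !tent0 ?subrr//.
- by rewrite ltr0_norm; lra.
- by rewrite ltr0_norm; lra.
- by rewrite gtr0_norm; lra.
- by rewrite gtr0_norm; lra.
Qed.

Lemma tent_variation t d s : 0 < d -> admissible s -> \sum_(I <- s) `|incr (tent t d) I| <= 2.
Proof.
move=> d0 ads.
have c1 : {homo clamp (t - d) t : x y / x <= y} by move=> x y; apply: clamp_mono; lra.
have c2 : {homo clamp t (t + d) : x y / x <= y} by move=> x y; apply: clamp_mono; lra.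
pose G x := d^-1 * (clamp (t - d) t x + clamp t (t + d) x).
have hG : {homo G : x y / x <= y}.
  move=> x y xy; rewrite /G ler_pM2l ?invr_gt0//; apply: lerD; [exact: c1|exact: c2].
apply: (@le_trans _ _ (\sum_(I <- s) incr G I)).
  rewrite big_seq [leRHS]big_seq; apply: ler_sum => I Is.
  have /and3P[_ I12 _] : in01 I by have /andP[/allP/(_ _ Is)] := ads.
  have := c1 _ _ I12; have := c2 _ _ I12; rewrite /incr /tent /G => h1 h2.
  rewrite -[X in `|X|](_ : d^-1 * ((clamp (t - d) t I.2 - clamp (t - d) t I.1) -
     (clamp t (t + d) I.2 - clamp t (t + d) I.1)) = _); last by ring.
  rewrite -mulrBr normrM gtr0_norm ?invr_gt0// ler_pM2l ?invr_gt0// ler_norml.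
  by apply/andP; split; lra.
rewrite (le_trans (admissible_sum_le hG ads))// /G -mulrBr mulrC ler_pdivrMr//.
have td : t - d <= t by lra. have tD : t <= t + d by lra.
have := @clamp_itv _ _ _ 1 td; have := @clamp_itv _ _ _ 0 td.
by have := @clamp_itv _ _ _ 1 tD; have := @clamp_itv _ _ _ 0 tD; lra.
Qed.

(** The sum of tents vanishes at the ends [t - d] and [t + d], and cutting there costs a factor 2.
    An interval with no such end inside meets at most one tent, so [lnorm_collect] applies; the
    variation of a tent is the other factor 2. *)
Lemma spike_sum_le (ts : seq R) (x : R -> R) (d : R) : uniq ts -> 0 < d ->
  {in ts, forall t, 0 <= t <= 1} ->
  {in ts &, forall t t', t != t' -> 2 * d <= `|t - t'|} ->
  `|j (\sum_(t <- ts) x t *: spike t d)| <= 4 * lnorm (map x ts).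
Proof.
move=> uts d0 ts01 sep.
rewrite (_ : 4 = 2 * 2 :> R); last by ring.
rewrite -mulrA.
pose H y := \sum_(t <- ts) x t * tent t d y.
have incrH I : incr H I = \sum_(t <- ts) x t * incr (tent t d) I.
  rewrite /incr /H -sumrB; apply: eq_bigr => t _; ring.
pose D := [seq t - d | t <- ts] ++ [seq t + d | t <- ts].
have HD y : y \in D -> H y = 0.
  move=> yD; rewrite /H big_seq big1// => t tts; rewrite tent0 ?mulr0//.
  move: yD; rewrite mem_cat => /orP[/mapP[t' t's ->]|/mapP[t' t's ->]].
    have [->|tt] := eqVneq t t'; first by rewrite addrAC subrr add0r normrN gtr0_norm.
    have := sep t t' tts t's tt; rewrite (distrC t) => h.
    have := ler_normB (t' - t) d; have := ler_normD (t' - d - t) d.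
    rewrite (_ : t' - d - t + d = t' - t); last by ring.
    by rewrite (gtr0_norm d0) => *; lra.
  have [->|tt] := eqVneq t t'; first by rewrite addrAC subrr add0r gtr0_norm.
  have := sep t t' tts t's tt; rewrite (distrC t) => h.
  have := ler_normB (t' + d - t) d.
  rewrite (_ : t' + d - t - d = t' - t); last by ring.
  by rewrite (gtr0_norm d0) => *; lra.
apply: (@jf_le_split H _ D).
- move=> I I01; rewrite incrH {1}/incr !prim_sum -sumrB !big_seq; apply: eq_bigr => t tts.
  by rewrite -(incr_spike (ts01 t tts) d0 I01) /incr !primZ mulrBr.
- by move=> y y' /HD-> /HD->.
move=> s ads sD.
rewrite (eq_map incrH) (le_trans (@lnorm_collect _ _ _ symN _ _ (fun t I => x t * incr (tent t d) I) ts s uts _))//.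
  move=> I Is t t' tts t's tt.
  have /and3P[_ I12 _] : in01 I by have /andP[/allP/(_ _ Is)] := ads.
  have [h|h] := boolP ((I.2 <= t - d) || (t + d <= I.1)).
    by left; rewrite incr_tent_out ?mulr0.
  have [h'|h'] := boolP ((I.2 <= t' - d) || (t' + d <= I.1)).
    by right; rewrite incr_tent_out ?mulr0.
  exfalso; move: h h'; rewrite !negb_or -!ltNge => /andP[a1 a2] /andP[b1 b2].
  have Dl u : u \in ts -> u - d \in D by move=> us; rewrite mem_cat (map_f (fun t => t - d)).
  have Dr u : u \in ts -> u + d \in D by move=> us; rewrite mem_cat (map_f (fun t => t + d)) ?orbT.
  have := sD I Is _ (Dl _ tts); have := sD I Is _ (Dl _ t's).
  rewrite a1 b1 !andbT -!leNgt => b3 a3.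
  have := sep t t' tts t's tt; have [u|u] := leP t t'.
    by rewrite ler0_norm ?subr_le0// => h; lra.
  by rewrite gtr0_norm ?subr_gt0// => h; lra.
have -> : 2 * lnorm (map x ts) = lnorm (map (fun t => 2 * x t) ts) by rewrite lnormZ ger0_norm.
apply: lnorm_map_le => // t _; under eq_bigr do rewrite normrM.
rewrite -mulr_sumr normrM normr_id normrM [`|2|]ger0_norm// [X in _ * X]ger0_norm ?sumr_ge0// mulrC.
rewrite ler_wpM2r//.
exact: tent_variation.
Qed.

Lemma spike_le t d : 0 <= t <= 1 -> 0 < d -> `|j (spike t d)| <= 4 * lnorm [:: 1].
Proof.
move=> t01 d0; have := @spike_sum_le [:: t] (fun=> 1) d isT d0.
rewrite big_seq1 scale1r; apply; first by move=> t'; rewrite inE => /eqP->.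
by move=> a b; rewrite !inE => /eqP-> /eqP->; rewrite eqxx.
Qed.

Lemma separation (ts : seq R) : exists2 d, 0 < d &
  {in ts &, forall t t', t != t' -> 2 * d <= `|t - t'|}.
Proof.
pose D := [seq `|p.1 - p.2| / 2 | p <- [seq (t, t') | t <- ts, t' <- ts] & p.1 != p.2].
have [m mD hm] := seq_min 1 D; exists m.
  move: mD; rewrite inE => /predU1P[->//|/mapP[p]]; rewrite mem_filter => /andP[pp _] ->.
  by rewrite divr_gt0// normr_gt0 subr_eq0.
move=> t t' ts1 ts2 tt; rewrite -ler_pdivlMl// mulrC; apply: hm.
rewrite inE; apply/orP; right; apply/mapP; exists (t, t') => //.
by rewrite mem_filter /= tt; apply/allpairsP; exists (t, t').
Qed.

Definition jump (phi : dual JF) (t : R) : R := ulim (fun n => phi (j (spike t n.+1%:R^-1))).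

Lemma jump_seq_bounded (phi : dual JF) t : 0 <= t <= 1 ->
  bounded_seq (fun n => phi (j (spike t n.+1%:R^-1))).
Proof.
move=> t01; exists (`|phi| * (4 * lnorm [:: 1])) => n.
by rewrite (le_trans (dual_norm_bound _ _))// ler_wpM2l// spike_le// invr_gt0.
Qed.

Lemma jump_linear (a : R) (phi psi : dual JF) (t : R) : 0 <= t <= 1 ->
  jump (a *: phi + psi) t = a * jump phi t + jump psi t.
Proof.
move=> t01; have b := fun q => jump_seq_bounded q t01.
rewrite /jump -ulimZ// -ulimD//; last by apply: bounded_seqM; [exact: bounded_seq_cst|exact: b].
Qed.

(** Once [1 / (n + 1)] is below the separation of the points, [spike_sum_le] bounds the sequence
    whose ultralimit is the left side. *)
Lemma jump_bound (phi : dual JF) (ts : seq R) (x : R -> R) : uniq ts -> {in ts, forall t, 0 <= t <= 1} ->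
  `|\sum_(t <- ts) x t * jump phi t| <= (4 * `|phi|) * lnorm (map x ts).
Proof.
move=> uts ts01; have [d d0 sep] := separation ts.
have [N hN] := divS_small 1 d0.
have -> : \sum_(t <- ts) x t * jump phi t =
    ulim (fun n => phi (j (\sum_(t <- ts) x t *: spike t n.+1%:R^-1))).
  rewrite big_seq.
  have E n : phi (j (\sum_(t <- ts) x t *: spike t n.+1%:R^-1)) =
    \sum_(t <- ts) (if t \in ts then x t * phi (j (spike t n.+1%:R^-1)) else 0).
    rewrite -big_mkcond -big_seq/= !linear_sum/=; apply: eq_bigr => t _.
    by rewrite linearZ/= dualZ.
  under [in RHS]eq_fun do rewrite E.
  rewrite ulim_sum => [|t].
    rewrite [in RHS]big_mkcond/=.
    rewrite big_mkcond; apply: eq_bigr => t _; case: ifP => [/ts01 t01|_]; last by rewrite ulim_cst.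
    by rewrite ulimZ//; exact: jump_seq_bounded.
  have [/ts01 t01|_] := boolP (t \in ts); last exact: bounded_seq_cst.
  by apply: bounded_seqM; [exact: bounded_seq_cst|exact: jump_seq_bounded].
apply: ulim_norm_le.
  exists (`|phi| * \sum_(t <- ts) `|x t| * (4 * lnorm [:: 1])) => n.
  rewrite (le_trans (dual_norm_bound _ _))// ler_wpM2l// linear_sum/=.
  rewrite (le_trans (ler_norm_sum _ _ _))// !big_seq; apply: ler_sum => t /ts01 t01.
  by rewrite linearZ/= normrZ ler_wpM2l// spike_le// invr_gt0.
apply: free_ultra_near; exists N => // n /= /hN h; rewrite mul1r in h.
rewrite (le_trans (dual_norm_bound _ _))// (_ : 4 * _ * _ = `|phi| * (4 * lnorm (map x ts))); last by ring.
rewrite ler_wpM2l//.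
apply: spike_sum_le => //.
by move=> t t' tts t's tt; rewrite (le_trans _ (sep t t' tts t's tt))// ler_pM2l.
Qed.

Lemma jump_itv (phi : dual JF) (p q t : R) : 0 <= t <= 1 -> 0 <= p -> p <= q -> q <= 1 ->
  (forall f, phi (j f) = prim f q - prim f p) ->
  jump phi t = (t == q)%:R - (t == p)%:R.
Proof.
move=> t01 p0 pq q1 hphi.
have tE y : exists N, forall n, (N <= n)%N -> tent t n.+1%:R^-1 y = (t == y)%:R.
  have [->|ty] := eqVneq t y; first by exists 0%N => n _; rewrite tent1// invr_gt0.
  have d0 : 0 < `|y - t| by rewrite normr_gt0 subr_eq0 eq_sym.
  have [N hN] := divS_small 1 d0; exists N => n /hN h.
  by rewrite tent0 ?invr_gt0// -[_^-1]mul1r.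
have [N1 h1] := tE q; have [N2 h2] := tE p.
apply: (ulim_eventually (N := maxn N1 N2)) => n; rewrite geq_max => /andP[n1 n2].
rewrite hphi -/(incr (prim _) (p, q)) incr_spike ?invr_gt0//; last by rewrite /in01/= p0 pq.
by rewrite /incr/= h1// h2.
Qed.

End Jump.

(** * Functionals without jumps *)

Section Gap.
Variables (R : realType) (X : normedModType R) (e : nat -> X).
Hypothesis symN : symmetric_lnorm e.
Variables (JF : completeNormedModType R) (j : {linear L1 R -> JF}).
Hypothesis jJF : is_JF e j.
Local Notation lnorm := (lnorm e).
Hypothesis lnorm1_gt0 : 0 < lnorm [:: 1].
Hypothesis shrN : shrinking_lnorm e.
Implicit Types (f g : L1 R) (s : seq (R * R)).

(** Otherwise the normalised restrictions to windows shrinking to [t] that violate the bound have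
    primitives vanishing at [t] and off the windows; these tend to 0 pointwise, against
    [weakly_null]. *)
Lemma local_null (phi : dual JF) (t eta : R) : 0 <= t <= 1 -> 0 < eta ->
  exists2 rho : R, 0 < rho & forall (p q : R) f, 0 <= p -> p <= t -> t <= q -> q <= 1 ->
    t - rho < p -> q < t + rho -> prim f p = prim f t -> prim f t = prim f q ->
    `|phi (j (restr f p q))| <= eta * `|j f|.
Proof.
move=> /andP[t0 t1] eta0; apply: contrapT => hn.
have i0 k : 0 < k.+1%:R^-1 :> R by rewrite invr_gt0.
have /choice[F hF] (k : nat) : exists pqf : R * R * L1 R,
    [/\ [/\ 0 <= pqf.1.1, pqf.1.1 <= t, t <= pqf.1.2 & pqf.1.2 <= 1],
     t - k.+1%:R^-1 < pqf.1.1 /\ pqf.1.2 < t + k.+1%:R^-1,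
     prim pqf.2 pqf.1.1 = prim pqf.2 t /\ prim pqf.2 t = prim pqf.2 pqf.1.2 &
     eta * `|j pqf.2| < `|phi (j (restr pqf.2 pqf.1.1 pqf.1.2))|].
  apply: contrapT => hk; apply: hn; exists k.+1%:R^-1 => // p q f *.
  by rewrite leNgt; apply/negP => h; apply: hk; exists (p, q, f).
pose p k := (F k).1.1; pose q k := (F k).1.2; pose f k := (F k).2.
pose g k := restr (f k) (p k) (q k).
have pq k : [/\ 0 <= p k, p k <= t, t <= q k & q k <= 1] by have [] := hF k.
have ppq k : p k <= q k by have [_ h1 h2 _] := pq k; exact: le_trans h2.
have phg k : eta * `|j (f k)| < `|phi (j (g k))| by have [] := hF k.
have jg k : `|j (g k)| <= `|j (f k)|.
  by have [? _ _ ?] := pq k; exact: (jf_restr_le symN jJF).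
have f0 k : 0 < `|j (f k)|.
  rewrite lt_neqAle normr_ge0 andbT; apply/eqP => h.
  have := phg k; have := jg k; rewrite -h mulr0 normr_le0 => /eqP->.
  by rewrite linear0 normr0 ltxx.
pose c k := `|j (f k)|^-1 * Num.sg (phi (j (g k))).
apply: (@weakly_null _ _ _ symN _ _ jJF lnorm1_gt0 shrN (fun k => c k *: g k) 1 phi eta) => //.
- move=> k; rewrite linearZ/= normrZ /c normrM normfV normr_id normr_sg.
  rewrite -mulrA ler_pdivrMl// mulr1 (le_trans _ (jg k))// ler_piMl//.
  by case: (_ != 0).
- move=> x x01; rewrite /pointwise_null.
  apply: cvg_near_cst; have [->|xt] := eqVneq x t.
    apply: nearW => k; have [? ? ? ?] := pq k; rewrite primZ prim_restr//.
    rewrite clamp_id; last by apply/andP.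
    by have [_ _ [-> _] _] := hF k; rewrite subrr mulr0.
  have d0 : 0 < `|x - t| by rewrite normr_gt0 subr_eq0.
  have [N hN] := divS_small 1 d0; exists N => // k Nk; suff : prim (c k *: g k) x = 0 by [].
  have := hN k Nk; rewrite mul1r => h.
  have [_ pt tq _] := pq k; have [_ [hp hq] [e1 e2] _] := hF k.
  have [pk0 _ _ qk1] := pq k.
  rewrite [LHS]primZ prim_restr//; have [xp|xp] := leP x (p k).
    by rewrite clamp_le// subrr mulr0.
  have [qx|xq] := leP (q k) x.
    by rewrite clamp_ge//  -/(p k) -/(q k) -/(f k) in e1 e2 *; rewrite e1 e2 subrr mulr0.
  exfalso; move: h; rewrite leNgt => /negP; apply; rewrite -/(p k) -/(q k) in hp hq.
  rewrite ltr_norml; apply/andP; split.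
    by rewrite ltrBrDr addrC; exact: lt_trans hp xp.
  by rewrite ltrBlDl; exact: lt_trans xq hq.
move=> k; rewrite linearZ/= dualZ /c -mulrA mulrC.
by rewrite -normrEsg ler_pdivlMr// ltW.
Qed.

Lemma restr_id f (p q : R) : 0 <= p -> p <= q -> q <= 1 ->
  (forall x : R, 0 <= x -> x <= p -> prim f x = prim f p) ->
  (forall x : R, q <= x -> x <= 1 -> prim f x = prim f q) ->
  j (restr f p q) = j f.
Proof.
move=> p0 pq q1 fp fq; apply: (jf_eq symN jJF) => I I01; rewrite incr_restr//.
have /and3P[I0 I12 I1] := I01.
have A (x : R) : 0 <= x -> x <= 1 -> prim f (clamp p q x) = prim f x.
  move=> x0 x1; have [xp|px] := leP x p; first by rewrite clamp_le// fp.
  have [qx|xq] := leP q x; first by rewrite clamp_ge// fq.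
  by rewrite clamp_id// !ltW.
by rewrite !A// ?(le_trans I0 I12) ?(le_trans I12 I1).
Qed.

(** The primitive of [restr f p q] vanishes outside (p,q), so the local estimate can be applied to
    [restr f p q] itself on a window enlarged to contain [t]. *)
Lemma gap_good_out (phi : dual JF) (t rho eta p q : R) f : 0 <= t <= 1 -> 0 < eta ->
  (forall (p q : R) f, 0 <= p -> p <= t -> t <= q -> q <= 1 ->
    t - rho < p -> q < t + rho -> prim f p = prim f t -> prim f t = prim f q ->
    `|phi (j (restr f p q))| <= eta * `|j f|) ->
  0 < rho -> 0 <= p -> p < q -> q <= 1 -> t - rho < p -> q < t + rho ->
  t <= p \/ q <= t -> prim f p = prim f q ->
  `|phi (j (restr f p q))| <= eta * `|j f|.
Proof.
move=> /andP[t0 t1] eta0 hrho rho0 p0 pq q1 tp qt out fpq.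
have pq' := ltW pq; have p1 := le_trans pq' q1; have q0 := le_trans p0 pq'.
pose m := Num.min p t; pose M := Num.max q t.
have mp : m <= p by rewrite ge_min lexx.
have mt : m <= t by rewrite ge_min lexx orbT.
have qM : q <= M by rewrite le_max lexx.
have tM : t <= M by rewrite le_max lexx orbT.
have m0 : 0 <= m by rewrite le_min p0 t0.
have M1 : M <= 1 by rewrite ge_max q1 t1.
have P (x : R) : x <= p \/ q <= x -> prim (restr f p q) x = 0.
  move=> [h|h]; rewrite prim_restr//; first by rewrite clamp_le// subrr.
  by rewrite clamp_ge// fpq subrr.
have <- : j (restr (restr f p q) m M) = j (restr f p q).
  apply: restr_id => //; first exact: le_trans mt tM.
    by move=> x x0 xm; rewrite !P//; left => //; exact: le_trans xm _.
  by move=> x xM x1; rewrite !P//; right => //; exact: le_trans xM.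
apply: (@le_trans _ _ (eta * `|j (restr f p q)|)).
  apply: hrho => //.
  - by rewrite lt_min tp ltrBlDr ltrDl.
  - by rewrite gt_max qt ltrDl.
  - by rewrite !P//; left.
  - by rewrite !P//; right.
by rewrite ler_wpM2l ?(ltW eta0)// (jf_restr_le symN jJF).
Qed.

(** A narrow multiple of a tent is subtracted to give the primitive at [t] the value that it has at
    the ends of the gap. The corrected function has norm at most [5 * |j f|], tents having norm at
    most [4 * lnorm [:: 1]]; as [phi] has no jump at [t], the tent itself adds at most one more
    [eta * |j f|], whence [6 = 5 + 1]. *)
Lemma gap_good_in (phi : dual JF) (t rho eta p q c : R) f : 0 <= t <= 1 -> 0 < eta ->
  (forall (p q : R) f, 0 <= p -> p <= t -> t <= q -> q <= 1 ->
    t - rho < p -> q < t + rho -> prim f p = prim f t -> prim f t = prim f q ->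
    `|phi (j (restr f p q))| <= eta * `|j f|) ->
  jump j phi t = 0 -> 0 <= p -> q <= 1 -> t - rho < p -> q < t + rho ->
  p < t \/ t = 0 /\ p = 0 -> t < q \/ t = 1 /\ q = 1 ->
  (p < t -> prim f t - prim f p = c) -> (t < q -> prim f t - prim f q = c) ->
  lnorm [:: 1] * `|c| <= `|j f| ->
  `|phi (j (restr f p q))| <= 6 * eta * `|j f|.
Proof.
move=> t01 eta0 hrho Jt p0 q1 tp qt pt1 tq1 c1 c2 cN; have /andP[t0 t1] := t01.
have pt : p <= t by case: pt1 => [/ltW//|[-> ->]].
have tq : t <= q by case: tq1 => [/ltW//|[-> ->]].
have pq := le_trans pt tq.
have [d [d0 dp dq dphi]] : exists d : R, [/\ 0 < d, p < t -> d <= t - p, t < q -> d <= q - t &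
    `|phi (j (spike t d))| <= eta * lnorm [:: 1]].
  pose m := Num.min (if p < t then t - p else 1) (if t < q then q - t else 1).
  have m0 : 0 < m.
    by rewrite lt_min; apply/andP; split; case: ifP => // h; rewrite subr_gt0.
  have [N hN] := divS_small 1 m0.
  have N0 : 0 < eta * lnorm [:: 1] by rewrite mulr_gt0.
  have [n Nn hn] := ulim0_small (jump_seq_bounded symN jJF phi t01) Jt N N0.
  have := hN n Nn; rewrite mul1r le_min => /andP[h1 h2].
  by exists n.+1%:R^-1; split=> // h; [rewrite h in h1|rewrite h in h2].
have tentp (x : R) : 0 <= x -> x <= p -> p < t -> tent t d x = 0.
  move=> x0 xp ptt; rewrite tent0//; have := dp ptt; move: xp ptt; clear => xp ptt h.
  rewrite ltr0_norm; lra.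
have tentq (x : R) : q <= x -> x <= 1 -> t < q -> tent t d x = 0.
  move=> xq x1 tqt; rewrite tent0//; have := dq tqt; move: xq tqt; clear => xq tqt h.
  rewrite gtr0_norm; lra.
pose f' : L1 R := f - c *: spike t d.
have ib (x y : R) : 0 <= x -> x <= y -> y <= 1 ->
    prim (spike t d) y - prim (spike t d) x = tent t d y - tent t d x.
  by move=> x0 xy y1; apply: (@incr_spike _ t d (x, y)); rewrite // /in01/= x0 xy.
have jb : j (restr (spike t d) p q) = j (spike t d).
  apply: restr_id => //.
    move=> x x0 xp; have [h|[h1 h2]] := pt1; last first.
      by congr prim; apply/le_anti; rewrite xp h2.
    by apply/esym/eqP; rewrite -subr_eq0 ib ?tentp ?subrr// (le_trans pq).
  move=> x qx x1; have [h|[h1 h2]] := tq1; last first.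
    by congr prim; apply/le_anti; rewrite qx h2 x1.
  by apply/eqP; rewrite -subr_eq0 ib ?tentq ?subrr// (le_trans p0).
have -> : j (restr f p q) = j (restr f' p q) + c *: j (spike t d).
  rewrite -jb -linearZ -linearD/=; apply: (jf_eq symN jJF) => I I01.
  rewrite /incr !primD !primZ !prim_restr//.
  by rewrite !primB !primZ; clear; ring.
have cN' : `|c| <= `|j f| / lnorm [:: 1] by rewrite ler_pdivlMr// mulrC.
have f'N : `|j f'| <= 5 * `|j f|.
  rewrite linearB linearZ/= (le_trans (ler_normB _ _))// normrZ.
  have h1 := spike_le symN jJF t01 d0.
  have := ler_wpM2l (normr_ge0 c) h1; move: cN; clear; lra.
rewrite dualD dualZ (le_trans (ler_normD _ _))//.
have /le_trans : `|phi (j (restr f' p q))| <= eta * `|j f'|.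
  apply: hrho => //.
    rewrite /f' !primB !primZ; have [h|[-> ->]//] := pt1.
    have := ib p t p0 pt t1; rewrite tent1// tentp// => /eqP; rewrite subr_eq => /eqP->.
    by rewrite -(c1 h); clear; ring.
  rewrite /f' !primB !primZ; have [h|[-> ->]//] := tq1.
  have := ib t q t0 tq q1; rewrite tent1// tentq// => /eqP; rewrite subr_eq => /eqP->.
  by rewrite -(c2 h); clear; ring.
move=> /(_ _ (ler_wpM2l (ltW eta0) f'N)) h1.
have h2 : `|c * phi (j (spike t d))| <= eta * `|j f|.
  rewrite normrM (le_trans (ler_wpM2l (normr_ge0 c) dphi))// mulrC -mulrA ler_wpM2l// ltW//.
by move: h1 h2; clear; lra.
Qed.

(** A point of [D] may carry a jump, so it must not be interior to a gap. For a gap starting at 0 or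
    ending at 1, half a tent makes up for the missing equality of the end values. *)
Lemma gap_good (D : set R) (phi : dual JF) (t eta : R) : 0 <= t <= 1 -> 0 < eta ->
  D `<=` `]0, 1[%classic -> (D t \/ jump j phi t = 0) ->
  exists2 rho : R, 0 < rho & forall (p q : R) f, 0 <= p -> p < q -> q <= 1 ->
    t - rho < p -> q < t + rho -> (D t -> t <= p \/ q <= t) ->
    [\/ prim f p = prim f q, p = 0 /\ t = 0 | q = 1 /\ t = 1] ->
    `|phi (j (restr f p q))| <= eta * `|j f|.
Proof.
move=> t01 eta0 D01 Dt; have /andP[t0 t1] := t01.
have eta6 : 0 < eta / 6 by rewrite divr_gt0.
have [rho rho0 hrho] := local_null phi t01 eta6.
have D_01 : D t -> t != 0 /\ t != 1.
  by move=> /D01; rewrite /= in_itv/= => /andP[h1 h2]; rewrite gt_eqF// lt_eqF.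
exists rho => // p q f p0 pq q1 tp qt Dpq hpq.
have six : 6 * (eta / 6) = eta by field.
have le6 : eta / 6 * `|j f| <= eta * `|j f|.
  by rewrite ler_wpM2r// -[leRHS]six ler_peMl ?ler1n// ltW.
have inside (c : R) : ~ D t -> p < t \/ t = 0 /\ p = 0 -> t < q \/ t = 1 /\ q = 1 ->
    (p < t -> prim f t - prim f p = c) -> (t < q -> prim f t - prim f q = c) ->
    lnorm [:: 1] * `|c| <= `|j f| -> `|phi (j (restr f p q))| <= eta * `|j f|.
  case: Dt => // Jt _ h1 h2 h3 h4 h5; rewrite -[eta in leRHS]six.
  exact: (gap_good_in t01 eta6 hrho Jt p0 q1 tp qt h1 h2 h3 h4 h5).
have incrN (x y : R) : 0 <= x -> x <= y -> y <= 1 ->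
    lnorm [:: 1] * `|prim f y - prim f x| <= `|j f|.
  move=> x0 xy y1; apply: (@jf_incr_le _ _ _ symN _ _ jJF f (x, y)).
  by rewrite /in01/= x0 xy.
have [[pE tE]|n0] := pselect (p = 0 /\ t = 0).
  subst p t; apply: (inside (prim f 0 - prim f q)) => //.
  - by move=> /D_01[]; rewrite eqxx.
  - by right.
  - by left.
  - by rewrite ltxx.
  - by rewrite distrC incrN// ltW.
have [[qE tE]|n1] := pselect (q = 1 /\ t = 1).
  subst q t; apply: (inside (prim f 1 - prim f p)) => //.
  - by move=> /D_01[_]; rewrite eqxx.
  - by left.
  - by right.
  - by rewrite ltxx.
  - by rewrite incrN// ltW.
have {hpq}fpq : prim f p = prim f q by case: hpq.
have [/andP[pt tq]|out] := boolP (p < t < q).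
  apply: (inside (prim f t - prim f p)); [|by left|by left| | |].
  - by move=> /Dpq[h|h]; [move: pt|move: tq]; rewrite ltNge h.
  - by [].
  - by rewrite fpq.
  - by rewrite incrN// ltW.
apply: le_trans le6; apply: (gap_good_out t01 eta6 hrho) => //.
by move: out; rewrite negb_and -!leNgt => /orP[|]; [left|right].
Qed.

Lemma dense_between (D : set R) (a b : R) : countable_dense01 D -> 0 <= a -> a < b -> b <= 1 ->
  exists2 x, D x & a < x < b.
Proof.
move=> [_ _ dD] a0 ab b1; pose m := (a + b) / 2.
have [am mb] : a < m /\ m < b by have [] := midf_lt ab.
have /dD/(_ `]a, b[%classic) : `]0, 1[%classic m.
  by rewrite /= in_itv/= (le_lt_trans a0 am) (lt_le_trans mb b1).
case=> [|x [Dx]]; last by rewrite /= in_itv/=; exists x.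
by apply: near_in_itvoo; rewrite in_itv/= am mb.
Qed.

Definition good (phi : dual JF) (eta p q : R) : Prop := forall f, prim f p = prim f q ->
  `|phi (j (restr f p q))| <= eta * `|j f|.

Definition good_end (phi : dual JF) (eta p q : R) : Prop := forall f,
  `|phi (j (restr f p q))| <= eta * `|j f|.

(* The points reachable from 0 by a chain of good gaps have supremum 1. *)
Lemma chain_exists (D : set R) (phi : dual JF) (eta : R) : countable_dense01 D ->
  (forall t : R, 0 <= t <= 1 -> D t \/ jump j phi t = 0) -> 0 < eta ->
  exists (d : R) (l : seq R), [/\ 0 < d, forall x, x \in d :: l -> D x,
    path (fun p q => (p < q) && `[< good phi eta p q >]) d l,
    good_end phi eta 0 d & good_end phi eta (last d l) 1].
Proof.
move=> cD DJ eta0; have [D01 _ _] := cD.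
have /choice[rho hrho] (t : R) : exists rho : R, 0 <= t <= 1 -> 0 < rho /\
    forall (p q : R) f, 0 <= p -> p < q -> q <= 1 ->
    t - rho < p -> q < t + rho -> (D t -> t <= p \/ q <= t) ->
    [\/ prim f p = prim f q, p = 0 /\ t = 0 | q = 1 /\ t = 1] ->
    `|phi (j (restr f p q))| <= eta * `|j f|.
  have [t01|_] := boolP (0 <= t <= 1); last by exists 0.
  by have [r r0 hr] := gap_good t01 eta0 D01 (DJ t t01); exists r.
pose G p q := (p < q) && `[< good phi eta p q >].
pose S : set R := [set x | exists (d : R) (l : seq R), [/\ 0 < d, forall x : R, x \in d :: l -> D x,
    path G d l, good_end phi eta 0 d & last d l = x]].
have SD x : S x -> D x by move=> [d [l [_ h _ _ <-]]]; apply: h; exact: mem_last.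
have D_01 x : D x -> 0 < x < 1 by move=> /D01; rewrite /= in_itv.
have Sext x y : S x -> D y -> x < y -> good phi eta x y -> S y.
  move=> [d [l [d0 hl pl gd <-]]] Dy xy gxy; exists d, (rcons l y); split=> //.
  - by move=> z; rewrite -rcons_cons mem_rcons inE => /predU1P[->//|]; exact: hl.
  - by rewrite rcons_path pl /G xy; apply/asboolP.
  - by rewrite last_rcons.
have [|r0 hr0] := hrho 0; first by rewrite lexx ler01.
have m0 : 0 < Num.min (rho 0) 1 by rewrite lt_min r0 ltr01.
have [d Dd /andP[d0 dm]] := dense_between cD (lexx 0) m0 (ltac:(by rewrite ge_min lexx orbT)).
move: dm; rewrite lt_min => /andP[dr d1].
have Sd : S d.
  exists d, [::]; split=> //; first by move=> x; rewrite inE => /eqP->.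
  move=> f; apply: hr0 => //; rewrite ?add0r ?sub0r ?oppr_lt0//; first exact: ltW.
    by left.
  by constructor 2.
have hS : has_sup S.
  by split; [exists d|exists 1 => x /SD/D_01/andP[_ /ltW]].
pose s := sup S.
have s1 : s <= 1 by apply: ge_sup; [exists d|move=> x /SD/D_01/andP[_ /ltW]].
have s0 : 0 < s by rewrite (lt_le_trans d0)//; apply: sup_upper_bound.
have s01 : 0 <= s <= 1 by rewrite s1 ltW.
have [rs hrs] := hrho s s01.
have [z Sz zs] := sup_adherent rs hS; rewrite -/s in zs.
have /andP[z0 z1] := D_01 z (SD z Sz).
have zles : z <= s by apply: sup_upper_bound.
have [sE|sn1] := eqVneq s 1.
  case: Sz => d' [l [? ? ? ? lz]]; exists d', l; split=> // f; rewrite lz.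
  apply: hrs => //; first exact: ltW.
  - by rewrite -[X in X < _]sE ltrDl.
  - by right; rewrite sE.
  - by constructor 3.
have slt1 : s < 1 by rewrite lt_neqAle sn1.
have m1 : s < Num.min (s + rho s) 1 by rewrite lt_min slt1 ltrDl rs.
have [z' Dz' /andP[sz' z'm]] := dense_between cD (ltW s0) m1 (ltac:(by rewrite ge_min lexx orbT)).
move: z'm; rewrite lt_min => /andP[z'r z'1].
suff Sz' : S z' by have := sup_upper_bound hS Sz'; rewrite leNgt sz'.
(* If [s] is in [D], no gap may straddle it: the chain stops at [s] before it goes on to [z']. *)
have [[Ds zlts]|h] := pselect (D s /\ z < s).
  have Ss : S s.
    apply: (Sext z) => // f fzs; apply: hrs => //; first exact: ltW.
    - by rewrite ltrDl.
    - by right.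
    - by constructor 1.
  apply: (Sext s) => // f fsz; apply: hrs => //; [exact: ltW|exact: ltW| | |].
  - by rewrite ltrBlDr ltrDl.
  - by left.
  - by constructor 1.
have zz' : z < z' := le_lt_trans zles sz'.
apply: (Sext z) => // f fzz; apply: hrs => //; rewrite ?(ltW z0) ?(ltW z'1)//.
  by move=> Ds; left; rewrite leNgt; apply/negP => zlts; apply: h.
by constructor 1.
Qed.

End Gap.

(** * Chains of points and their gaps *)

Section Chains.
Variable R : realType.
Implicit Types (d x y : R) (l : seq R) (G I : R * R).

Fixpoint gaps d l : seq (R * R) := if l is z :: l' then (d, z) :: gaps z l' else [::].

Lemma chain_min d l x : path <%R d l -> x \in d :: l -> d <= x.
Proof.
move=> /(order_path_min lt_trans)/allP dl; rewrite inE => /predU1P[->//|/dl]; exact: ltW.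
Qed.

Lemma chain_max d l x : path <%R d l -> x \in d :: l -> x <= last d l.
Proof.
elim: l d x => [|z l IH] d x /=; first by rewrite inE => _ /eqP->.
move=> /andP[dz pl]; rewrite inE => /predU1P[->|]; last exact: IH.
by rewrite (le_trans (ltW dz))// IH// mem_head.
Qed.

Lemma gaps_mem d l G : path <%R d l -> G \in gaps d l ->
  [/\ G.1 \in d :: l, G.2 \in d :: l & G.1 < G.2].
Proof.
elim: l d => // z l IH d /= /andP[dz pl]; rewrite inE => /predU1P[->/=|/(IH _ pl)[h1 h2 h3]].
  by rewrite !inE !eqxx orbT.
by split=> //; rewrite in_cons ?h1 ?h2 orbT.
Qed.

Lemma gaps_node d l G y : path <%R d l -> G \in gaps d l -> y \in d :: l ->
  (y <= G.1) \/ (G.2 <= y).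
Proof.
elim: l d => // z l IH d /= /andP[dz pl]; rewrite in_cons => /predU1P[->/=|Gl].
  rewrite in_cons => /predU1P[->|yl]; first by left.
  by right; exact: chain_min yl.
rewrite in_cons => /predU1P[->|]; last exact: IH.
have [G1 _ _] := gaps_mem pl Gl; left; rewrite (le_trans (ltW dz))//.
exact: chain_min G1.
Qed.

Lemma gaps_admissible d l : 0 <= d -> last d l <= 1 -> path <%R d l -> admissible (gaps d l).
Proof.
elim: l d => // z l IH d d0 /= l1 /andP[dz pl].
have z0 : 0 <= z := le_trans d0 (ltW dz).
rewrite admissible_cons IH// andbT /in01/= d0 (ltW dz) (le_trans (chain_max pl (mem_head _ _)))//=.
apply/allP => G Gl; have [G1 _ _] := gaps_mem pl Gl.
by rewrite /itv_disj/= (chain_min pl G1).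
Qed.

Lemma uniq_gaps d l : path <%R d l -> uniq (gaps d l).
Proof.
elim: l d => // z l IH d /= /andP[dz pl]; rewrite IH// andbT; apply/negP => /(gaps_mem pl)[/= dl _ _].
by have := chain_min pl dl; rewrite leNgt dz.
Qed.

Lemma admissible_disj (s : seq (R * R)) G G' : admissible s -> G \in s -> G' \in s -> G != G' ->
  itv_disj G G'.
Proof.
move=> /andP[_ ps] Gs G's GG'; have P := elimT (pairwiseP G) ps.
have hG : nth G s (index G s) = G by rewrite nth_index.
have hG' : nth G s (index G' s) = G' by rewrite nth_index.
have iG : (index G s < size s)%N by rewrite index_mem.
have iG' : (index G' s < size s)%N by rewrite index_mem.
have : index G s != index G' s by apply: contra GG' => /eqP h; rewrite -hG h hG'.
rewrite neq_ltn => /orP[h|h].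
  by have := P _ _ iG iG' h; rewrite hG hG'.
by rewrite itv_disjC; have := P _ _ iG' iG h; rewrite hG hG'.
Qed.

(** A degenerate interval counts as outside even when it lies in the gap, since every increment over
    it vanishes. *)
Definition outside I G := [|| I.2 <= G.1, G.2 <= I.1 | I.1 == I.2].

Lemma outside_or_inside I G : ~~ (I.1 < G.1 < I.2) -> ~~ (I.1 < G.2 < I.2) ->
  ~~ outside I G -> G.1 <= I.1 /\ I.2 <= G.2.
Proof.
rewrite /outside !negb_or -!ltNge => h1 h2 /and3P[a b _].
by move: h1 h2; rewrite a b andbT /= -!leNgt.
Qed.

(** Without a node inside, an interval that is not outside a gap is contained in it, and gaps do not
    overlap. This supplies the column condition of [lnorm_collect]. *)
Lemma outside_single d l I G G' : 0 <= d -> last d l <= 1 -> path <%R d l -> I.1 <= I.2 ->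
  {in d :: l, forall x, ~~ (I.1 < x < I.2)} -> G \in gaps d l -> G' \in gaps d l -> G != G' ->
  outside I G \/ outside I G'.
Proof.
move=> d0 l1 pl I12 hI Gl G'l GG'.
have [G1 G2 _] := gaps_mem pl Gl; have [G'1 G'2 _] := gaps_mem pl G'l.
have [_|o] := boolP (outside I G); first by left.
have [_|o'] := boolP (outside I G'); first by right.
have [a1 a2] := outside_or_inside (hI _ G1) (hI _ G2) o.
have [b1 b2] := outside_or_inside (hI _ G'1) (hI _ G'2) o'.
exfalso; move: o; rewrite /outside !negb_or => /and3P[_ _ /negP]; apply.
rewrite eq_le I12 /=.
have /orP[h|h] := admissible_disj (gaps_admissible d0 l1 pl) Gl G'l GG'.
  by rewrite (le_trans a2)// (le_trans h).
by rewrite (le_trans b2)// (le_trans h).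
Qed.

Lemma clamp_outside I G : G.1 <= G.2 -> I.1 <= I.2 -> outside I G ->
  clamp G.1 G.2 I.2 = clamp G.1 G.2 I.1.
Proof.
move=> G12 I12 /or3P[h|h|/eqP->//].
  by rewrite !clamp_le// (le_trans I12).
by rewrite !clamp_ge// (le_trans h).
Qed.

Lemma sum_single (T : eqType) (r : seq T) (P : pred T) (v : T -> R) M : 0 <= M -> uniq r ->
  {in r &, forall i k, i != k -> v i = 0 \/ v k = 0} ->
  {in r, forall i, P i -> `|v i| <= M} -> `|\sum_(i <- r | P i) v i| <= M.
Proof.
move=> M0; elim: r => [|i r IH] /=; first by rewrite big_nil normr0.
move=> /andP[ir ur] v1 vM.
have v1' : {in r &, forall i k, i != k -> v i = 0 \/ v k = 0}.
  by move=> k m kr mr; apply: v1; rewrite inE ?kr ?mr orbT.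
have vM' : {in r, forall i, P i -> `|v i| <= M}.
  by move=> k kr; apply: vM; rewrite inE kr orbT.
rewrite big_cons; case: ifP => Pi; last exact: IH.
have [->|vi] := eqVneq (v i) 0; first by rewrite add0r IH.
rewrite big1_seq ?addr0; first by apply: vM; rewrite ?mem_head.
move=> k /andP[_ kr]; have ik : i != k by apply: contraNneq ir => ->.
have := v1 i k (mem_head _ _); rewrite inE kr orbT => /(_ isT ik)[h|//].
by rewrite h eqxx in vi.
Qed.

End Chains.

Lemma dual_norm_dense (R : realType) (E0 : lmodType R) (E : normedModType R)
    (j : {linear E0 -> E}) (phi : dual E) (M : R) : dense (range j) -> 0 <= M ->
  (forall f, `|phi (j f)| <= M * `|j f|) -> `|phi| <= M.
Proof.
move=> dj M0 hphi; apply: dual_norm_le => x x1; apply/ler_addgt0Pr => eps eps0.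
have d0 : 0 < eps / (`|phi| + M + 1) by rewrite divr_gt0// ltr_wpDl// addr_ge0.
have [||y [/= h [f _ fE]]] := dj (ball x (eps / (`|phi| + M + 1))).
- by exists x; exact: ballxx.
- exact: ball_open.
move: h; rewrite -fE -ball_normE/= => xf.
have -> : phi x = phi (x - j f) + phi (j f) by rewrite dualB subrK.
rewrite (le_trans (ler_normD _ _))//.
have h1 : `|phi (x - j f)| <= `|phi| * (eps / (`|phi| + M + 1)).
  by rewrite (le_trans (dual_norm_bound _ _))// ler_wpM2l// ltW.
have h2 : `|phi (j f)| <= M * (1 + eps / (`|phi| + M + 1)).
  rewrite (le_trans (hphi f))// ler_wpM2l//.
  have -> : j f = x - (x - j f) by rewrite opprB addrC subrK.
  by rewrite (le_trans (ler_normB _ _))// lerD// ltW.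
rewrite (le_trans (lerD h1 h2))// mulrDr mulr1 addrCA lerD2l -mulrDl.
rewrite mulrCA ger_pMr// ler_pdivrMr ?mul1r ?lerDl//.
by rewrite ltr_wpDl// addr_ge0.
Qed.

(** * Averaging over gaps, and the functionals without jumps outside Delta *)

Section Averages.
Variables (R : realType) (X : normedModType R) (e : nat -> X).
Hypothesis symN : symmetric_lnorm e.
Variables (JF : completeNormedModType R) (j : {linear L1 R -> JF}).
Hypothesis jJF : is_JF e j.
Local Notation lnorm := (lnorm e).
Implicit Types (f g h : L1 R) (s : seq (R * R)) (d : R) (l : seq R) (G : R * R).

Definition slope f G : R := incr (prim f) G / (G.2 - G.1).

(** The conditional expectation of [f] with respect to the gaps, extended by zero: up to a constant,
    its primitive interpolates that of [f] linearly between the nodes. *)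
Definition avg f d l : L1 R := \sum_(G <- gaps d l) slope f G *: restr (L1_one R) G.1 G.2.

Lemma prim_restr_one (p q x : R) : 0 <= p -> p <= q -> q <= 1 ->
  prim (restr (L1_one R) p q) x = clamp p q x - p.
Proof.
move=> p0 pq q1; rewrite prim_restr// !prim_one.
have /andP[h1 h2] := @clamp_itv R p q x pq.
congr (_ - _); apply: clamp_id; first by rewrite (le_trans p0 h1) (le_trans h2 q1).
by rewrite p0 (le_trans pq).
Qed.

Lemma prim_avg f d l x : 0 <= d -> last d l <= 1 -> path <%R d l ->
  prim (avg f d l) x = \sum_(G <- gaps d l) slope f G * (clamp G.1 G.2 x - G.1).
Proof.
move=> d0 l1 pl; rewrite prim_sum !big_seq; apply: eq_bigr => G Gl.
have /andP[/allP/(_ _ Gl)/and3P[G0 G12 G1] _] := gaps_admissible d0 l1 pl.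
by rewrite primZ prim_restr_one.
Qed.

Lemma prim_avg_node f d l y : 0 <= d -> last d l <= 1 -> path <%R d l -> y \in d :: l ->
  prim (avg f d l) y = prim f y - prim f d.
Proof.
move=> d0 l1 pl yl; rewrite prim_avg//.
elim: l d d0 l1 pl yl => [|z l IH] d d0 l1; first by rewrite inE => _ /eqP->; rewrite big_nil subrr.
move=> /= /andP[dz pl]; rewrite inE big_cons/= => /predU1P[->|yl].
  have -> : clamp d z d - d = 0 by rewrite clamp_le// subrr.
  rewrite mulr0 add0r big_seq big1 ?subrr// => G Gl.
  have [G1 _ _] := gaps_mem pl Gl.
  by rewrite clamp_le ?subrr ?mulr0// (le_trans (ltW dz))// (chain_min pl).
have dz' : z - d != 0 by rewrite subr_eq0 gt_eqF.
rewrite IH//; last exact: le_trans (ltW dz).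
rewrite clamp_ge ?(ltW dz) ?(chain_min pl)// /slope /incr/= divfK//.
by rewrite addrC subrKA.
Qed.

Lemma prim_sub_avg_node f d l y : 0 <= d -> last d l <= 1 -> path <%R d l -> y \in d :: l ->
  prim (f - avg f d l) y = prim f d.
Proof. by move=> d0 l1 pl yl; rewrite primB prim_avg_node// opprB addrC subrK. Qed.

(** The primitive of the remainder is constant on the nodes, so cutting there costs a factor 2. On
    each piece [f] and its average each cost [|j f|]: the increments of the interpolation inside a
    gap add up to at most that of [f] over the gap. *)
Lemma jf_sub_avg_le f d l : 0 <= d -> last d l <= 1 -> path <%R d l ->
  `|j (f - avg f d l)| <= 4 * `|j f|.
Proof.
move=> d0 l1 pl; rewrite (_ : 4 * _ = 2 * (2 * `|j f|)); last by ring.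
have adg := gaps_admissible d0 l1 pl.
apply: (jf_le_split symN jJF (H := prim (f - avg f d l)) (D := d :: l)) => //.
  by move=> y y' yl y'l; rewrite !prim_sub_avg_node.
move=> s ads sD.
have s12 I : I \in s -> I.1 <= I.2.
  by move=> Is; have /andP[/allP/(_ _ Is)/and3P[]] := ads.
pose v G (I : R * R) := - (slope f G * (clamp G.1 G.2 I.2 - clamp G.1 G.2 I.1)).
have E : incr (prim (f - avg f d l)) =1 (fun I => incr (prim f) I + \sum_(G <- gaps d l) v G I).
  move=> I; rewrite (_ : \sum_(G <- gaps d l) v G I = prim (avg f d l) I.1 - prim (avg f d l) I.2).
    by rewrite /incr !primB; ring.
  by rewrite !prim_avg// -sumrB; apply: eq_bigr => G _; rewrite /v; ring.
rewrite (eq_map E) (le_trans (lnormD _ _ _ _))// mulrDl !mul1r lerD ?(jf_ge symN jJF)//.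
rewrite (le_trans _ (jf_ge symN jJF f adg))//.
rewrite (le_trans (lnorm_collect symN (uniq_gaps pl) _))//.
  move=> I Is G G' Gl G'l GG'; have I12 := s12 I Is.
  have out0 G0 : G0 \in gaps d l -> outside I G0 -> v G0 I = 0.
    by move=> /(gaps_mem pl)[_ _ /ltW G12] o; rewrite /v clamp_outside// subrr mulr0 oppr0.
  by case: (outside_single d0 l1 pl I12 (sD I Is) Gl G'l GG') => /out0; [left|right]; auto.
apply: (lnorm_map_le symN) => G Gl.
have [_ _ G12] := gaps_mem pl Gl; have G12' := ltW G12.
have /andP[/allP/(_ _ Gl)/and3P[G0 _ G1] _] := adg.
rewrite ger0_norm ?sumr_ge0//.
rewrite (@eq_big_seq _ _ _ _ _ _ (fun I => `|slope f G| * incr (clamp G.1 G.2) I)); last first.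
  move=> I /s12 I12; rewrite /v normrN normrM; congr (_ * _).
  by rewrite ger0_norm// subr_ge0 clamp_mono.
rewrite -mulr_sumr /slope normrM normfV -mulrA ler_piMr//.
rewrite ler_pdivrMl ?mulr1 ?normr_gt0 ?subr_eq0 ?gt_eqF// gtr0_norm ?subr_gt0//.
rewrite (le_trans (admissible_sum_le _ ads))//; first by move=> x y; exact: clamp_mono.
by rewrite clamp_ge// clamp_le.
Qed.

Lemma jf_restr_split f (p q r : R) : 0 <= p -> p <= q -> q <= r -> r <= 1 ->
  j (restr f p r) = j (restr f p q) + j (restr f q r).
Proof.
move=> p0 pq qr r1; rewrite -linearD; apply: (jf_eq symN jJF) => I I01.
have pr := le_trans pq qr; have q0 := le_trans p0 pq; have q1 := le_trans qr r1.
have E x : prim (restr f p r) x = prim (restr f p q + restr f q r) x.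
  rewrite primD !prim_restr//.
  have [xq|qx] := leP x q.
    rewrite (clamp_le r xq) subrr addr0; congr (prim f _ - _).
    have [rx|xr] := leP r x.
      by have -> : r = q by apply/le_anti; rewrite qr (le_trans rx).
    rewrite /clamp (leNgt r) xr; case: ifP => // _; case: (leP q x) => // qx.
    by apply/le_anti; rewrite xq qx.
  rewrite (clamp_ge pq (ltW qx)) [RHS]addrC subrKA; congr (prim f _ - _).
  by rewrite /clamp leNgt (le_lt_trans pq qx) (leNgt x q) qx.
by rewrite /incr !E.
Qed.

Lemma jf_chain_split f d l : 0 <= d -> last d l <= 1 -> path <%R d l ->
  j (restr f d (last d l)) = \sum_(G <- gaps d l) j (restr f G.1 G.2).
Proof.
elim: l d => [|z l IH] d d0 /=.
  move=> d1 _; rewrite big_nil -[RHS](linear0 j); apply: (jf_eq symN jJF) => I _.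
  have cE x : clamp d d x = d by apply/le_anti; rewrite andbC clamp_itv.
  by rewrite /incr !prim_restr// !cE !prim_L1_0 !subrr.
move=> l1 /andP[dz pl]; have z0 := le_trans d0 (ltW dz).
rewrite big_cons -IH// (@jf_restr_split _ d z)//; first exact: ltW.
by rewrite (chain_max pl)// mem_head.
Qed.

Lemma jf_restr01 f : j (restr f 0 1) = j f.
Proof.
apply: (jf_eq symN jJF) => I /and3P[I0 I12 I1].
by rewrite /incr !prim_restr// !clamp_id ?I0 ?I1 ?(le_trans I0 I12) ?(le_trans I12 I1)// opprB addrA subrK.
Qed.

Lemma lnorm_ones_mono n m : (n <= m)%N -> lnorm (nseq n 1) <= lnorm (nseq m 1).
Proof.
have E k : nseq k (1 : R) = mkseq (fun=> 1) k.
  by apply: (@eq_from_nth _ 0); rewrite ?size_nseq ?size_mkseq// => i ik; rewrite nth_nseq ik nth_mkseq.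
by move=> nm; rewrite !E; exact: lnorm_mkseq_mono.
Qed.

Definition oscillates h (delta : R) G : bool :=
  `[< exists2 x, G.1 <= x <= G.2 & delta < `|prim h x - prim h G.1| >].

(** In each oscillating gap an initial interval has an increment larger than [delta] in absolute
    value. When the norms of the constant lists are unbounded, this bounds the number of such
    gaps. *)
Lemma count_oscillates h (delta : R) s : 0 <= delta -> admissible s ->
  delta * lnorm (nseq (count (oscillates h delta) s) 1) <= `|j h|.
Proof.
move=> d0 ads; have /choice[x hx] (G : R * R) : exists x : R, oscillates h delta G ->
    G.1 <= x <= G.2 /\ delta < `|prim h x - prim h G.1|.
  have [/asboolP[x]|_] := boolP (oscillates h delta G); last by exists 0.
  by exists x.
pose r := [seq G <- s | oscillates h delta G].
have rO G : G \in r -> oscillates h delta G by rewrite mem_filter => /andP[].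
have adr : admissible (map (fun G => (G.1, x G)) r).
  apply: admissible_sub; last exact: admissible_filter.
  by move=> G /rO/hx[/andP[h1 h2] _] /=; rewrite lexx h1.
rewrite (le_trans _ (jf_ge symN jJF h adr))// -map_comp.
have -> : nseq (count (oscillates h delta) s) (1 : R) = map (fun=> 1) r.
  by rewrite -size_filter -/r; elim: r {rO adr} => //= G r ->.
rewrite -{1}(ger0_norm d0) -lnormZ; apply: (lnorm_map_le symN) => G /rO/hx[_ hG].
by rewrite /= mulr1 ger0_norm// ltW.
Qed.

Definition flat h (delta : R) d l : L1 R :=
  \sum_(G <- gaps d l | ~~ oscillates h delta G) restr h G.1 G.2.

Section Flat.
Variables (h : L1 R) (delta : R) (d : R) (l : seq R).
Hypotheses (d0 : 0 <= d) (l1 : last d l <= 1) (pl : path <%R d l).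
Hypothesis hd : forall y, y \in d :: l -> prim h y = prim h d.

Lemma prim_flat x : prim (flat h delta d l) x =
  \sum_(G <- gaps d l | ~~ oscillates h delta G) (prim h (clamp G.1 G.2 x) - prim h d).
Proof.
rewrite prim_sum [LHS]big_seq_cond [RHS]big_seq_cond; apply: eq_bigr => G /andP[Gl _].
have /andP[/allP/(_ _ Gl)/and3P[G0 G12 G1] _] := gaps_admissible d0 l1 pl.
by have [G1l _ _] := gaps_mem pl Gl; rewrite prim_restr// (hd G1l).
Qed.

Lemma clamp_gap_node G x : G \in gaps d l -> ~~ (G.1 < x < G.2) -> prim h (clamp G.1 G.2 x) = prim h d.
Proof.
move=> Gl; have [G1 G2 G12] := gaps_mem pl Gl; rewrite negb_and -!leNgt => /orP[h1|h1].
  by rewrite clamp_le// hd.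
by rewrite clamp_ge// ?hd// ltW.
Qed.

(** A point is interior to at most one gap, so at most one term survives, and its gap does not
    oscillate. *)
Lemma flat_small x : 0 <= delta -> `|prim (flat h delta d l) x| <= delta.
Proof.
move=> delta0; rewrite prim_flat; apply: sum_single => //; first exact: uniq_gaps.
  move=> G G' Gl G'l GG'.
  have [Gx|Gx] := boolP (G.1 < x < G.2); last by left; rewrite clamp_gap_node// subrr.
  have [G'x|G'x] := boolP (G'.1 < x < G'.2); last by right; rewrite clamp_gap_node// subrr.
  exfalso; move: Gx G'x => /andP[a1 a2] /andP[b1 b2].
  have /orP[c|c] := admissible_disj (gaps_admissible d0 l1 pl) Gl G'l GG'.
    by have := lt_trans (lt_le_trans a2 c) b1; rewrite ltxx.
  by have := lt_trans (lt_le_trans b2 c) a1; rewrite ltxx.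
move=> G Gl nO; have [G1 G2 G12] := gaps_mem pl Gl.
rewrite leNgt; apply/negP => hG; move/negP: nO; apply; apply/asboolP.
exists (clamp G.1 G.2 x); first by apply: clamp_itv; exact: ltW.
by rewrite (hd G1).
Qed.

(** Over an interval without nodes inside, the increment is that of [h] or zero; cutting at the
    nodes costs the factor 2. *)
Lemma jf_flat_le : `|j (flat h delta d l)| <= 2 * `|j h|.
Proof.
apply: (jf_le_split symN jJF (H := prim (flat h delta d l)) (D := d :: l)) => //.
  have Z y : y \in d :: l -> prim (flat h delta d l) y = 0.
    move=> yl; rewrite prim_flat big_seq_cond big1// => G /andP[Gl _].
    rewrite clamp_gap_node ?subrr//; apply/negP => /andP[a1 a2].
    by case: (gaps_node pl Gl yl); rewrite leNgt ?a1 ?a2.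
  by move=> y y' yl y'l; rewrite !Z.
move=> s ads sD; rewrite (le_trans _ (jf_ge symN jJF h ads))//.
apply: (lnorm_map_le symN) => I Is.
have I12 : I.1 <= I.2 by have /andP[/allP/(_ _ Is)/and3P[]] := ads.
have -> : incr (prim (flat h delta d l)) I = \sum_(G <- gaps d l | ~~ oscillates h delta G)
    (prim h (clamp G.1 G.2 I.2) - prim h (clamp G.1 G.2 I.1)).
  by rewrite /incr !prim_flat -sumrB; apply: eq_bigr => G _; ring.
have out0 G : G \in gaps d l -> outside I G ->
    prim h (clamp G.1 G.2 I.2) - prim h (clamp G.1 G.2 I.1) = 0.
  by move=> /(gaps_mem pl)[_ _ /ltW G12] o; rewrite clamp_outside// subrr.
apply: sum_single => //; first exact: uniq_gaps.
  move=> G G' Gl G'l GG'.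
  by case: (outside_single d0 l1 pl I12 (sD I Is) Gl G'l GG') => /out0; [left|right]; auto.
move=> G Gl _; have [oG|nG] := boolP (outside I G); first by rewrite out0// normr0.
have [G1 G2 G12] := gaps_mem pl Gl.
have [a1 a2] := outside_or_inside (sD I Is _ G1) (sD I Is _ G2) nG.
by rewrite !clamp_id ?a1 ?a2 ?(le_trans a1) ?(le_trans I12).
Qed.

End Flat.

Lemma itv_functional (p q : R) : 0 < lnorm [:: 1] -> 0 <= p -> p <= q -> q <= 1 ->
  exists F : dual JF, (forall f, F (j f) = prim f q - prim f p) /\ `|F| <= (lnorm [:: 1])^-1.
Proof.
move=> N1 p0 pq q1; apply: dense_extend; first exact: jJF.1.
- by rewrite invr_ge0 ltW.
- by move=> a f g; rewrite !primP; ring.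
- move=> f; rewrite mulrC ler_pdivlMr// mulrC.
  by apply: (@jf_incr_le _ _ _ symN _ _ jJF f (p, q)); rewrite /in01/= p0 pq.
Qed.

Lemma csub_sum (V : normedModType R) (Y : closedSubspace V) (T : eqType) (r : seq T)
    (c : T -> R) (F : T -> V) : {in r, forall i, csub_set Y (F i)} ->
  csub_set Y (\sum_(i <- r) c i *: F i).
Proof.
have [Y0 YD] := csub_subspace Y; elim: r => [|i r IH] hF; first by rewrite big_nil.
rewrite big_cons; apply: YD; first by apply: hF; exact: mem_head.
by apply: IH => k kr; apply: hF; rewrite inE kr orbT.
Qed.

Definition lnorm_unbounded := forall C : R, exists n, C < lnorm (nseq n 1).

Hypothesis lnorm1_gt0 : 0 < lnorm [:: 1].
Hypothesis shrN : shrinking_lnorm e.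
Hypothesis unbN : lnorm_unbounded.

(** The coefficients of the average are multiples of the integrals over the gaps, so [phi] composed
    with it is a combination of the functionals of the gaps, whose ends lie in [D]. *)
Lemma avg_functional (D : set R) (phi : dual JF) d l : countable_dense01 D ->
  path <%R d l -> (forall x, x \in d :: l -> D x) ->
  exists2 psi : dual JF, csub_set (interval_span j D) psi & forall f, psi (j f) = phi (j (avg f d l)).
Proof.
move=> [D01 _ _] pl hl.
have /choice[F hF] (G : R * R) : exists F : dual JF, G \in gaps d l ->
    forall f, F (j f) = prim f G.2 - prim f G.1.
  have [Gl|_] := boolP (G \in gaps d l); last by exists 0.
  have [/hl/D01 + /hl/D01 + G12] := gaps_mem pl Gl; rewrite /= !in_itv/= => /andP[a1 a2] /andP[b1 b2].
  have [F [hF _]] := itv_functional lnorm1_gt0 (ltW a1) (ltW G12) (ltW b2).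
  by exists F.
exists (\sum_(G <- gaps d l) (phi (j (restr (L1_one R) G.1 G.2)) / (G.2 - G.1)) *: F G).
  apply: csub_sum => G Gl W; apply.
  have [/hl DG1 /hl DG2 G12] := gaps_mem pl Gl.
  have := D01 _ DG1; have := D01 _ DG2; rewrite /= !in_itv/= => /andP[_ /ltW b] /andP[/ltW a _].
  exists G.1, G.2, true, true; split=> // f.
  by rewrite hF// (prim_itv _ _ (L1_int01 f))// ltW.
move=> f; rewrite /avg linear_sum/=.
have -> (x : JF) (c : R * R -> R) : (\sum_(G <- gaps d l) c G *: F G) x = \sum_(G <- gaps d l) c G * F G x.
  elim: (gaps d l) => [|G s IH]; first by rewrite !big_nil.
  by rewrite !big_cons -IH.
have -> (u : R * R -> JF) : phi (\sum_(G <- gaps d l) u G) = \sum_(G <- gaps d l) phi (u G).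
  exact: linear_sum.
rewrite !big_seq; apply: eq_bigr => G Gl.
by rewrite [j (_ *: _)]linearZ/= dualZ hF// /slope /incr; ring.
Qed.

(* The remainder [f - avg f d l] is split along the chain; the few gaps on which its primitive
   oscillates and the two outer ones contribute little, the others form a pointwise small function. *)
Lemma kernel_span (D : set R) (phi : dual JF) : countable_dense01 D ->
  (forall t : R, 0 <= t <= 1 -> D t \/ jump j phi t = 0) -> csub_set (interval_span j D) phi.
Proof.
move=> cD DJ; have [D01 _ _] := cD.
suff near_Y (eps : R) : 0 < eps -> exists2 psi, csub_set (interval_span j D) psi & `|phi - psi| <= eps.
  apply: (csub_closed (c := interval_span j D)) => B /nbhs_normP[r /= r0 Hr].
  have r20 : 0 < r / 2 by rewrite divr_gt0.
  have [psi Ypsi hpsi] := near_Y _ r20; exists psi; split=> //; apply: Hr => /=.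
  by rewrite (le_lt_trans hpsi)// ltr_pdivrMr// ltr_pMr// ltr1n.
move=> eps0; apply: contrapT => far.
have step k : exists h', [/\ `|j h'| <= 8, forall x, 0 <= x <= 1 -> `|prim h' x| <= k.+1%:R^-1 &
    eps / 2 <= phi (j h')].
  (* As [|j h| <= 4] and [delta = 1 / (k + 1)], at most [n] gaps of any chain oscillate. So [n] can
     be fixed before the chain, which depends on [eta]: the oscillating gaps and the two outer ones
     cost at most [4 * eta] each, [(n + 2) * 4 * eta = eps / 2] in all. *)
  have [n hn] := unbN (4 * k.+1%:R).
  pose eta := eps / (8 * n.+2%:R).
  have eta0 : 0 < eta by rewrite divr_gt0// mulr_gt0.
  have [d [l [d0 hl pl' g0 g1]]] := chain_exists symN jJF lnorm1_gt0 shrN cD DJ eta0.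
  have pl : path <%R d l by apply: sub_path pl' => x y /andP[].
  have hl01 x : x \in d :: l -> 0 < x < 1 by move=> /hl/D01; rewrite /= in_itv.
  have l1 : last d l <= 1 by have /hl01/andP[_ /ltW] := mem_last d l.
  have l0 : 0 <= last d l by have /hl01/andP[/ltW] := mem_last d l.
  have dle : d <= last d l by apply: (chain_max pl); exact: mem_head.
  have gG G : G \in gaps d l -> good j phi eta G.1 G.2.
    move: pl'; clear; elim: l d => // z l IH d /= /andP[/andP[_ /asboolP gz] pl'].
    by rewrite inE => /predU1P[->//|]; exact: IH.
  have [psi Ypsi hpsi] := avg_functional phi cD pl hl.
  have [f hf] : exists f, eps * `|j f| < `|(phi - psi) (j f)|.
    apply: contrapT => nf; apply: far; exists psi => //; apply: (dual_norm_dense jJF.1); first exact: ltW.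
    by move=> f; rewrite leNgt; apply/negP => hf; apply: nf; exists f.
  have f0 : 0 < `|j f|.
    rewrite lt_neqAle normr_ge0 andbT; apply/eqP => f0; move: hf; rewrite -f0 mulr0.
    by rewrite ltNge (le_trans (dual_norm_bound _ _))// -f0 mulr0.
  pose c := `|j f|^-1 * Num.sg ((phi - psi) (j f)); pose f1 : L1 R := c *: f.
  have f1N : `|j f1| <= 1.
    rewrite /f1 linearZ/= normrZ /c normrM normfV normr_id normr_sg -mulrA ler_pdivrMl// mulr1.
    by rewrite ler_piMl//; case: (_ != 0).
  have hf1 : eps <= (phi - psi) (j f1).
    have -> : (phi - psi) (j f1) = c * (phi - psi) (j f) by rewrite -dualZ -linearZ.
    rewrite /c -mulrA -normrEsg mulrC ler_pdivlMr//.
    exact: ltW.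
  pose h : L1 R := f1 - avg f1 d l.
  have hN : `|j h| <= 4.
    by rewrite (le_trans (jf_sub_avg_le f1 (ltW d0) l1 pl))// ler_piMr.
  have phih : eps <= phi (j h).
    by rewrite /h linearB/= dualB -hpsi.
  have hd y : y \in d :: l -> prim h y = prim h d.
    by move=> yl; rewrite !(prim_sub_avg_node f1 (ltW d0) l1 pl)// mem_head.
  pose delta : R := k.+1%:R^-1.
  have delta0 : 0 <= delta by rewrite invr_ge0.
  exists (flat h delta d l); split.
  - by rewrite (le_trans (jf_flat_le delta (ltW d0) l1 pl hd))// (_ : 8 = 2 * 4) ?ler_pM2l//; ring.
  - by move=> x _; apply: flat_small => //; exact: ltW.
  have cnt : (count (oscillates h delta) (gaps d l) <= n)%N.
    rewrite leqNgt; apply/negP => /ltnW/lnorm_ones_mono hc.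
    have := count_oscillates h delta0 (gaps_admissible (ltW d0) l1 pl).
    move=> /le_trans/(_ hN); rewrite mulrC ler_pdivrMr// => /(le_trans hc).
    by rewrite leNgt hn.
  pose S := \sum_(G <- gaps d l | oscillates h delta G) phi (j (restr h G.1 G.2)).
  have split_h : phi (j h) = phi (j (restr h 0 d)) + phi (j (restr h (last d l) 1)) + S +
      phi (j (flat h delta d l)).
    rewrite -[in LHS](jf_restr01 h) (jf_restr_split h _ (ltW d0) (le_trans dle l1))//.
    rewrite (jf_restr_split h (ltW d0) dle l1)// (jf_chain_split h (ltW d0) l1 pl).
    have -> : S = phi (\sum_(G <- gaps d l | oscillates h delta G) j (restr h G.1 G.2)).
      by rewrite /S linear_sum.
    have -> : j (flat h delta d l) = \sum_(G <- gaps d l | ~~ oscillates h delta G) j (restr h G.1 G.2).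
      by rewrite /flat linear_sum.
    rewrite (bigID (oscillates h delta))/= !dualD; ring.
  have eta4 G : good_end j phi eta G.1 G.2 -> `|phi (j (restr h G.1 G.2))| <= 4 * eta.
    by move=> /(_ h)/le_trans; apply; rewrite mulrC ler_wpM2r// ltW.
  have b0 := eta4 (0, d) g0; have b1 := eta4 (last d l, 1) g1.
  have bS : `|S| <= n%:R * (4 * eta).
    rewrite (le_trans (ler_norm_sum _ _ _))//.
    apply: (@le_trans _ _ (\sum_(G <- gaps d l | oscillates h delta G) 4 * eta)).
      rewrite big_seq_cond [leRHS]big_seq_cond; apply: ler_sum => G /andP[Gl _].
      have [G1 G2 _] := gaps_mem pl Gl.
      rewrite (le_trans (gG G Gl h _))//; first by rewrite (hd _ G1) (hd _ G2).
      by rewrite mulrC ler_wpM2r// ltW.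
    rewrite big_const_seq iter_addr addr0 -[leLHS]mulr_natl ler_wpM2r ?ler_nat//.
    by rewrite mulr_ge0// ltW.
  have etaE : (n%:R + 2) * (4 * eta) = eps / 2.
    by rewrite /eta -natr1 -natr1; field; rewrite -natrD -natr1 natr1 pnatr_eq0.
  move: phih b0 b1 bS etaE; rewrite split_h /=; clear.
  move: (phi (j (restr h 0 d))) (phi (j (restr h (last d l) 1))) S (phi (j (flat h delta d l))).
  move=> a b s u h1 h2 h3 h4 h5.
  have := ler_norm a; have := ler_norm b; have := ler_norm s.
  lra.
have /choice[h' hh'] := step.
apply: (@weakly_null _ _ _ symN _ _ jJF lnorm1_gt0 shrN h' 8 phi (eps / 2)).
- by move=> k; have [] := hh' k.
- move=> x x01; apply/cvgr0Pnorm_le => r r0; have [N hN] := divS_small 1 r0.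
  exists N => // k Nk; have [_ + _] := hh' k => /(_ x x01)/le_trans; apply.
  by have := hN k Nk; rewrite mul1r.
- by rewrite divr_gt0.
- by move=> k; have [] := hh' k.
Qed.

End Averages.

(** * Functionals with prescribed jumps *)

Section Onto.
Variables (R : realType) (X : normedModType R) (e : nat -> X).
Hypothesis symN : symmetric_lnorm e.
Variables (JF : completeNormedModType R) (j : {linear L1 R -> JF}).
Hypothesis jJF : is_JF e j.
Local Notation lnorm := (lnorm e).
Hypothesis lnorm1_gt0 : 0 < lnorm [:: 1].
Hypothesis shrN : shrinking_lnorm e.
Hypothesis unbN : lnorm_unbounded e.
Implicit Types (f g : L1 R) (phi psi : dual JF).

(** Identifies [W] with the families that pair boundedly with finite families normed by [lnorm],
    that is, with the dual of X_Gamma. Both [dual XR] and [l2 R R] have this form. *)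
Definition dual_coordinates (W : normedModType R) (kappa : W -> R -> R) : Prop :=
  [/\ forall a w w' r, kappa (a *: w + w') r = a * kappa w r + kappa w' r,
      forall w w', kappa w =1 kappa w' -> w = w',
      forall w (s : seq R) (c : R -> R), uniq s ->
        `|\sum_(r <- s) kappa w r * c r| <= `|w| * lnorm (map c s) &
      forall (g : R -> R) M, 0 <= M ->
        (forall (s : seq R) (c : R -> R), uniq s ->
          `|\sum_(r <- s) g r * c r| <= M * lnorm (map c s)) ->
        exists2 w, kappa w =1 g & `|w| <= M].

Variable D : set R.
Hypothesis cD : countable_dense01 D.

(** The functionals without jump at [t] form a subspace, closed by [jump_bound], which contains the
    generators because [t] is not an end point. *)
Lemma jump_span phi (t : R) : 0 <= t <= 1 -> ~ D t -> csub_set (interval_span j D) phi ->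
  jump j phi t = 0.
Proof.
move=> t01 nDt Yphi; pose Z : set (dual JF) := [set psi | jump j psi t = 0].
have subZ : is_subspace Z.
  split=> [|a psi psi']; first by apply: ulimE; exact: cvg_cst.
  by rewrite /Z/= (jump_linear symN jJF)// => -> ->; rewrite mulr0 addr0.
have closedZ : closed Z.
  move=> psi clZ; apply/eqP; rewrite -normr_le0; apply/ler_addgt0Pr => eps eps0; rewrite add0r.
  pose K := 4 * lnorm [:: 1] + 1.
  have K0 : 0 < K by rewrite ltr_wpDl// mulr_ge0// ltW.
  have d0 : 0 < eps / K by rewrite divr_gt0.
  have [psi' [Zpsi']] := clZ _ (nbhsx_ballx psi _ d0).
  rewrite -ball_normE/= => hpsi.
  have E : jump j psi t = jump j (psi - psi') t.
    have := jump_linear symN jJF 1 (psi - psi') psi' t01.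
    by rewrite scale1r subrK mul1r => ->; rewrite Zpsi' addr0.
  have := jump_bound symN jJF (psi - psi') (ts := [:: t]) (fun=> 1) isT.
  rewrite big_seq1 mul1r -E /= => h; apply: le_trans (h _) _.
    by move=> t'; rewrite inE => /eqP->.
  rewrite mulrAC; apply: (@le_trans _ _ (K * `|psi - psi'|)).
    by rewrite ler_wpM2r// lerDl.
  by rewrite mulrC -ler_pdivlMr// ltW.
apply: (Yphi (ClosedSubspace subZ closedZ)) => psi [a [b [l [r [Da Db ab hpsi]]]]] /=.
have [D01 _ _] := cD.
have /andP[a0 a1] : 0 < a < 1 by have := D01 _ Da; rewrite /= in_itv.
have /andP[b0 b1] : 0 < b < 1 by have := D01 _ Db; rewrite /= in_itv.
rewrite /Z/= (jump_itv (p := a) (q := b) t01)//; try exact: ltW.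
  have ntD x : D x -> (t == x) = false by move=> Dx; apply/eqP => tx; rewrite tx in nDt.
  by rewrite !ntD// subrr.
by move=> f; rewrite hpsi (prim_itv _ _ (L1_int01 f))// ltW.
Qed.

Lemma pick_interval (t delta : R) : 0 <= t <= 1 -> 0 < delta -> exists J : R * R,
  [/\ in01 J, J.1 < J.2, t - delta < J.1, J.2 < t + delta &
      (J.1 = t /\ D J.2) \/ (J.2 = t /\ D J.1)].
Proof.
move=> /andP[t0 t1] delta0; have [t1'|t1'] := ltP t 1.
  have m1 : t < Num.min (t + delta) 1 by rewrite lt_min t1' ltrDl delta0.
  have [a Da /andP[ta]] := dense_between cD t0 m1 (ltac:(by rewrite ge_min lexx orbT)).
  rewrite lt_min => /andP[a1 a2]; exists (t, a); split=> //=; last by left.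
    by rewrite /in01/= t0 !ltW.
  by rewrite ltrBlDr ltrDl.
have tE : t = 1 by apply/le_anti; rewrite t1.
have m1 : Num.max (1 - delta) 0 < 1 by rewrite gt_max ltr01 andbT ltrBlDr ltrDl.
have m0 : 0 <= Num.max (1 - delta) 0 by rewrite le_max lexx orbT.
have [a Da /andP[]] := dense_between cD m0 m1 (lexx 1).
rewrite gt_max => /andP[a1 a2] a3; exists (a, 1); rewrite tE; split=> //=; last by right.
  by rewrite /in01/= (ltW a2) (ltW a3) lexx.
by rewrite ltrDl.
Qed.

Variables (W : normedModType R) (kappa : W -> R -> R).
Hypothesis Wkappa : dual_coordinates kappa.
Variable beta : R -> R.
Hypothesis beta_inj : injective beta.
Hypothesis beta01 : forall r, 0 <= beta r <= 1 /\ ~ D (beta r).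
Hypothesis beta_onto : forall t, 0 <= t <= 1 -> ~ D t -> exists r, beta r = t.

Lemma jump_map : exists T : {linear dual JF -> W},
  (forall phi r, kappa (T phi) r = jump j phi (beta r)) /\ forall phi, `|T phi| <= 4 * `|phi|.
Proof.
have [kD kI _ kO] := Wkappa.
have /choice[T hT] phi : exists w, kappa w =1 (fun r => jump j phi (beta r)) /\ `|w| <= 4 * `|phi|.
  have [||w w1 w2] := kO (fun r => jump j phi (beta r)) (4 * `|phi|).
  - by rewrite mulr_ge0.
  - move=> s c us; pose c' t := c (xget 0 [set r | beta r = t]).
    have c'E r : c' (beta r) = c r.
      congr c; apply: beta_inj; apply: (@xgetPex _ 0 [set x | beta x = beta r]).
      by exists r.
    have := jump_bound symN jJF phi (ts := map beta s) c'.
    rewrite map_inj_uniq// => /(_ us); rewrite big_map -map_comp.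
    rewrite (@eq_map _ _ (c' \o beta) c c'E).
    under eq_bigr do rewrite c'E mulrC.
    by apply=> _ /mapP[r _ ->]; have [] := beta01 r.
  - by exists w.
have lT : linear T.
  move=> a phi psi; apply: kI => r; rewrite kD !(hT _).1 (jump_linear symN jJF)//.
  by have [] := beta01 r.
pose L := GRing.isLinear.Build R (dual JF) W _ T lT.
pose TL : {linear dual JF -> W} := HB.pack T L.
by exists TL; split=> phi; [exact: (hT phi).1|exact: (hT phi).2].
Qed.

(** [w'] stands for the image of [phi]. The intervals attached to the points of [A] are shorter than
    half the separation of these points, hence disjoint, so that [phi] inherits the bound of [w].
    The difference [w - w'] has coordinates zero on [A] and those of [w] elsewhere. *)
Lemma jump_onto (w : W) : exists phi, `|phi| <= `|w| /\
  forall w', (forall r, kappa w' r = jump j phi (beta r)) -> `|w - w'| <= `|w| / 2.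
Proof.
have [kD kI kN kO] := Wkappa.
have [->|w0] := eqVneq w 0.
  exists 0; rewrite !normr0; split=> // w' hw'.
  rewrite (_ : w' = 0) ?subr0 ?normr0 ?mul0r//; apply: kI => r.
  rewrite hw' [LHS](_ : _ = 0); last by apply: ulimE; exact: cvg_cst.
  by have := kD 1 0 0 r; rewrite scaler0 addr0 mul1r => /eqP; rewrite -subr_eq subrr => /eqP.
have eps0 : 0 < `|w| / 2 by rewrite divr_gt0// normr_gt0.
have [A0 hA0] := shrinking_family symN shrN (kN w) eps0.
pose A := undup A0.
have uA : uniq A by exact: undup_uniq.
have [d d0 sep] := separation (map beta A).
have /choice[J hJ] (r : R) := pick_interval (beta01 r).1 d0.
have /choice[F hF] (r : R) : exists F : dual JF, forall f, F (j f) = prim f (J r).2 - prim f (J r).1.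
  have [/and3P[J0 J12 J1] _ _ _ _] := hJ r.
  by have [F [hF _]] := itv_functional symN jJF lnorm1_gt0 J0 J12 J1; exists F.
(* The functional of an interval jumps by 1 at the right end and by -1 at the left end. *)
pose sg (r : R) : R := if (J r).2 == beta r then 1 else -1.
have jumpF r r' : jump j (sg r *: F r) (beta r') = (r' == r)%:R.
  have [t01 nD] := beta01 r'; have [/and3P[J0 J12 J1] Jlt _ _ Jt] := hJ r.
  rewrite -[sg r *: F r]addr0 (jump_linear symN jJF)// (jump_itv t01 J0 J12 J1 (hF r)).
  rewrite (_ : jump j 0 _ = 0) ?addr0; last by apply: ulimE; exact: cvg_cst.
  have nb x : D x -> (beta r' == x) = false by move=> Dx; apply/eqP => h; rewrite h in nD.
  rewrite /sg; case: Jt => -[Jt /nb DJ]; rewrite DJ Jt ?eqxx (inj_eq beta_inj).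
    by rewrite -Jt gt_eqF// sub0r mulN1r opprK.
  by rewrite mul1r subr0.
pose phi := \sum_(r <- A) (kappa w r * sg r) *: F r.
have phiE (x : JF) : phi x = \sum_(r <- A) kappa w r * (sg r * F r x).
  rewrite /phi; elim: (A) => [|r s IH]; first by rewrite !big_nil.
  by rewrite !big_cons -IH mulrA.
have jphi r' : jump j phi (beta r') = if r' \in A then kappa w r' else 0.
  have [t01 _] := beta01 r'; rewrite /phi.
  have -> : jump j (\sum_(r <- A) (kappa w r * sg r) *: F r) (beta r') =
      \sum_(r <- A) kappa w r * (r' == r)%:R.
    elim: (A) => [|r s IH]; first by rewrite !big_nil; apply: ulimE; exact: cvg_cst.
    rewrite !big_cons -scalerA (jump_linear symN jJF)// jumpF IH//.
  case: ifPn => rA; last first.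
    rewrite big_seq big1// => r rs; rewrite (_ : _ == _ = false) ?mulr0//.
    by apply: contraNF rA => /eqP->.
  rewrite (bigD1_seq r')//= eqxx mulr1 big1 ?addr0// => r rr'.
  by rewrite eq_sym (negPf rr') mulr0.
exists phi; split.
  apply: (dual_norm_dense jJF.1) => // f; rewrite phiE.
  rewrite (le_trans (kN w A (fun r => sg r * F r (j f)) uA))// ler_wpM2l//.
  have adJ : admissible (map J A).
    apply/andP; split; first by apply/allP => _ /mapP[r _ ->]; have [] := hJ r.
    rewrite pairwise_map; apply: (@sub_in_pairwise _ (mem A) [rel x y | x != y]); last first.
    - by rewrite -uniq_pairwise.
    - exact/allP.
    move=> r r' rA r'A /= rr'.
    have := sep _ _ (map_f beta rA) (map_f beta r'A); rewrite (inj_eq beta_inj) => /(_ rr').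
    have [_ _ a1 a2 _] := hJ r; have [_ _ b1 b2 _] := hJ r'.
    rewrite /itv_disj.
    have [u|u] := leP (beta r) (beta r').
      by rewrite ler0_norm ?subr_le0// => h; apply/orP; left; lra.
    by rewrite gtr0_norm ?subr_gt0// => h; apply/orP; right; lra.
  rewrite (le_trans _ (jf_ge symN jJF f adJ))// -map_comp; apply: (lnorm_map_le symN) => r _.
  rewrite normrM hF /incr /= (_ : `|sg r| = 1) ?mul1r//.
  by rewrite /sg; case: (_ == _); rewrite ?normrN normr1.
move=> w' hw'.
have [||w'' h1 h2] := kO (kappa (w - w')) (`|w| / 2); first exact: ltW.
  move=> s c us; rewrite (bigID (mem A))/= big1 ?add0r => [|r rA]; last first.
    by rewrite addrC -scaleN1r kD hw' jphi rA mulN1r addNr mul0r.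
  rewrite -big_filter.
  have -> : \sum_(r <- [seq r <- s | r \notin A]) kappa (w - w') r * c r =
     \sum_(r <- [seq r <- s | r \notin A]) kappa w r * c r.
    rewrite big_filter [RHS]big_filter; apply: eq_bigr => r /negPf rA.
    by rewrite addrC -scaleN1r kD hw' jphi rA mulr0 add0r.
  rewrite (le_trans (hA0 _ c (filter_uniq _ us) _))//.
    by move=> r; rewrite mem_filter mem_undup => /andP[].
  by rewrite ler_wpM2l ?(ltW eps0)// (lnorm_filter_le symN).
by rewrite -(kI _ _ h1).
Qed.

Lemma quotient_coordinates : isomorphic (quotient (interval_span j D)) W.
Proof.
have [kD kI kN kO] := Wkappa.
have [T [hT TN]] := jump_map.
have four : 0 <= 4 :> R by [].
have k0 r : kappa 0 r = 0.
  by have := kD 1 0 0 r; rewrite scaler0 addr0 mul1r => /eqP; rewrite -subr_eq subrr => /eqP.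
apply: (@quotient_isomorphic _ _ _ _ T 4 2) => //.
- move=> phi; split=> [T0|Yphi].
    apply: (kernel_span symN jJF lnorm1_gt0 shrN unbN cD) => t t01.
    have [Dt|nDt] := pselect (D t); [by left|right].
    by have [r <-] := beta_onto t01 nDt; rewrite -hT T0 k0.
  apply: kI => r; rewrite hT k0; have [t01 nDt] := beta01 r.
  exact: jump_span.
- move=> w; have [|phi [h1 h2]] := @approx_onto _ _ _ T 4 1 four ler01 TN _ w.
    move=> w1; have [phi [p1 p2]] := jump_onto w1; exists phi; rewrite mul1r; split=> //.
    exact: p2.
  by exists phi; rewrite mulr1 in h2.
Qed.

End Onto.

(** * Symmetric bases of reflexive spaces and of l2 *)

Section SymmetricBasisNorm.
Variables (R : realType) (X : normedModType R) (e : nat -> X).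
Hypothesis symE : symmetric_basis e.
Local Notation lnorm := (lnorm e).

Lemma symmetric_basis_lnorm : symmetric_lnorm e.
Proof.
have [_ inv] := symE; split=> [c d|a c]; last first.
  rewrite /lnorm /= -(inv _ (fun i => (a :: c)`_i) (fun i => i == 0%N) id); last by exists id.
  congr `|_|; apply: eq_bigr => -[[|i] ilt] _ //=; first by rewrite expr1 mulN1r.
  by rewrite expr0 mul1r.
move=> cd; have sz := perm_size cd; have [Is pI ->] := perm_iotaP 0 cd.
set n := size d in pI *; have sI : size Is = n by rewrite (perm_size pI) size_iota.
have uI : uniq Is by rewrite (perm_uniq pI) iota_uniq.
have memI k : (k \in Is) = (k < n)%N by rewrite (perm_mem pI) mem_iota add0n.
(* The inverse of the rearrangement, extended by the identity to a bijection of [nat]. *)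
pose q k := if (k < n)%N then index k Is else k.
pose p i := if (i < n)%N then nth 0%N Is i else i.
have bij_q : bijective q.
  exists p => k; rewrite /q /p.
    case: (ltnP k n) => kn; last by rewrite ltnNge kn.
    by rewrite -{1}sI index_mem memI kn nth_index// memI.
  case: (ltnP k n) => kn; last by rewrite ltnNge kn.
  by rewrite -memI mem_nth ?sI// index_uniq// sI.
rewrite /lnorm size_map sI -(inv n (fun k => d`_k) (fun=> false) q bij_q).
congr `|_|.
transitivity (\sum_(k <- Is) d`_k *: e (q k)).
  rewrite (big_nth 0%N) sI big_mkord; apply: eq_bigr => i _.
  rewrite (nth_map 0%N) ?sI// /q -memI mem_nth ?sI// index_uniq ?sI//.
rewrite (perm_big _ pI)/= -/(index_iota 0 n) -[n in iota 0 n]subn0 -/(index_iota 0 n) big_mkord.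
by apply: eq_bigr => i _; rewrite expr0 mul1r.
Qed.

(** If [e 0] were zero, the vector 0 would have two expansions. *)
Lemma symmetric_basis_neq0 : 0 < lnorm [:: 1].
Proof.
have [sb _] := symE; rewrite lt_neqAle lnorm_ge0 andbT eq_sym /lnorm big_ord1 scale1r normr_eq0.
apply/eqP => e0; have [a [_ ua]] := sb 0.
have c0 : series (fun n => (0 : R) *: e n) @ \oo --> (0 : X).
  rewrite (_ : series _ = fun=> 0); first exact: cvg_cst.
  by apply/funext => n; rewrite /series/= big1// => i _; rewrite scale0r.
have c1 : series (fun n => ((n == 0%N)%:R : R) *: e n) @ \oo --> (0 : X).
  rewrite (_ : series _ = fun=> 0); first exact: cvg_cst.
  by apply/funext => n; rewrite /series/= big1// => -[|i] _; rewrite ?e0 ?scaler0 ?scale0r.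
have := congr1 (fun a => a 0%N) (etrans (esym (ua _ c0)) (ua _ c1)).
by move=> /eqP; rewrite eqxx eq_sym oner_eq0.
Qed.

Let symN := symmetric_basis_lnorm.

(** By symmetry the norms of the partial sums increase, so the norm of the limit bounds them; the
    coordinates are therefore continuous. *)
Lemma basis_coordinates : exists a : X -> nat -> R,
  [/\ forall x, (fun n => \sum_(i < n) a x i *: e i) @ \oo --> x,
      forall (c : R) x y i, a (c *: x + y) i = c * a x i + a y i,
      forall n (d : nat -> R) i, a (\sum_(k < n) d k *: e k) i = if (i < n)%N then d i else 0 &
      forall x n, lnorm (mkseq (a x) n) <= `|x|].
Proof.
have [sb _] := symE; have /choice[a ha] := sb.
have ac x : (fun n => \sum_(i < n) a x i *: e i) @ \oo --> x.
  have [h _] := ha x; rewrite (_ : (fun n => _) = series (fun i => a x i *: e i))//.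
  by apply/funext => n; rewrite /series/= big_mkord.
have au x (b : nat -> R) : (fun n => \sum_(i < n) b i *: e i) @ \oo --> x -> a x = b.
  move=> h; have [_] := ha x; apply.
  rewrite (_ : series _ = (fun n => \sum_(i < n) b i *: e i))//.
  by apply/funext => n; rewrite /series/= big_mkord.
exists a; split=> //.
- move=> c x y i; rewrite (au _ (fun i => c * a x i + a y i))//.
  rewrite (_ : (fun n => _) = (fun n => c *: (\sum_(i < n) a x i *: e i) + \sum_(i < n) a y i *: e i)).
    by apply: cvgD => //; apply: cvgZl_tmp.
  apply/funext => n; rewrite scaler_sumr -big_split/=; apply: eq_bigr => k _.
  by rewrite scalerDl scalerA.
- move=> n d i; rewrite (au _ (fun i => if (i < n)%N then d i else 0))//.
  apply: cvg_near_cst; exists n => // m /= nm.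
  rewrite [RHS](big_ord_widen_cond _ xpredT (fun i => d i *: e i) nm) [RHS]big_mkcond/=.
  by apply: eq_bigr => k _; case: ifP => // _; rewrite scale0r.
- move=> x n; have cn : (fun m => `|\sum_(i < m) a x i *: e i|) @ \oo --> `|x|.
    exact: cvg_norm.
  rewrite -(cvg_lim _ cn)//; apply: limr_ge; first by apply/cvg_ex; exists `|x|.
  exists n => // m /= nm; rewrite -lnorm_mkseq; exact: lnorm_mkseq_mono.
Qed.

Hypothesis refX : reflexive_space X.

(* Reflexivity is only used through: a bounded sequence has a vector on which every functional
   takes its limit along the ultrafilter. *)
Lemma reflexive_ulim (y : nat -> X) (C : R) : (forall n, `|y n| <= C) ->
  exists x : X, forall phi : dual X, phi x = ulim (fun n => phi (y n)).
Proof.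
move=> yC; have C0 : 0 <= C by rewrite (le_trans _ (yC 0%N)).
have b (phi : dual X) : bounded_seq (fun n => phi (y n)).
  by exists (`|phi| * C) => n; rewrite (le_trans (dual_norm_bound _ _))// ler_wpM2l.
have [||F [hF _]] := @mk_dual R (dual X) (fun phi => ulim (fun n => phi (y n))) C C0.
- move=> a phi psi; rewrite -ulimZ// -ulimD//.
  by apply: bounded_seqM => //; exact: bounded_seq_cst.
- move=> phi; apply: ulim_norm_le_all => n.
  by rewrite mulrC (le_trans (dual_norm_bound _ _))// ler_wpM2l.
by have [x hx] := refX F; exists x => phi; rewrite -hx hF.
Qed.

(** The value at [x] is the ultralimit of the partial sums of [alpha i * a x i], which are bounded
    by [M * |x|] and eventually constant on finite combinations. *)
Lemma sequence_functional (alpha : nat -> R) (M : R) :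
  (forall n (d : nat -> R), `|\sum_(i < n) alpha i * d i| <= M * lnorm (mkseq d n)) ->
  exists phi : dual X, forall n (d : nat -> R),
    phi (\sum_(k < n) d k *: e k) = \sum_(k < n) alpha k * d k.
Proof.
move=> aM; have [a [ac al ad an]] := basis_coordinates.
have M0 : 0 <= M.
  have := aM 1%N (fun=> 1); rewrite big_ord1 => /(le_trans (normr_ge0 _)).
  by rewrite pmulr_lge0// symmetric_basis_neq0.
have b x : bounded_seq (fun n => \sum_(i < n) alpha i * a x i).
  by exists (M * `|x|) => n; rewrite (le_trans (aM _ _))// ler_wpM2l.
have [||phi [hphi _]] := @mk_dual R X (fun x => ulim (fun n => \sum_(i < n) alpha i * a x i)) M M0.
- move=> c x y; rewrite -ulimZ// -ulimD//; last by apply: bounded_seqM => //; exact: bounded_seq_cst.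
  congr ulim; apply/funext => n; rewrite mulr_sumr -big_split/=; apply: eq_bigr => i _.
  by rewrite al; ring.
- by move=> x; apply: ulim_norm_le_all => n; rewrite (le_trans (aM _ _))// ler_wpM2l.
exists phi => n d; rewrite hphi; apply: (ulim_eventually (N := n)) => m nm.
under eq_bigr do rewrite ad.
rewrite [RHS](big_ord_widen_cond _ xpredT (fun i => alpha i * d i) nm) [RHS]big_mkcond/=.
by apply: eq_bigr => k _; case: ifP => // _; rewrite mulr0.
Qed.

Lemma coordinate_functional k : exists phi : dual X, forall n (d : nat -> R),
  phi (\sum_(i < n) d i *: e i) = if (k < n)%N then d k else 0.
Proof.
have sE n (d : nat -> R) : \sum_(i < n) (i == k :> nat)%:R * d i = if (k < n)%N then d k else 0.
  case: ltnP => kn.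
    rewrite (bigD1 (Ordinal kn))//= eqxx mul1r big1 ?addr0// => i ik.
    by rewrite (_ : (i == k :> nat) = false) ?mul0r//; apply: contraNF ik => /eqP ik; apply/eqP/val_inj.
  rewrite big1// => i _; rewrite (_ : (i == k :> nat) = false) ?mul0r//.
  by apply/eqP => ik; have := ltn_ord i; rewrite ik ltnNge kn.
have [n d|phi hphi] := @sequence_functional (fun i => (i == k)%:R) (lnorm [:: 1])^-1.
  rewrite sE; case: ltnP => kn; last by rewrite normr0 mulr_ge0 ?invr_ge0 ?lnorm_ge0.
  rewrite mulrC ler_pdivlMr ?symmetric_basis_neq0// mulrC -lnorm1Z//.
  have -> : [:: d k] = map d [seq i <- iota 0 n | i == k].
    by rewrite (filter_pred1_uniq (iota_uniq 0 n)) ?mem_iota.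
  exact: lnorm_filter_le.
by exists phi => n d; rewrite hphi sE.
Qed.

Lemma coordinates_determined (x x' : X) :
  (forall k, exists phi : dual X, (forall n (d : nat -> R),
    phi (\sum_(i < n) d i *: e i) = if (k < n)%N then d k else 0) /\ phi x = phi x') -> x = x'.
Proof.
move=> h; have [a [ac _ _ _]] := basis_coordinates.
have aE y k (phi : dual X) : (forall n (d : nat -> R),
    phi (\sum_(i < n) d i *: e i) = if (k < n)%N then d k else 0) -> phi y = a y k.
  move=> hphi; have cphi : (fun n => phi (\sum_(i < n) a y i *: e i)) @ \oo --> phi y.
    by apply: continuous_cvg; [exact: dual_continuous|exact: ac].
  apply: (cvg_unique _ cphi) => //; apply: cvg_near_cst; exists k.+1 => // n /= kn.
  by rewrite hphi kn.
have E : a x = a x' by apply/funext => k; have [phi [h1 h2]] := h k; rewrite -!(aE _ _ _ h1).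
by have := ac x'; rewrite -E; exact: cvg_unique (ac x).
Qed.

(** Otherwise there are vectors in the unit ball, supported ever further out, on which [phi] is at
    least [eps]. Their weak limit along the ultrafilter has zero coordinates, so it is 0, yet [phi]
    is at least [eps] there. *)
Lemma reflexive_shrinking : shrinking_lnorm e.
Proof.
move=> alpha M aM eps eps0; apply: contrapT => hn.
have /choice[nd hnd] (J : nat) : exists nd : nat * (nat -> R),
    (forall i, (i < J)%N -> nd.2 i = 0) /\
    eps * lnorm (mkseq nd.2 nd.1) < `|\sum_(i < nd.1) alpha i * nd.2 i|.
  apply: contrapT => hJ; apply: hn; exists J => n d dJ; rewrite leNgt; apply/negP => h.
  by apply: hJ; exists (n, d).
have [phi hphi] := sequence_functional aM.
pose v J := \sum_(i < (nd J).1) (nd J).2 i *: e i.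
have vN J : `|v J| = lnorm (mkseq (nd J).2 (nd J).1) by rewrite lnorm_mkseq.
have phiv J : eps * `|v J| < `|phi (v J)| by rewrite vN hphi; have [] := hnd J.
have v0 J : 0 < `|v J|.
  rewrite lt_neqAle normr_ge0 andbT; apply/eqP => h; have := phiv J.
  by rewrite ltNge (le_trans (dual_norm_bound _ _))// -h !mulr0.
pose c J := `|v J|^-1 * Num.sg (phi (v J)).
have cv1 J : `|c J *: v J| <= 1.
  rewrite normrZ /c normrM normfV normr_id normr_sg -mulrA ler_pdivrMl// mulr1.
  by rewrite ler_piMl//; case: (_ != 0).
have [x hx] := reflexive_ulim cv1.
have x0 : x = 0.
  apply: coordinates_determined => k; have [psi hpsi] := coordinate_functional k.
  exists psi; split=> //; rewrite linear0 hx; apply: (ulim_eventually (N := k.+1)) => J kJ.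
  rewrite dualZ hpsi; case: ifP => _; last by rewrite mulr0.
  by have [-> //] := hnd J; rewrite mulr0.
have := hx phi; rewrite x0 linear0 => h.
suff : eps <= ulim (fun n => phi (c n *: v n)) by rewrite -h leNgt eps0.
rewrite -[eps]ulim_cst; apply: ulim_le_all; first exact: bounded_seq_cst.
  by exists (`|phi| * 1) => n; rewrite (le_trans (dual_norm_bound _ _))// ler_wpM2l.
move=> J; rewrite dualZ /c -mulrA -normrEsg mulrC ler_pdivlMr//; exact: ltW.
Qed.

(** If the partial sums of the basis vectors were bounded, they would have a weak limit with all
    coordinates 1. Its expansion converges, so [e n] tends to 0, whereas [|e n|] is at least [lnorm
    [:: 1]]. *)
Lemma reflexive_unbounded : lnorm_unbounded e.
Proof.
move=> C; apply: contrapT => hn.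
pose y n := \sum_(i < n) (1 : R) *: e i.
have yN n : `|y n| <= C.
  rewrite leNgt; apply/negP => h; apply: hn; exists n.
  rewrite (_ : nseq n 1 = mkseq (fun=> 1) n) ?lnorm_mkseq//.
  by apply: (@eq_from_nth _ 0); rewrite ?size_nseq ?size_mkseq// => i ik; rewrite nth_nseq ik nth_mkseq.
have [x hx] := reflexive_ulim yN; have [a [ac _ _ an]] := basis_coordinates.
have ax k : a x k = 1.
  have [psi hpsi] := coordinate_functional k.
  have h1 : psi x = a x k.
    have cpsi : (fun n => psi (\sum_(i < n) a x i *: e i)) @ \oo --> psi x.
      by apply: continuous_cvg; [exact: dual_continuous|exact: ac].
    apply: (cvg_unique _ cpsi) => //; apply: cvg_near_cst; exists k.+1 => // n /= kn.
    by rewrite hpsi kn.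
  rewrite -h1 hx; apply: (ulim_eventually (N := k.+1)) => n kn.
  by rewrite (hpsi n (fun=> 1)) kn.
have cy : y @ \oo --> x.
  rewrite (_ : y = (fun n => \sum_(i < n) a x i *: e i)); first exact: ac.
  by apply/funext => n; apply: eq_bigr => i _; rewrite ax.
have cS : (fun n => y n.+1 - y n) @ \oo --> (0 : X).
  by rewrite -[X in _ --> X](subrr x); apply: cvgB => //; rewrite (cvg_shiftS y).
have /cvgr0Pnorm_lt/(_ _ symmetric_basis_neq0)[N _ /(_ N (leqnn N))] := cS.
rewrite /= /y big_ord_recr/= addrAC subrr add0r.
have -> : `|1 *: e N| = lnorm (mkseq (fun i => (i == N)%:R) N.+1).
  rewrite lnorm_mkseq big_ord_recr/= eqxx big1 ?add0r// => i _.
  by rewrite (ltn_eqF (ltn_ord i)) scale0r.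
have -> : lnorm [:: 1] = lnorm (map (fun i => (i == N)%:R) [seq i <- iota 0 N.+1 | i == N]).
  by rewrite (filter_pred1_uniq (iota_uniq 0 _)) ?mem_iota//= eqxx.
by rewrite ltNge lnorm_filter_le.
Qed.

End SymmetricBasisNorm.

(** * The dual of X_Gamma *)

Section FinitelySupportedDual.
Variables (R : realType) (X : normedModType R) (e : nat -> X).
Variables (XR : completeNormedModType R) (u : {linear c00 R R -> XR}).
Hypothesis XRu : is_XGamma e u.
Local Notation lnorm := (lnorm e).

Lemma c00_support (f : c00 R R) : exists2 s : seq R, uniq s & forall r, f r != 0 -> r \in s.
Proof.
have /asboolP/finite_seqP[s hs] := valP f; exists (undup s); first exact: undup_uniq.
by move=> r fr; rewrite mem_undup; have : [set r | f r != 0] r by []; rewrite hs.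
Qed.

Lemma c00_expand (f : c00 R R) (s : seq R) : uniq s -> (forall r, f r != 0 -> r \in s) ->
  f = \sum_(r <- s) f r *: c00_unit R r.
Proof.
move=> us fs; apply/val_inj/funext => g /=.
have -> (t : seq R) : c00_fun (\sum_(r <- t) f r *: c00_unit R r) g = \sum_(r <- t) f r * (g == r)%:R.
  elim: t => [|r t IH]; first by rewrite !big_nil.
  by rewrite !big_cons -IH.
have [gs|gs] := boolP (g \in s); last first.
  rewrite big_seq big1 => [|r rs]; first by apply/eqP; apply: contraNT gs; exact: fs.
  by rewrite (_ : (g == r) = false) ?mulr0//; apply: contraNF gs => /eqP->.
rewrite (bigD1_seq g)//= eqxx mulr1 big1 ?addr0// => r rg.
by rewrite eq_sym (negPf rg) mulr0.
Qed.

Lemma XGamma_lnorm (s : seq R) (c : R -> R) : uniq s ->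
  `|u (\sum_(r <- s) c r *: c00_unit R r)| = lnorm (map c s).
Proof.
move=> us; rewrite (big_nth 0) big_mkord (lnorm_map_nth _ 0).
rewrite (XRu.2 (size s) (fun i => s`_i) (fun i => c s`_i))//.
by move=> i k /eqP; rewrite nth_uniq// => /eqP/val_inj.
Qed.

Lemma dual_XGamma_coordinates :
  dual_coordinates e (fun (w : dual XR) (r : R) => w (u (c00_unit R r))).
Proof.
have [du _] := XRu.
have sumE (w : dual XR) (s : seq R) (c : R -> R) :
    w (u (\sum_(r <- s) c r *: c00_unit R r)) = \sum_(r <- s) w (u (c00_unit R r)) * c r.
  elim: s => [|r s IH]; first by rewrite !big_nil linear0 linear0.
  by rewrite !big_cons linearD dualD IH [u (_ *: _)]linearZ dualZ mulrC.
split=> // [w w' ww'|w s c us|g M M0 gM].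
- apply/eqP; rewrite -subr_eq0 -normr_le0; apply: (dual_norm_dense du) => // f.
  rewrite mul0r; have [s us fs] := c00_support f.
  rewrite [f](c00_expand us fs) sumE big1 ?normr0// => r _.
  by rewrite [X in X * _](_ : _ = w (u (c00_unit R r)) - w' (u (c00_unit R r)))// ww' subrr mul0r.
- by rewrite -sumE (le_trans (dual_norm_bound _ _))// XGamma_lnorm.
have /choice[S hS] (f : c00 R R) : exists s : seq R, uniq s /\ forall r, f r != 0 -> r \in s.
  by have [s ? ?] := c00_support f; exists s.
pose l (f : c00 R R) := \sum_(r <- S f) g r * f r.
(* Any list containing the support gives the same value, so linearity can be checked on a common
   list. *)
have lE (f : c00 R R) (s : seq R) : uniq s -> (forall r, f r != 0 -> r \in s) ->
    l f = \sum_(r <- s) g r * f r.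
  move=> us fs; have [uS fS] := hS f.
  have filt t : \sum_(r <- t) g r * f r = \sum_(r <- [seq r <- t | f r != 0]) g r * f r.
    rewrite big_filter [RHS]big_mkcond; apply: eq_bigr => r _.
    by case: eqP => // ->; rewrite mulr0.
  rewrite /l filt [RHS]filt; apply: perm_big; apply: uniq_perm; rewrite ?filter_uniq// => r.
  by rewrite !mem_filter; case: eqP => //= /eqP h; rewrite fS ?fs.
have [||w [hw wM]] := @dense_extend _ _ _ u l M du M0.
- move=> a f h; pose s := undup (S f ++ S h).
  have us : uniq s by exact: undup_uniq.
  have fs r : f r != 0 -> r \in s.
    by move=> /(hS f).2 rf; rewrite mem_undup mem_cat rf.
  have hs r : h r != 0 -> r \in s.
    by move=> /(hS h).2 rf; rewrite mem_undup mem_cat rf orbT.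
  have afhs r : (a *: f + h) r != 0 -> r \in s.
    have [/eqP fr|/fs//] := boolP (f r == 0); have [/eqP hr|/hs//] := boolP (h r == 0).
    by rewrite [(a *: f + h) r](_ : _ = a * f r + h r)// fr hr mulr0 addr0 eqxx.
  rewrite !(lE _ s)// mulr_sumr -big_split/=; apply: eq_bigr => r _.
  transitivity (g r * (a * f r + h r)); first by [].
  ring.
- move=> f; have [uS fS] := hS f; rewrite (le_trans (gM _ _ uS))// ler_wpM2l//.
  by rewrite -(XGamma_lnorm f uS) -(c00_expand uS fS).
exists w => // r; rewrite hw (lE _ [:: r])//; last first.
  by move=> r'; rewrite inE; apply: contraNT => /negPf rr; rewrite /= rr.
by rewrite big_seq1 /= eqxx mulr1.
Qed.

End FinitelySupportedDual.

(** * The case of l2 *)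

Section SquareSummableCoordinates.
Variable R : realType.
Implicit Types (s : seq R).

Lemma l2_norm_finite (G : choiceType) (f : l2 R G) (s : seq G) : uniq s ->
  (forall g, f g != 0 -> g \in s) -> `|f| = Num.sqrt (\sum_(g <- s) f g ^+ 2).
Proof.
move=> us fs; rewrite [`|f|]/(l2_norm f) /l2_norm; congr (Num.sqrt _).
rewrite /sqsum (_ : (\esum_(g in [set: G]) _)%E = (\esum_(g in [set` s]) (f g ^+ 2)%:E)%E).
  rewrite esum_fset//; last by move=> g _; rewrite lee_fin sqr_ge0.
  by rewrite -fsbig_seq// sumEFin.
rewrite [RHS]esum_mkcond; apply: eq_esum => g _; case: ifPn => // /negP h.
apply/eqP; rewrite eqe sqrf_eq0; apply/negPn/negP => /fs gs; apply: h.
exact/mem_set.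
Qed.

Lemma l2_norm_ge (G : choiceType) (f : l2 R G) (s : seq G) : uniq s ->
  Num.sqrt (\sum_(g <- s) f g ^+ 2) <= `|f|.
Proof.
move=> us; rewrite [`|f|]/(l2_norm f) -(@ler_pXn2r _ 2) ?nnegrE ?sqrtr_ge0//.
rewrite sqr_sqrtr; last by apply: sumr_ge0 => g _; exact: sqr_ge0.
rewrite -lee_fin -sqsum_l2_norm -sumEFin fsbig_seq//.
by apply: ereal_sup_ubound; exists [set` s].
Qed.

Lemma l2_unit_lnorm (c : seq R) : lnorm (@l2_unit R nat) c = Num.sqrt (\sum_(x <- c) x ^+ 2).
Proof.
rewrite /lnorm; set f := \sum_(i < _) _.
have fE k : (f : l2 R nat) k = c`_k.
  rewrite /f; have -> n (d : nat -> R) : (\sum_(i < n) d i *: l2_unit R (i : nat) : l2 R nat) k =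
      \sum_(i < n) d i * (k == i)%:R.
    elim: n => [|n IH]; first by rewrite !big_ord0.
    by rewrite !big_ord_recr -IH.
  have [kc|ck] := ltnP k (size c).
    rewrite (bigD1 (Ordinal kc))//= eqxx mulr1 big1 ?addr0// => i ik.
    rewrite (_ : (k == i :> nat) = false) ?mulr0//.
    by apply: contraNF ik => /eqP ik; apply/eqP/val_inj.
  rewrite nth_default// big1// => i _; rewrite (_ : (k == i :> nat) = false) ?mulr0//.
  by apply/eqP => ki; have := ltn_ord i; rewrite -ki ltnNge ck.
rewrite (@l2_norm_finite _ f (iota 0 (size c))) ?iota_uniq//; last first.
  by move=> k; rewrite fE mem_iota add0n ltnNge; apply: contraNN => ck; rewrite nth_default.
congr Num.sqrt; under eq_bigr do rewrite fE.
by rewrite [RHS](big_nth 0) /index_iota subn0.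
Qed.

Lemma cauchy_schwarz (T : Type) (s : seq T) (a b : T -> R) :
  `|\sum_(i <- s) a i * b i| <= Num.sqrt (\sum_(i <- s) a i ^+ 2) * Num.sqrt (\sum_(i <- s) b i ^+ 2).
Proof.
set A := \sum_(i <- s) a i ^+ 2; set B := \sum_(i <- s) b i ^+ 2; set S := \sum_(i <- s) _.
have A0 : 0 <= A by apply: sumr_ge0 => i _; exact: sqr_ge0.
have B0 : 0 <= B by apply: sumr_ge0 => i _; exact: sqr_ge0.
rewrite -sqrtrM// -sqrtr_sqr ler_wsqrtr//.
have E x y : \sum_(i <- s) (x * a i - y * b i) ^+ 2 = x ^+ 2 * A - 2 * x * y * S + y ^+ 2 * B.
  rewrite /A /B /S !mulr_sumr -sumrB -big_split/=; apply: eq_bigr => i _; ring.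
have P x y : 0 <= x ^+ 2 * A - 2 * x * y * S + y ^+ 2 * B.
  by rewrite -E; apply: sumr_ge0 => i _; exact: sqr_ge0.
have [B00|Bn0] := eqVneq B 0.
  have [->|Sn0] := eqVneq S 0; first by rewrite expr0n/= mulr_ge0.
  (* With [B = 0] the quadratic form takes here the value [A - 2 * (A + 1)], which is negative. *)
  exfalso; have := P 1 ((A + 1) / S).
  by rewrite B00 mulr0 addr0 mulr1 -mulrA divfK//; lra.
have Bgt : 0 < B by rewrite lt_neqAle eq_sym Bn0.
have := P B S; rewrite (_ : _ + _ = B * (A * B - S ^+ 2)); last by ring.
by rewrite pmulr_rge0// subr_ge0.
Qed.

Lemma l2_unit_symmetric : symmetric_lnorm (@l2_unit R nat).
Proof.
split=> [c d cd|a c]; first by rewrite !l2_unit_lnorm (perm_big _ cd).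
by rewrite !l2_unit_lnorm !big_cons sqrrN.
Qed.

Lemma l2_unit_neq0 : 0 < lnorm (@l2_unit R nat) [:: 1].
Proof. by rewrite l2_unit_lnorm big_seq1 expr1n sqrtr1. Qed.

Lemma l2_unit_unbounded : lnorm_unbounded (@l2_unit R nat).
Proof.
move=> C; have [n hn] : exists n : nat, C ^+ 2 < n%:R.
  by exists (Num.truncn (C ^+ 2)).+1; exact: truncnS_gt.
exists n; rewrite l2_unit_lnorm big_nseq expr1n iter_addr addr0.
by rewrite (le_lt_trans (ler_norm C))// -sqrtr_sqr ltr_sqrt// (le_lt_trans (sqr_ge0 _) hn).
Qed.

(* Testing a bounded functional on its own coefficients shows that they are square summable. *)
Lemma sum_sqr_le (T : Type) (s : seq T) (g : T -> R) (M : R) : 0 <= M ->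
  `|\sum_(i <- s) g i * g i| <= M * Num.sqrt (\sum_(i <- s) g i ^+ 2) ->
  Num.sqrt (\sum_(i <- s) g i ^+ 2) <= M.
Proof.
move=> M0; under eq_bigr do rewrite -expr2.
set S := \sum_(i <- s) _; have S0 : 0 <= S by apply: sumr_ge0 => i _; exact: sqr_ge0.
rewrite ger0_norm//; have := sqrtr_ge0 S; rewrite le_eqVlt => /predU1P[<-//|q0].
by rewrite -{1}(sqr_sqrtr S0) expr2 ler_pM2r.
Qed.

(** The partial sums of [alpha i ^+ 2] are bounded by [M ^+ 2]; [J] is where they come within
    [eps ^+ 2] of their supremum, and Cauchy-Schwarz handles the tail. *)
Lemma l2_unit_shrinking : shrinking_lnorm (@l2_unit R nat).
Proof.
move=> alpha M aM eps eps0.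
pose S n := \sum_(0 <= i < n) alpha i ^+ 2.
have M0 : 0 <= M.
  have := aM 1%N (fun=> 1); rewrite big_ord1 => /(le_trans (normr_ge0 _)).
  by rewrite /mkseq/= pmulr_lge0// l2_unit_neq0.
have SM n : S n <= M ^+ 2.
  have S0 : 0 <= S n by apply: sumr_ge0 => i _; exact: sqr_ge0.
  rewrite -(sqr_sqrtr S0) ler_pXn2r ?nnegrE ?sqrtr_ge0//.
  apply: sum_sqr_le => //; have := aM n alpha.
  by rewrite l2_unit_lnorm big_map /S /index_iota subn0 -(big_mkord xpredT (fun i => alpha i * alpha i)) /index_iota subn0.
have hS : has_sup (range S) by split; [exists (S 0%N), 0%N|exists (M ^+ 2) => _ [n _ <-]].
have [_ [J _ <-] hJ] := sup_adherent (exprn_gt0 2 eps0) hS.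
exists J => n d dJ.
have [nJ|Jn] := leqP n J.
  rewrite big1 ?normr0 ?mulr_ge0 ?lnorm_ge0 ?ltW// => i _.
  by rewrite dJ ?mulr0// (leq_trans (ltn_ord i)).
rewrite l2_unit_lnorm big_map -(big_mkord xpredT (fun i => alpha i * d i)) -[n in iota 0 n]subn0.
rewrite -/(index_iota 0 n) (big_cat_nat (leq0n J) (ltnW Jn))//= big_nat big1 ?add0r; last first.
  by move=> i /dJ->; rewrite mulr0.
rewrite (le_trans (cauchy_schwarz _ _ _))// ler_pM ?sqrtr_ge0//; last first.
  rewrite ler_wsqrtr// [leRHS](big_cat_nat (leq0n J) (ltnW Jn))//= lerDr.
  by apply: sumr_ge0 => i _; exact: sqr_ge0.
rewrite -(ger0_norm (ltW eps0)) -sqrtr_sqr ler_wsqrtr//.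
have := sup_upper_bound hS (imageT S n); rewrite {1}/S (big_cat_nat (leq0n J) (ltnW Jn))//= -/(S J).
move: hJ; lra.
Qed.

(** Self-duality of l2: Cauchy-Schwarz one way, testing a bounded family on itself the other way. *)
Lemma l2_dual_coordinates : dual_coordinates (@l2_unit R nat) (fun (w : l2 R R) (r : R) => w r).
Proof.
split=> // [w w' ww'|w s c us|g M M0 gM].
- by apply/val_inj/funext => r; exact: ww'.
- rewrite l2_unit_lnorm big_map (le_trans (cauchy_schwarz _ _ _))// ler_wpM2r ?sqrtr_ge0//.
  exact: l2_norm_ge.
have gs s : uniq s -> \sum_(r <- s) g r ^+ 2 <= M ^+ 2.
  move=> us; have S0 : 0 <= \sum_(r <- s) g r ^+ 2 by apply: sumr_ge0 => i _; exact: sqr_ge0.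
  rewrite -(sqr_sqrtr S0) ler_pXn2r ?nnegrE ?sqrtr_ge0//; apply: sum_sqr_le => //.
  by have := gM s g us; rewrite l2_unit_lnorm big_map.
have gM2 : (sqsum g <= (M ^+ 2)%:E)%E.
  apply: ge_ereal_sup => _ [A [finA _] <-].
  have [s As] := (finite_seqP A).1 finA.
  rewrite As (_ : [set` s] = [set` undup s]); last by apply/seteqP; split=> x /=; rewrite mem_undup.
  by rewrite -fsbig_seq ?undup_uniq// sumEFin lee_fin gs// undup_uniq.
have gl2 : (g : R -> R^o) \in @square_summable R R by rewrite inE/= (le_lt_trans gM2)// ltry.
exists (L2 gl2) => //; rewrite [`|_|]/(l2_norm _) -(@ler_pXn2r _ 2) ?nnegrE ?l2_norm_ge0//.
by rewrite -lee_fin -sqsum_l2_norm.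
Qed.

End SquareSummableCoordinates.

(** * Equipotence of R with [0,1] minus a countable set *)

Section ComplementOfCountable.
Variable R : realType.
Local Notation mu := (@lebesgue_measure R).

(** Countable sets are null, whereas [0,1] has measure 1. *)
Lemma complement_nonempty (D : set R) : countable D -> exists2 t : R, 0 <= t <= 1 & ~ D t.
Proof.
move=> cD; apply: contrapT => hD.
have D01 : (`[0%R, 1%R]%classic : set R) `<=` D.
  move=> t; rewrite /= in_itv/= => t01; apply: contrapT => nDt; apply: hD.
  by exists t.
have := countable_lebesgue_measure0 (sub_countable (subset_card_le D01) cD).
by rewrite lebesgue_measure_itv/= lte_fin ltr01 oppr0 adde0 => /eqP; rewrite eqe oner_eq0.
Qed.

(* A translation by some theta outside D - D maps D into its complement. *)
Lemma enumerate_complement (D : set R) : countable D -> exists beta : R -> R,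
  [/\ injective beta, forall r, 0 <= beta r <= 1 /\ ~ D (beta r) &
      forall t : R, 0 <= t <= 1 -> ~ D t -> exists r, beta r = t].
Proof.
move=> cD; pose G := [set t : R | 0 <= t <= 1 /\ ~ D t].
pose E := [set 3 * (p.2 - p.1 - 3^-1) | p in D `*` D].
have cE : countable E.
  by apply: sub_countable (card_image_le _ _) _; exact: countableX.
have [t /andP[t0 t1] nEt] := complement_nonempty cE.
pose theta := 3^-1 + t / 3.
have Dtheta x : D x -> ~ D (x + theta).
  move=> Dx Dxt; apply: nEt; exists (x, x + theta) => //=.
  by rewrite /theta; field.
have s01 (x : R) : 0 < (1 + expR x)^-1 < 1.
  rewrite invr_gt0 addr_gt0 ?expR_gt0//=.
  by rewrite invf_lt1 ?ltrDl ?expR_gt0// addr_gt0// expR_gt0.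
have s_inj x y : (1 + expR x)^-1 / 4 = (1 + expR y)^-1 / 4 :> R -> x = y.
  have n4 : 4^-1 != 0 :> R by rewrite invr_eq0 pnatr_eq0.
  by move=> /(mulIf n4)/invr_inj/addrI/expR_inj.
(* Unshifted values lie in (0,1/4) and, as [theta] is between 1/3 and 2/3, shifted ones lie in
   (1/3,11/12): the two kinds never collide. *)
pose f x : R := (1 + expR x)^-1 / 4 + (if (1 + expR x)^-1 / 4 \in D then theta else 0).
have f_inj : injective f.
  move=> x y; rewrite /f; have := s01 x; have := s01 y; rewrite /theta.
  case: ifP => _; case: ifP => _ /andP[a1 a2] /andP[b1 b2] fxy; apply: s_inj; lra.
have fG x : G (f x).
  have := s01 x; rewrite /f; case: ifPn => xD /andP[a1 a2].
    split; last by apply: Dtheta; exact/set_mem.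
    by apply/andP; rewrite /theta; split; lra.
  rewrite addr0; split; first by apply/andP; split; lra.
  by move=> Dx; move/negP: xD; apply; exact/mem_set.
have /card_set_bijP[beta [b1 b2 b3]] : ([set: R] #= G)%card.
  apply: Cantor_Bernstein; last exact: subset_card_le.
  apply: (@card_le_trans _ _ _ (f @` [set: R])).
    by have := inj_card_eq (in2W f_inj : {in [set: R] &, injective f}); rewrite card_eq_le => /andP[].
  by apply: subset_card_le => _ [x _ <-].
exists beta; split.
- by move=> x y; apply: b2; rewrite inE.
- by move=> r; apply: b1.
- by move=> t' t'01 nDt'; have [r _ <-] := b3 t' (conj t'01 nDt'); exists r.
Qed.

End ComplementOfCountable.

Theorem propositionB (R : realType) :
  (forall (X : completeNormedModType R) (e : nat -> X),
     reflexive_space X -> symmetric_basis e ->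
   forall (JF : completeNormedModType R) (j : {linear L1 R -> JF}),
     is_JF e j ->
   forall (XR : completeNormedModType R) (u : {linear c00 R R -> XR}),
     is_XGamma e u ->
   forall D : set R, countable_dense01 D ->
     isomorphic (quotient (interval_span j D)) (dual XR))
  /\
  (forall (JF : completeNormedModType R) (j : {linear L1 R -> JF}),
     is_JF (@l2_unit R nat) j ->
   forall D : set R, countable_dense01 D ->
     isomorphic (quotient (interval_span j D)) (l2 R R)).
Proof.
split=> [X e refX symE JF j jJF XR u XRu D cD|JF j jJF D cD].
  have [_ cntD _] := cD; have [beta [b1 b2 b3]] := enumerate_complement cntD.
  apply: (quotient_coordinates (symmetric_basis_lnorm symE) jJF (symmetric_basis_neq0 symE)
    (reflexive_shrinking symE refX) (reflexive_unbounded symE refX) cD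
    (dual_XGamma_coordinates XRu) b1 b2 b3).
have [_ cntD _] := cD; have [beta [b1 b2 b3]] := enumerate_complement cntD.
exact: (quotient_coordinates (l2_unit_symmetric R) jJF (l2_unit_neq0 R) (l2_unit_shrinking (R := R))
  (l2_unit_unbounded (R := R)) cD (l2_dual_coordinates R) b1 b2 b3).
Qed.
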